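(* Let $r\geq 2$ be an integer, let $(\Lambda V,d)$ be a coformal pure elliptic minimal Sullivan model (of a simply-connected space), and let $\mathcal{B}$ be a (homogeneous) basis of $V^{even}$. Then $$(r-1)\cdot \mathrm{cat}(\Lambda V)+ L(\Lambda V,\mathcal{B})\leq \mathrm{TC}_r(\Lambda V).$$
   Context: All spaces are simply-connected CW-complexes of finite type, so Sullivan models are over $\mathbb{Q}$ with $V=V^{\geq 2}$ of finite type. A Sullivan model $(\Lambda V,d)$ is minimal if $dV\subset \Lambda^{\geq 2}V$. It is pure if $dV^{even}=0$ and $dV^{odd}\subset \Lambda V^{even}$; elliptic if $V$ and $H^*(\Lambda V,d)$ are both finite dimensional; coformal if $dV\subset \Lambda^2V$ (the differential is quadratic, i.e. of constant length $2$). Definition of $L(\Lambda V,\mathcal{B})$: write $X=V^{even}$, $Y=V^{odd}$ and $\mathcal{B}=\{x_1,\dots,x_n\}$. Extend $(\Lambda V,d)$ to the model $(\Lambda W_{\mathcal{B}},d)=(\Lambda(V\oplus U),d)$, where $U$ has basis $u_1,\dots,u_n$ of odd degrees with $du_i=x_i^2$. Since $d$ is quadratic it splits into operators $d_{p,q}:\Lambda^pX\otimes\Lambda^q(Y\oplus U)\to\Lambda^{p+2}X\otimes\Lambda^{q-1}(Y\oplus U)$, which induce a bigraded cohomology $H_{p,q}(\Lambda W_{\mathcal{B}})$ (classes represented by cocycles in $\Lambda^pX\otimes\Lambda^q(Y\oplus U)$). Then $$L(\Lambda V,\mathcal{B})=\max\{i:\ [z_1]\cdots[z_i]\neq 0 \text{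 for some } [z_1],\dots,[z_i]\in H_{odd,*}(\Lambda W_{\mathcal{B}})\},$$ where $H_{odd,*}$ refers to odd $p$. $\mathrm{cat}(\Lambda V)$ is the rational Lusternik–Schnirelmann category $\mathrm{cat}(Z_0)$ (normalized so that a point has category $0$), where $Z_0$ is the rational space with minimal model $(\Lambda V,d)$; equivalently (Félix–Halperin) the least $n$ such that the projection $\Lambda V\to \Lambda V/\Lambda^{>n}V$ admits a homotopy retraction. For a space $Z$, $\mathrm{TC}_r(Z)$ is the least $n$ such that $Z^r$ is covered by $n+1$ open sets on each of which the evaluation map $Z^{[0,1]}\to Z^r$, $\gamma\mapsto(\gamma(0),\gamma(\tfrac1{r-1}),\dots,\gamma(\tfrac{r-2}{r-1}),\gamma(1))$ has a continuous local section. One writes $\mathrm{TC}_r(\Lambda V)=\mathrm{TC}_r(Z_0)$. By a theorem of Carrasquel, $\mathrm{TC}_r(\Lambda V)$ is equivalently the least $n$ such that the projection $\rho^r_n:(\Lambda V)^{\otimes r}\to (\Lambda V)^{\otimes r}/(\ker \mu^r_{\Lambda V})^{n+1}$ admits a homotopy retraction, where $\mu^r_{\Lambda V}:(\Lambda V)^{\otimes r}\to\Lambda V$ is the multiplication. A morphism $\rho:A\to B$ of commutative differential graded algebras (cdga's) admits a homotopy retraction if, for a relative Sullivan model $A\xrightarrow{i} A\otimes\Lambda W\xrightarrow{\simeq}B$ of $\rho$, there is a cdga morphism $\tau:A\otimes\Lambda W\to A$ with $\tau\circ i=\mathrm{id}_A$. *)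

(* Defs.v *)
From HB Require Import structures.
From mathcomp Require Import all_boot all_order all_algebra.
From mathcomp Require Import boolp classical_sets constructive_ereal.

Set Implicit Arguments.
Unset Strict Implicit.
Unset Printing Implicit Defensive.

Import Order.TTheory GRing.Theory Num.Theory.
Local Open Scope classical_set_scope.
Local Open Scope ring_scope.

Section LinearAlgebra.
Variable M : lmodType rat.

Definition lspan (S : set M) : set M :=
  [set z | exists (n : nat) (c : 'I_n -> rat) (v : 'I_n -> M),
     (forall i, S (v i)) /\ z = \sum_i c i *: v i].

Definition lin_indep (n : nat) (v : 'I_n -> M) : Prop :=
  forall c : 'I_n -> rat, \sum_i c i *: v i = 0 -> forall i, c i = 0.

Definition fin_dim (S : set M) : Prop :=
  exists s : seq M, S `<=` lspan [set` s].

Definition multilinear (r : nat) (N : lmodType rat) (phi : ('I_r -> M) -> N) :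
    Prop :=
  forall (k : 'I_r) (c : rat) (f g h : 'I_r -> M),
    (forall j, j != k -> h j = f j /\ h j = g j) ->
    h k = c *: f k + g k ->
    phi h = c *: phi f + phi g.

End LinearAlgebra.

(* Graded-commutative algebras over Q, graded by the natural numbers; [gr k]
   is the component of degree k, and the carrier is the direct sum of the
   components. *)
Record gca := Gca {
  gca_sort :> algType rat;
  gr : nat -> set gca_sort;
  gr0 : forall k, gr k 0;
  grL : forall k (c : rat) x y, gr k x -> gr k y -> gr k (c *: x + y);
  gr_sum : forall x, exists (N : nat) (f : nat -> gca_sort),
    (forall k, gr k (f k)) /\ x = \sum_(k < N) f k;
  gr_direct : forall (N : nat) (f : nat -> gca_sort),
    (forall k, gr k (f k)) -> \sum_(k < N) f k = 0 ->
    forall k, (k < N)%N -> f k = 0;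
  gr1 : gr 0%N 1;
  grM : forall i j x y, gr i x -> gr j y -> gr (i + j)%N (x * y);
  grC : forall i j x y, gr i x -> gr j y -> x * y = (-1) ^+ (i * j) * (y * x)
}.

Record cdga := Cdga {
  cdga_gca :> gca;
  diff : cdga_gca -> cdga_gca;
  diffL : forall (c : rat) x y, diff (c *: x + y) = c *: diff x + diff y;
  diff_gr : forall k x, gr k x -> gr k.+1 (diff x);
  diffM : forall k x y, gr k x ->
    diff (x * y) = diff x * y + (-1) ^+ k * (x * diff y);
  diffK : forall x, diff (diff x) = 0
}.

Record gmor (A B : gca) := Gmor {
  gmor_fun :> {lrmorphism A -> B};
  gmor_gr : forall k x, gr k x -> gr k (gmor_fun x)
}.

Record dmor (A B : cdga) := Dmor {
  dmor_gmor :> gmor A B;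
  dmor_diff : forall x, dmor_gmor (diff x) = diff (dmor_gmor x)
}.

Definition cocycle (A : cdga) : set A := [set z | diff z = 0].
Definition coboundary (A : cdga) : set A := range (@diff A).

Definition quasi_iso (A B : cdga) (f : dmor A B) : Prop :=
  (forall z, cocycle z -> coboundary (f z) -> coboundary z) /\
  (forall b, cocycle b -> exists z, cocycle z /\ coboundary (b - f z)).

(* The field Q as a cdga concentrated in degree 0, and its unit into A. *)
Section BaseField.

Let algQ := [the algType rat of rat^o].

Let grQ (k : nat) : set algQ := [set x | k = 0%N \/ x = 0].

Fact grQ0 k : grQ k 0. Proof. by right. Qed.

Fact grQL k (c : rat) (x y : algQ) :
  grQ k x -> grQ k y -> grQ k (c *: x + y).
Proof.
move=> [->|->]; first by left.
by move=> [->|->]; [left|right; rewrite scaler0 addr0].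
Qed.

Fact grQ_sum (x : algQ) :
  exists (N : nat) (f : nat -> algQ),
    (forall k, grQ k (f k)) /\ x = \sum_(k < N) f k.
Proof.
exists 1%N, (fun k => if k is 0%N then x else 0); split.
  by case=> [|k]; [left|right].
by rewrite big_ord1.
Qed.

Fact grQ_direct (N : nat) (f : nat -> algQ) :
  (forall k, grQ k (f k)) -> \sum_(k < N) f k = 0 ->
  forall k, (k < N)%N -> f k = 0.
Proof.
case: N => [//|N] fgr.
rewrite big_ord_recl big1 ?addr0; last by move=> i _; case: (fgr (lift ord0 i)).
move=> f0 [|k] _; first exact: f0.
by case: (fgr k.+1).
Qed.

Fact grQ1 : grQ 0%N 1. Proof. by left. Qed.

Fact grQM i j (x y : algQ) :
  grQ i x -> grQ j y -> grQ (i + j)%N (x * y).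
Proof.
move=> [->|->]; last by right; rewrite mul0r.
by move=> [->|->]; [left|right; rewrite mulr0].
Qed.

Fact grQC i j (x y : algQ) :
  grQ i x -> grQ j y -> x * y = (-1) ^+ (i * j) * (y * x).
Proof.
move=> [->|->]; last by rewrite !(mul0r, mulr0).
move=> _; rewrite mul0n; transitivity (y * x); first exact: (@mulrC rat).
exact/esym/mul1r.
Qed.

Definition gcaQ : gca := Gca grQ0 grQL grQ_sum grQ_direct grQ1 grQM grQC.

Fact diffQL (c : rat) (x y : gcaQ) : (0 : gcaQ) = c *: 0 + 0.
Proof. by rewrite scaler0 addr0. Qed.

Fact diffQ_gr k (x : gcaQ) : gr k x -> gr k.+1 (0 : gcaQ).
Proof. by right. Qed.

Fact diffQM k (x y : gcaQ) : gr k x -> 0 = 0 * y + (-1) ^+ k * (x * 0).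
Proof. by rewrite mul0r !mulr0 addr0. Qed.

Definition cdgaQ : cdga :=
  @Cdga gcaQ (fun=> 0) diffQL diffQ_gr diffQM (fun=> erefl).

Variable A : cdga.

Let unit_fun (c : cdgaQ) : A := in_alg A c.

Fact unit_is_nmod_morphism : nmod_morphism unit_fun.
Proof. by split; [exact: rmorph0 | exact: rmorphD]. Qed.
Fact unit_is_monoid_morphism : monoid_morphism unit_fun.
Proof. by split; [exact: rmorph1 | exact: rmorphM]. Qed.
Fact unit_is_scalable : scalable unit_fun.
Proof. by move=> c x; rewrite /unit_fun /= scalerA. Qed.

Let unit_lrmorphism : {lrmorphism cdgaQ -> A} :=
  HB.pack_for {lrmorphism cdgaQ -> A} unit_fun
    (GRing.isNmodMorphism.Build cdgaQ A unit_fun unit_is_nmod_morphism)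
    (GRing.isMonoidMorphism.Build cdgaQ A unit_fun unit_is_monoid_morphism)
    (GRing.isScalable.Build rat cdgaQ A *:%R unit_fun unit_is_scalable).

Fact unit_gr k (c : cdgaQ) : gr k c -> gr k (unit_fun c).
Proof.
move=> [->|->]; rewrite /unit_fun /=; last by rewrite scale0r; exact: gr0.
by rewrite -[_ *: _]addr0; apply: grL; [exact: gr1 | exact: gr0].
Qed.

Fact unit_diff (c : cdgaQ) : unit_fun (diff c) = diff (unit_fun c).
Proof.
rewrite /unit_fun /= scale0r.
have d0 : diff (0 : A) = 0.
  have := diffL 1 (0 : A) 0; rewrite !scale1r addr0 => d00.
  by apply: (addrI (diff (0 : A))); rewrite addr0.
have d1 : diff (1 : A) = 0.
  have := diffM (1 : A) (gr1 A); rewrite !(mulr1, mul1r) => d11.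
  by apply: (addrI (diff (1 : A))); rewrite addr0.
by have := diffL c (1 : A) 0; rewrite addr0 d1 d0 scaler0 addr0.
Qed.

Definition unit_mor : dmor cdgaQ A :=
  @Dmor cdgaQ A (@Gmor cdgaQ A unit_lrmorphism unit_gr) unit_diff.

End BaseField.

Section Subspaces.
Variable A : gca.

(* Span of the homogeneous elements of [S] of degree satisfying [P]. *)
Definition hpart (P : pred nat) (S : set A) : set A :=
  lspan [set x | S x /\ exists2 k, P k & gr k x].

(* [graded xpredT S] says that S is a graded subspace; in general,
   [graded P S] says moreover that S is concentrated in the degrees in [P]. *)
Definition graded (P : pred nat) (S : set A) : Prop := S = hpart P S.

Definition even_part (S : set A) : set A := hpart (fun k => ~~ odd k) S.
Definition odd_part (S : set A) : set A := hpart odd S.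

(* Span of the products of [p] elements of [S]: if A is free on V,
   [wpow V p] is Lambda^p V; if I is an ideal and p > 0, [wpow I p] is I^p. *)
Definition wpow (S : set A) (p : nat) : set A :=
  lspan [set z | exists v : 'I_p -> A,
                   (forall i, S (v i)) /\ z = \prod_(i < p) v i].

Definition wpow_if (P : pred nat) (S : set A) : set A :=
  lspan [set z | exists2 p, P p & wpow S p z].

Definition hom_basis (S : set A) (n : nat) (x : 'I_n -> A) : Prop :=
  [/\ forall i, exists k, gr k (x i), lin_indep x & S = lspan (range x)].

End Subspaces.

(* E = A (x) Lambda W as a graded algebra: E is the free graded-commutative
   A-algebra on the graded subspace W of E. *)
Definition free_ext (A E : gca) (iota : gmor A E) (W : set E) : Prop :=
  graded xpredT W /\
  forall (C : gca) (f : gmor A C) (g : E -> C),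
    (forall (c : rat) x y, W x -> W y -> g (c *: x + y) = c *: g x + g y) ->
    (forall k x, W x -> gr k x -> gr k (g x)) ->
    exists h : gmor E C,
      [/\ forall a, h (iota a) = f a,
          forall w, W w -> h w = g w &
          forall h' : gmor E C, (forall a, h' (iota a) = f a) ->
            (forall w, W w -> h' w = g w) -> forall e, h' e = h e].

(* The image of A (x) Lambda S in E. *)
Definition ext_span (A E : gca) (iota : gmor A E) (S : set E) : set E :=
  lspan [set z | exists a b, wpow_if xpredT S b /\ z = iota a * b].

Definition relative_sullivan (A E : cdga) (iota : dmor A E) (W : set E) :
    Prop :=
  [/\ free_ext iota W, graded (leq 1) W &
      exists F : nat -> set E,
        [/\ forall k, graded xpredT (F k),
            forall k, F k `<=` F k.+1,
            W = \bigcup_k F k,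
            (forall w, F 0%N w -> range iota (diff w)) &
            forall k w, F k.+1 w -> ext_span iota (F k) (diff w)]].

(* (A, d) = (Lambda V, d), with V of finite type and concentrated in
   degrees >= 2. *)
Definition sullivan_model (A : cdga) (V : set A) : Prop :=
  [/\ relative_sullivan (unit_mor A) V, graded (leq 2) V &
      forall k, fin_dim [set x | V x /\ gr k x]].

Definition minimal (A : cdga) (V : set A) : Prop :=
  forall v, V v -> wpow_if (leq 2) V (diff v).

Definition coformal (A : cdga) (V : set A) : Prop :=
  forall v, V v -> wpow V 2 (diff v).

Definition pure (A : cdga) (V : set A) : Prop :=
  (forall x, even_part V x -> diff x = 0) /\
  (forall y, odd_part V y -> wpow_if xpredT (even_part V) (diff y)).

Definition fin_dim_cohomology (A : cdga) : Prop :=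
  exists s : seq A, [set` s] `<=` @cocycle A /\
    forall z, cocycle z -> exists2 w, lspan [set` s] w & coboundary (z - w).

Definition elliptic (A : cdga) (V : set A) : Prop :=
  fin_dim V /\ fin_dim_cohomology A.

Definition homotopy_retraction (A B : cdga) (rho : dmor A B) : Prop :=
  exists (E : cdga) (iota : dmor A E) (W : set E) (phi : dmor E B)
         (tau : dmor E A),
    [/\ relative_sullivan iota W, quasi_iso phi,
        forall a, phi (iota a) = rho a &
        forall a, tau (iota a) = a].

(* A surjective morphism with kernel I presents its target as A / I, so the
   following says that the projection A -> A / I admits a homotopy
   retraction. *)
Definition proj_retraction (A : cdga) (I : set A) : Prop :=
  exists (B : cdga) (rho : dmor A B),
    [/\ forall b, exists a, rho a = b,
        forall a, rho a = 0 <-> I a &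
        homotopy_retraction rho].

(* T is the r-fold tensor power of A, with pure tensors
   a_1 (x) ... (x) a_r = iota_1 a_1 * ... * iota_r a_r: they are universal for
   multilinear maps, and the grading, product and differential of T are
   determined by the iota_k being morphisms of cdga's. *)
Definition tensor_power (r : nat) (A T : cdga) (iota : 'I_r -> dmor A T) :
    Prop :=
  forall (M : lmodType rat) (phi : ('I_r -> A) -> M), multilinear phi ->
    exists h : {linear T -> M},
      (forall a, h (\prod_(k < r) iota k (a k)) = phi a) /\
      forall h' : {linear T -> M},
        (forall a, h' (\prod_(k < r) iota k (a k)) = phi a) ->
        forall t, h' t = h t.

(* cat(Lambda V) <= n, as characterised by Felix and Halperin. *)
Definition LScat_le (A : cdga) (V : set A) (n : nat) : Prop :=
  proj_retraction (wpow_if (leq n.+1) V).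

(* TC_r(Lambda V) <= n, as characterised by Carrasquel; mu is the
   multiplication morphism from the r-fold tensor power of A to A. *)
Definition TC_le (r : nat) (A : cdga) (n : nat) : Prop :=
  exists (T : cdga) (iota : 'I_r -> dmor A T) (mu : dmor T A),
    [/\ tensor_power iota,
        forall k a, mu (iota k a) = a &
        proj_retraction (wpow [set t | mu t = 0] n.+1)].

(* E = Lambda (V + U), where U has basis u_1, ..., u_n and d u_i = x_i ^ 2. *)
Definition square_ext (A : cdga) (n : nat) (x : 'I_n -> A) (E : cdga)
    (iota : dmor A E) (u : 'I_n -> E) : Prop :=
  [/\ free_ext iota (lspan (range u)), lin_indep u,
      forall i k, gr k (x i) -> gr (2 * k).-1 (u i) &
      forall i, diff (u i) = iota (x i) ^+ 2].

(* Lambda^p X (x) Lambda^q (Y + U), where X = V^even and Y = V^odd. *)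
Definition bideg (A E : cdga) (V : set A) (iota : dmor A E) (n : nat)
    (u : 'I_n -> E) (p q : nat) : set E :=
  lspan [set z | exists a b, [/\ wpow (iota @` even_part V) p a,
    wpow [set e | exists y w, [/\ odd_part V y, lspan (range u) w &
                                  e = iota y + w]] q b & z = a * b]].

(* Cocycles whose class lies in H_(odd, * ). *)
Definition odd_cocycle (A E : cdga) (V : set A) (iota : dmor A E) (n : nat)
    (u : 'I_n -> E) : set E :=
  [set z | cocycle z /\
     lspan [set y | exists p q, odd p /\ bideg V iota u p q y] z].

(* The empty product (i = 0) is 1. *)
Definition has_odd_product (A : cdga) (V : set A) (n : nat) (x : 'I_n -> A)
    (i : nat) : Prop :=
  exists (E : cdga) (iota : dmor A E) (u : 'I_n -> E) (z : 'I_i -> E),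
    [/\ square_ext x iota u, forall j, odd_cocycle V iota u (z j) &
        ~ coboundary (\prod_(j < i) z j)].

(* The natural number satisfying Q, and +oo if there is none. *)
Definition the_nat (Q : set nat) : \bar int :=
  if pselect (exists n, Q n) is left h then (Posz (sval (cid h)))%:E else +oo%E.

Definition nat_min (P : set nat) : \bar int :=
  the_nat [set n | P n /\ forall m, P m -> (n <= m)%N].

Definition nat_max (P : set nat) : \bar int :=
  the_nat [set n | P n /\ forall m, P m -> (m <= n)%N].

Definition LScat (A : cdga) (V : set A) : \bar int := nat_min (LScat_le V).

Definition TC (r : nat) (A : cdga) : \bar int := nat_min (TC_le r A).

Definition Lprod (A : cdga) (V : set A) (n : nat) (x : 'I_n -> A) : \bar int :=
  nat_max (has_odd_product V x).

(* Main.v *)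
Require Import Defs.
From HB Require Import structures.
From mathcomp Require Import all_boot all_order all_algebra.
From mathcomp Require Import boolp classical_sets constructive_ereal.
From mathcomp Require Import ring lra zify.
Import Order.TTheory GRing.Theory Num.Theory.
Local Open Scope classical_set_scope.
Local Open Scope ring_scope.

Set Implicit Arguments.
Unset Strict Implicit.
Unset Printing Implicit Defensive.

(** The inequality passes through the number m of odd generators of
    Lambda V:
      cat(Lambda V) <= m   and   (r - 1) m + L <= TC_r(Lambda V).
    The empty product shows that L is a number once it is bounded, and if TC_r
    is infinite the inequality is trivial.

    Lower bound for TC_r ([TC_lower]).  Let T be the r-th tensor power, with
    copies x_p^(k), y_j^(k) of the even and odd generators for k = 0, ..., r-1,
    and let I be the kernel of the multiplication.  If TC_r <= N, a cocycle of
    T mapped to 0 in T / I^(N+1) is a coboundary ([retractable_exact]), and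
    this remains so after adjoining odd generators to T and to the quotient
    ([retractable_odd]): every cocycle in I^(N+1) M is a coboundary in M, for M
    any tower of odd extensions of T.  Take M = T[w, u] with
      d w_(k,p) = x_p^(0) + x_p^(k),   d u_p = h_p^2,
      h_p = (x_p^(0) - x_p^(1)) / 2.
    Modulo the elements x_p^(0) + x_p^(k) a quadratic polynomial takes the
    same values at x^(0), at x^(k) = - x^(0) and (for k = 1) at h.  So
    y_j^(0) - y_j^(k) can be corrected by multiples of the w_(k,p) into
    cocycles, and these lie in the ideal I M.
    For the same reason x_p |-> h_p extends to a morphism G from Lambda W_B to
    M; as h_p is in I, it sends the classes of odd bidegree into I M.  So
    L classes with nonzero product and the (r - 1) m corrected elements give a
    cocycle in I^((r-1)m+L) M.  It is not a coboundary: the morphism that is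
    the identity on the factor 0 and sends x^(k) to -x, y^(k) to y - e_k with
    new closed odd elements e_(k,j), and w to 0, maps it to the product of the
    given classes with all the e_(k,j).  Hence (r - 1) m + L <= N.

    Upper bound for cat ([LScat_upper]).  The differential raises word length
    by one, so word length grades the cohomology.  Call an algebra with such a
    grading vanishing above c if its cohomology is zero in word lengths greater
    than c ([vanish]).  The algebra Q[x_i][u_i] with d u_i = x_i^2 vanishes
    above n, each odd generator with quadratic differential raises the bound
    by at most one ([vanish_square], [vanish_odd]), and Lambda V [u_1, ..., u_n]
    is a retract of such an algebra, so it vanishes above n + m.  Because
    H(Lambda V) is finite dimensional, the u_i can be removed again, each one
    lowering the bound by one ([vanish_odd_conv]): Lambda V vanishes above m
    ([md_vanish]).  Let J be the sum of Lambda^(>m) V and of a complement of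
    the cocycles in Lambda^m V; it is an ideal, and every cocycle of J bounds
    in J.  Now build a relative Sullivan model of
    Lambda V -> Lambda V / Lambda^(>m) V by killing the cohomology of the
    kernel one class at a time ([killing_model]); a retraction which maps the
    kernel into J can be extended to each new generator, because the cocycle
    to be bounded lies in J. *)

(** * Algebras from explicit operations *)

(** One record for the ring and module axioms, so that each of the four
    algebras built below (odd and even extensions, quotients, colimits) is
    obtained from a single proof of laws about plain functions. *)
Record alg_laws (T : Type) (zero one : T) (opp : T -> T) (add mul : T -> T -> T)
    (scale : rat -> T -> T) : Prop := AlgLaws {
  al_addA : associative add;
  al_addC : commutative add;
  al_add0 : left_id zero add;
  al_addN : left_inverse zero opp add;
  al_mulA : associative mul;
  al_mul1 : left_id one mul;
  al_1mul : right_id one mul;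
  al_mulDl : left_distributive mul add;
  al_mulDr : right_distributive mul add;
  al_scA : forall a b v, scale a (scale b v) = scale (a * b) v;
  al_sc1 : left_id 1 scale;
  al_scDr : right_distributive scale add;
  al_scDl : forall v a b, scale (a + b) v = add (scale a v) (scale b v);
  al_nz : one <> zero;
  al_scAl : forall a u v, scale a (mul u v) = mul (scale a u) v;
  al_scAr : forall a u v, scale a (mul u v) = mul u (scale a v)
}.

Section MkAlg.
Variables (T : Type) (zero one : T) (opp : T -> T) (add mul : T -> T -> T)
          (scale : rat -> T -> T).
Hypothesis ax : alg_laws zero one opp add mul scale.

(** A name for T that depends on the proof of the laws: the canonical
    structures attach to this name, so that two algebras on the same type do
    not clash. *)
Definition alg_carrier of alg_laws zero one opp add mul scale := T.
Local Notation C := (alg_carrier ax).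

HB.instance Definition _ := gen_eqMixin C.
HB.instance Definition _ := gen_choiceMixin C.
HB.instance Definition _ := @GRing.isZmodule.Build C zero opp add
  (al_addA ax) (al_addC ax) (al_add0 ax) (al_addN ax).
Fact alg_carrier_nz : one != zero :> C.
Proof. by apply/eqP; exact: al_nz ax. Qed.
HB.instance Definition _ := @GRing.Zmodule_isNzRing.Build C one mul
  (al_mulA ax) (al_mul1 ax) (al_1mul ax) (al_mulDl ax) (al_mulDr ax) alg_carrier_nz.
HB.instance Definition _ := @GRing.Zmodule_isLmodule.Build rat C scale
  (al_scA ax) (al_sc1 ax) (al_scDr ax) (al_scDl ax).
HB.instance Definition _ := @GRing.LSemiModule_isLSemiAlgebra.Build rat C (al_scAl ax).
HB.instance Definition _ := @GRing.LSemiAlgebra_isSemiAlgebra.Build rat C (al_scAr ax).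
Definition mk_alg : algType rat := C.
End MkAlg.

Section MkMor.
Variables (A B : gca) (f : A -> B).
Hypotheses (fL : forall (c : rat) x y, f (c *: x + y) = c *: f x + f y)
  (f1 : f 1 = 1) (fM : forall x y, f (x * y) = f x * f y)
  (fgr : forall k x, gr k x -> gr k (f x)).
Let f0 : f 0 = 0.
Proof. by have := fL (-1) 0 0; rewrite scaler0 addr0 scaleN1r addNr. Qed.
Fact mk_mor_nmod : nmod_morphism f.
Proof. by split=> // x y; have := fL 1 x y; rewrite !scale1r. Qed.
Fact mk_mor_monoid : monoid_morphism f.
Proof. by split. Qed.
Fact mk_mor_scal : scalable f.
Proof. by move=> c x; have := fL c x 0; rewrite f0 !addr0. Qed.
Definition mk_mor_lr : {lrmorphism A -> B} :=
  HB.pack_for {lrmorphism A -> B} f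
    (GRing.isNmodMorphism.Build A B f mk_mor_nmod)
    (GRing.isMonoidMorphism.Build A B f mk_mor_monoid)
    (GRing.isScalable.Build rat A B *:%R f mk_mor_scal).
Definition mk_mor : gmor A B := @Gmor A B mk_mor_lr fgr.
Lemma mk_morE x : mk_mor x = f x. Proof. by []. Qed.
End MkMor.

Definition mk_dmor (A B : cdga) (f : gmor A B)
  (fd : forall x, f (diff x) = diff (f x)) : dmor A B := @Dmor A B f fd.

Definition gcomp (A B C : gca) (g : gmor B C) (f : gmor A B) : gmor A C.
Proof.
refine (@mk_mor A C (fun x => g (f x)) _ _ _ _).
- by move=> c x y; rewrite !linearP.
- by rewrite !rmorph1.
- by move=> x y; rewrite !rmorphM.
- by move=> k x /gmor_gr /gmor_gr.
Defined.

Definition gid (A : gca) : gmor A A.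
Proof. by refine (@mk_mor A A id _ _ _ _). Defined.

Definition dcomp (A B C : cdga) (g : dmor B C) (f : dmor A B) : dmor A C.
Proof. by refine (@mk_dmor A C (gcomp g f) _) => x; rewrite /= !dmor_diff. Defined.

Definition did (A : cdga) : dmor A A.
Proof. by refine (@mk_dmor A A (gid A) _). Defined.

Lemma gcompE (A B C : gca) (g : gmor B C) (f : gmor A B) x : gcomp g f x = g (f x).
Proof. by []. Qed.
Lemma dcompE (A B C : cdga) (g : dmor B C) (f : dmor A B) x : dcomp g f x = g (f x).
Proof. by []. Qed.
Lemma gidE (A : gca) x : gid A x = x. Proof. by []. Qed.
Lemma didE (A : cdga) x : did A x = x. Proof. by []. Qed.
Lemma mk_dmorE (A B : cdga) (f : gmor A B) fd x : @mk_dmor A B f fd x = f x.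
Proof. by []. Qed.

Section Diff.
Variable R : cdga.
Implicit Types x y : R.
Lemma diff0 : diff (0 : R) = 0.
Proof. by have := diffL (-1) (0 : R) 0; rewrite scaler0 addr0 scaleN1r addNr. Qed.
Lemma diffD x y : diff (x + y) = diff x + diff y.
Proof. by have := diffL 1 x y; rewrite !scale1r. Qed.
Lemma diffZ c x : diff (c *: x) = c *: diff x.
Proof. by have := diffL c x 0; rewrite diff0 !addr0. Qed.
Lemma diffN x : diff (- x) = - diff x.
Proof. by rewrite -scaleN1r diffZ scaleN1r. Qed.
Lemma diffB x y : diff (x - y) = diff x - diff y.
Proof. by rewrite diffD diffN. Qed.
Lemma diff_sum I (s : seq I) (P : pred I) (F : I -> R) :
  diff (\sum_(i <- s | P i) F i) = \sum_(i <- s | P i) diff (F i).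
Proof. by elim/big_rec2: _ => [|i a b _ <-]; rewrite ?diff0 ?diffD. Qed.
Lemma diff1 : diff (1 : R) = 0.
Proof.
have := diffM (1 : R) (gr1 R); rewrite expr0 !(mul1r, mulr1) => h.
by apply: (addrI (diff (1 : R))); rewrite addr0 -h.
Qed.
End Diff.

(** * Homogeneous components and the sign involution *)

Section Grading.
Variable A : gca.
Implicit Types x y : A.

Lemma grD k x y : gr k x -> gr k y -> gr k (x + y).
Proof. by move=> hx hy; rewrite -[x]scale1r; apply: grL. Qed.
Lemma grZ k c x : gr k x -> gr k (c *: x).
Proof. by move=> hx; rewrite -[_ *: _]addr0; apply: grL => //; exact: gr0. Qed.
Lemma grN k x : gr k x -> gr k (- x).
Proof. by rewrite -scaleN1r; exact: grZ. Qed.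
Lemma grB k x y : gr k x -> gr k y -> gr k (x - y).
Proof. by move=> hx hy; apply: grD => //; apply: grN. Qed.
Lemma gr_bigsum k I (s : seq I) (P : pred I) (F : I -> A) :
  (forall i, P i -> gr k (F i)) -> gr k (\sum_(i <- s | P i) F i).
Proof. by move=> h; apply: big_ind => //; [exact: gr0 | exact: grD]. Qed.

(** A decomposition padded by zeros, so that it may be summed up to any large
    enough bound; comparing two elements then needs no reindexing. *)
Lemma gr_dec x : { Nf : nat * (nat -> A) |
  [/\ forall k, gr k (Nf.2 k), forall k, (Nf.1 <= k)%N -> Nf.2 k = 0 &
      forall M, (Nf.1 <= M)%N -> x = \sum_(k < M) Nf.2 k] }.
Proof.
apply: cid; have [N [f [fgr ->]]] := gr_sum x.
exists (N, fun k => if (k < N)%N then f k else 0); split => /=.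
- by move=> k; case: ifP => // _; exact: gr0.
- by move=> k; rewrite leqNgt => /negbTE ->.
- move=> M NM; rewrite [LHS](big_ord_widen M f NM) big_mkcond /=.
  by apply: eq_bigr.
Qed.

Definition hcomp (k : nat) (x : A) : A := (sval (gr_dec x)).2 k.
Definition bnd (x : A) : nat := (sval (gr_dec x)).1.

Lemma gr_hcomp k x : gr k (hcomp k x).
Proof. by rewrite /hcomp; case: (gr_dec x) => [[N f] []]. Qed.
Lemma hcomp_big k x : (bnd x <= k)%N -> hcomp k x = 0.
Proof. by rewrite /hcomp /bnd; case: (gr_dec x) => [[N f] [] ? h ?]; exact: h. Qed.
Lemma hcomp_sumE x M : (bnd x <= M)%N -> x = \sum_(k < M) hcomp k x.
Proof. by rewrite /hcomp /bnd; case: (gr_dec x) => [[N f] [] ? ? h]; exact: h. Qed.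

Lemma hcomp_uniq M (f : nat -> A) : (forall k, gr k (f k)) ->
  forall k, (k < M)%N -> hcomp k (\sum_(k < M) f k) = f k.
Proof.
move=> fgr k kM; set x := \sum_(_ < _) _.
pose f' k := if (k < M)%N then f k else 0.
have f'gr i : gr i (f' i) by rewrite /f'; case: ifP => // _; exact: gr0.
pose L := maxn M (bnd x).
have e : \sum_(k < L) (hcomp k x - f' k) = 0.
  rewrite sumrB -hcomp_sumE ?leq_maxr // /x.
  rewrite (big_ord_widen L f (leq_maxl _ _)) big_mkcond /=.
  by rewrite -sumrB big1 // => i _; rewrite /f' subrr.
have := gr_direct (fun k => grB (gr_hcomp k x) (f'gr k)) e.
move=> /(_ k) /(_ (leq_trans kM (leq_maxl _ _))) /eqP.
by rewrite subr_eq0 /f' kM => /eqP.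
Qed.

Lemma hcompL k c x y : hcomp k (c *: x + y) = c *: hcomp k x + hcomp k y.
Proof.
pose L := maxn k.+1 (maxn (bnd x) (bnd y)).
have Lx : (bnd x <= L)%N by rewrite /L; lia.
have Ly : (bnd y <= L)%N by rewrite /L; lia.
have -> : c *: x + y = \sum_(i < L) (c *: hcomp i x + hcomp i y).
  by rewrite big_split /= -scaler_sumr -!hcomp_sumE.
rewrite (hcomp_uniq (f := fun i => c *: hcomp i x + hcomp i y)) //.
  by move=> i; apply: grL; exact: gr_hcomp.
by rewrite /L; lia.
Qed.

Lemma hcomp_is_linear k : linear (hcomp k).
Proof. by move=> c x y; rewrite hcompL. Qed.
HB.instance Definition _ k := GRing.isLinear.Build rat A A *:%R (hcomp k)
  (hcomp_is_linear k).

Lemma hcomp0 k : hcomp k 0 = 0. Proof. exact: linear0. Qed.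
Lemma hcompD k x y : hcomp k (x + y) = hcomp k x + hcomp k y.
Proof. exact: linearD. Qed.
Lemma hcompZ k c x : hcomp k (c *: x) = c *: hcomp k x.
Proof. exact: linearZ. Qed.

Lemma hcomp_gr k i x : gr i x -> hcomp k x = if k == i then x else 0.
Proof.
move=> hx.
pose f j := if j == i then x else 0.
have fgr j : gr j (f j) by rewrite /f; case: eqP => [->|_] //; exact: gr0.
pose M := (maxn k i).+1.
have e : x = \sum_(j < M) f j.
  have iM : (i < M)%N by rewrite /M; lia.
  rewrite (bigD1 (Ordinal iM)) //= /f eqxx big1 ?addr0 // => j.
  by rewrite -val_eqE /= => /negbTE ->.
by rewrite {1}e hcomp_uniq // /M; lia.
Qed.

Lemma hcomp_id k x : gr k x -> hcomp k x = x.
Proof. by move=> /(hcomp_gr k); rewrite eqxx. Qed.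

Lemma hcomp_inj x y : (forall k, hcomp k x = hcomp k y) -> x = y.
Proof.
move=> h; pose L := maxn (bnd x) (bnd y).
rewrite (@hcomp_sumE x L) ?leq_maxl // (@hcomp_sumE y L) ?leq_maxr //.
by apply: eq_bigr.
Qed.

Lemma gr_ind (P : A -> Prop) : P 0 -> (forall x y, P x -> P y -> P (x + y)) ->
  (forall k x, gr k x -> P x) -> forall x, P x.
Proof.
move=> P0 PD Pg x; rewrite (hcomp_sumE (leqnn (bnd x))).
by apply: big_ind => // i _; apply: Pg (gr_hcomp _ _).
Qed.

Lemma gr_disj k i x : gr k x -> gr i x -> k != i -> x = 0.
Proof. by move=> hk hi ki; rewrite -(hcomp_id hk) (hcomp_gr k hi) (negbTE ki). Qed.

(** The algebra endomorphism acting on degree k as l ^ k. At l = -1 it is the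
    sign involution, which turns the sign rules of a graded algebra into
    identities valid for all elements; at l = 2 it detects degrees. *)
Definition sc (l : rat) (x : A) : A := \sum_(k < bnd x) l ^+ k *: hcomp k x.

Lemma scE l x M : (bnd x <= M)%N -> sc l x = \sum_(k < M) l ^+ k *: hcomp k x.
Proof.
move=> h; rewrite /sc (big_ord_widen M (fun k => l ^+ k *: hcomp k x) h).
rewrite big_mkcond; apply: eq_bigr => i _; case: ifPn => //.
by rewrite -leqNgt => /hcomp_big ->; rewrite scaler0.
Qed.

Lemma sc_is_linear l : linear (sc l).
Proof.
move=> c x y; pose L := maxn (bnd (c *: x + y)) (maxn (bnd x) (bnd y)).
rewrite !(@scE l _ L); [|by rewrite /L; lia..].
rewrite scaler_sumr -big_split /=; apply: eq_bigr => i _.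
by rewrite linearP scalerDr !scalerA [c * _]mulrC.
Qed.
HB.instance Definition _ l := GRing.isLinear.Build rat A A *:%R (sc l)
  (sc_is_linear l).

Lemma sc0 l : sc l 0 = 0. Proof. exact: linear0. Qed.
Lemma scD l x y : sc l (x + y) = sc l x + sc l y.
Proof. exact: linearD. Qed.
Lemma scZ l c x : sc l (c *: x) = c *: sc l x.
Proof. exact: linearZ. Qed.

Lemma scN l x : sc l (- x) = - sc l x. Proof. exact: linearN. Qed.
Lemma scB l x y : sc l (x - y) = sc l x - sc l y. Proof. exact: linearB. Qed.

Lemma sc_gr l k x : gr k x -> sc l x = l ^+ k *: x.
Proof.
move=> hx; rewrite (@scE l x (maxn (bnd x) k.+1)) ?leq_maxl //.
have kM : (k < maxn (bnd x) k.+1)%N by lia.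
rewrite (bigD1 (Ordinal kM)) //= (hcomp_id hx) big1 ?addr0 // => j.
by rewrite -val_eqE /= => /negbTE jk; rewrite (hcomp_gr _ hx) jk scaler0.
Qed.

Lemma scM l x y : sc l (x * y) = sc l x * sc l y.
Proof.
elim/gr_ind: x => [|x x' hx hx'|i x hx]; first by rewrite mul0r sc0 mul0r.
  by rewrite mulrDl !scD hx hx' mulrDl.
elim/gr_ind: y => [|y y' hy hy'|j y hy]; first by rewrite mulr0 sc0 mulr0.
  by rewrite mulrDr !scD hy hy' mulrDr.
rewrite (sc_gr _ hx) (sc_gr _ hy) (sc_gr _ (grM hx hy)).
by rewrite -scalerAl -scalerAr scalerA exprD.
Qed.
Lemma sc1 l : sc l 1 = 1.
Proof. by rewrite (sc_gr _ (gr1 A)) scale1r. Qed.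
Lemma gr_sc l k x : gr k x -> gr k (sc l x).
Proof. by move=> hx; rewrite (sc_gr _ hx); exact: grZ. Qed.
Lemma sc_sc l l' x : sc l (sc l' x) = sc (l * l') x.
Proof.
elim/gr_ind: x => [|x x' hx hx'|i x hx]; rewrite ?sc0 //.
  by rewrite !scD hx hx'.
by rewrite !(sc_gr _ hx) scZ (sc_gr _ hx) scalerA exprMn mulrC.
Qed.
Lemma sc_one x : sc 1 x = x.
Proof.
elim/gr_ind: x => [|x x' hx hx'|i x hx]; rewrite ?sc0 //.
  by rewrite !scD hx hx'.
by rewrite !(sc_gr _ hx) expr1n scale1r.
Qed.

Lemma hcomp_sc k l x : hcomp k (sc l x) = l ^+ k *: hcomp k x.
Proof.
elim/gr_ind: x => [|x y hx hy|i x hx]; rewrite ?sc0 ?hcomp0 ?scaler0 //.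
  by rewrite !(scD, hcompD) hx hy scalerDr.
rewrite (sc_gr _ hx) hcompZ (hcomp_gr k hx); case: eqP => [->|] //.
by rewrite !scaler0.
Qed.

(** Degrees are eigenvalues of [sc 2]: a linear map that commutes with [sc 2]
    preserves degrees, a condition that can be checked on generators. *)
Lemma gr_sc2 k x : sc 2 x = 2 ^+ k *: x -> gr k x.
Proof.
move=> e; suff <- : hcomp k x = x by exact: gr_hcomp.
apply: hcomp_inj => i; rewrite (hcomp_gr i (gr_hcomp k x)); case: eqP => [->|/eqP ik] //.
have := congr1 (hcomp i) e; rewrite hcomp_sc hcompZ => /eqP.
rewrite -subr_eq0 -scalerBl scaler_eq0 subr_eq0 => /orP[|/eqP ->//].
by move=> /eqP /(@ieexprIn rat 2 isT isT) /eqP; rewrite (negbTE ik).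
Qed.
End Grading.

Section GmorTheory.
Variables (A B : gca) (h : gmor A B).
Lemma gm0 : h 0 = 0. Proof. exact: rmorph0. Qed.
Lemma gm1 : h 1 = 1. Proof. exact: rmorph1. Qed.
Lemma gmD x y : h (x + y) = h x + h y. Proof. exact: rmorphD. Qed.
Lemma gmB x y : h (x - y) = h x - h y. Proof. exact: rmorphB. Qed.
Lemma gmN x : h (- x) = - h x. Proof. exact: rmorphN. Qed.
Lemma gmM x y : h (x * y) = h x * h y. Proof. exact: rmorphM. Qed.
Lemma gmX x n : h (x ^+ n) = h x ^+ n. Proof. exact: rmorphXn. Qed.
Lemma gmZ c x : h (c *: x) = c *: h x. Proof. exact: linearZ. Qed.
Lemma gm_sum I (s : seq I) (P : pred I) F :
  h (\sum_(i <- s | P i) F i) = \sum_(i <- s | P i) h (F i).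
Proof. exact: rmorph_sum. Qed.
End GmorTheory.
Definition gmE := (gm0, gm1, gmD, gmB, gmN, gmM, gmZ).

Lemma gmor_hcomp (A B : gca) (h : gmor A B) k x : h (hcomp k x) = hcomp k (h x).
Proof.
elim/(@gr_ind A): x => [|x y hx hy|i x hx]; first by rewrite !(hcomp0, gm0).
  by rewrite !(hcompD, gmD) hx hy.
rewrite (hcomp_gr k hx) (hcomp_gr k (gmor_gr h hx)).
by case: eqP; rewrite ?gm0.
Qed.
Lemma gmor_sc (A B : gca) (h : gmor A B) l x : h (sc l x) = sc l (h x).
Proof.
elim/(@gr_ind A): x => [|x y hx hy|i x hx]; first by rewrite !(sc0, gm0).
  by rewrite !(scD, gmD) hx hy.
by rewrite (sc_gr _ hx) (sc_gr _ (gmor_gr h hx)) gmZ.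
Qed.

Definition scm (A : gca) (l : rat) : gmor A A :=
  mk_mor (@sc_is_linear A l) (sc1 A l) (@scM A l) (@gr_sc A l).

Notation sg := (sc (-1)).

Lemma sgK (A : gca) (x : A) : sg (sg x) = x.
Proof. by rewrite sc_sc mulN1r opprK sc_one. Qed.

Lemma gr_signE (A : algType rat) (n : nat) (x : A) : (-1) ^+ n * x = (-1) ^+ n *: x.
Proof. by rewrite -signr_odd -[in RHS](@signr_odd rat); case: (odd n); rewrite ?expr1 ?mulN1r ?scaleN1r ?expr0 ?mul1r ?scale1r. Qed.

Section SgDiff.
Variable R : cdga.
Implicit Types x y : R.
Lemma diff_hcomp k x : diff (hcomp k x) = hcomp k.+1 (diff x).
Proof.
elim/(@gr_ind R): x => [|x y hx hy|i x hx]; rewrite ?(hcomp0, diff0) //.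
  by rewrite !(hcompD, diffD) hx hy.
rewrite (hcomp_gr k hx) (hcomp_gr k.+1 (diff_gr hx)) eqSS.
by case: eqP; rewrite ?diff0.
Qed.
Lemma hcomp0_diff x : hcomp 0 (diff x) = 0.
Proof.
elim/(@gr_ind R): x => [|x y hx hy|i x hx]; rewrite ?(hcomp0, diff0) //.
  by rewrite diffD hcompD hx hy addr0.
by rewrite (hcomp_gr _ (diff_gr hx)).
Qed.
Lemma diff_sg x : diff (sg x) = - sg (diff x).
Proof.
elim/(@gr_ind R): x => [|x y hx hy|i x hx]; rewrite ?(sc0, diff0, oppr0) //.
  by rewrite !(scD, diffD) hx hy opprD.
by rewrite (sc_gr _ hx) (sc_gr _ (diff_gr hx)) diffZ exprS mulN1r scaleNr opprK.
Qed.
Lemma diffMs x y : diff (x * y) = diff x * y + sg x * diff y.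
Proof.
elim/(@gr_ind R): x => [|x x' hx hx'|i x hx]; rewrite ?(mul0r, sc0, diff0, addr0) //.
  by rewrite !(mulrDl, scD, diffD) hx hx' addrACA.
by rewrite (diffM _ hx) (sc_gr _ hx) -scalerAl gr_signE.
Qed.
End SgDiff.


Lemma odd_mulC (A : gca) k (u x : A) : odd k -> gr k u -> u * x = sg x * u.
Proof.
move=> ok hu; elim/(@gr_ind A): x => [|x x' hx hx'|i x hx].
- by rewrite sc0 mulr0 mul0r.
- by rewrite mulrDr scD mulrDl hx hx'.
- by rewrite (grC hu hx) gr_signE (sc_gr _ hx) -scalerAl -(@signr_odd rat) oddM ok signr_odd.
Qed.
Lemma even_mulC (A : gca) k (u x : A) : ~~ odd k -> gr k u -> u * x = x * u.
Proof.
move=> ok hu; elim/(@gr_ind A): x => [|x x' hx hx'|i x hx].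
- by rewrite mulr0 mul0r.
- by rewrite mulrDr mulrDl hx hx'.
- by rewrite (grC hu hx) gr_signE -(@signr_odd rat) oddM (negbTE ok) scale1r.
Qed.
Lemma odd_sqr0 (A : gca) k (u : A) : odd k -> gr k u -> u * u = 0.
Proof.
move=> ok hu; have := odd_mulC u ok hu.
rewrite (sc_gr _ hu) -(@signr_odd rat) ok expr1 scaleN1r mulNr => /eqP.
rewrite -subr_eq0 opprK -mulr2n -scaler_nat scaler_eq0 => /orP[|/eqP //].
by rewrite pnatr_eq0.
Qed.
Lemma sg_odd (A : gca) k (u : A) : odd k -> gr k u -> sg u = - u.
Proof. by move=> ok hu; rewrite (sc_gr _ hu) -(@signr_odd rat) ok scaleN1r. Qed.
Lemma sg_even (A : gca) k (u : A) : ~~ odd k -> gr k u -> sg u = u.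
Proof. by move=> ok hu; rewrite (sc_gr _ hu) -(@signr_odd rat) (negbTE ok) scale1r. Qed.
Lemma sc_sum (A : gca) l I (s : seq I) (P : pred I) (F : I -> A) :
  sc l (\sum_(i <- s | P i) F i) = \sum_(i <- s | P i) sc l (F i).
Proof. exact: linear_sum. Qed.
Lemma hcomp_sum (A : gca) k I (s : seq I) (P : pred I) (F : I -> A) :
  hcomp k (\sum_(i <- s | P i) F i) = \sum_(i <- s | P i) hcomp k (F i).
Proof. exact: linear_sum. Qed.

(** * Adjoining one generator *)

(** R' = R (x) Lambda(u) with u of odd degree k and du = z. *)
Record odd_ext (R R' : cdga) (j : dmor R R') (k : nat) (z : R) (u : R') : Prop :=
  OddExt {
  oe_odd : odd k;
  oe_gr : gr k u;
  oe_d : diff u = j z;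
  oe_gen : forall e, exists a b, e = j a + j b * u;
  oe_inj : forall a b, j a + j b * u = 0 -> a = 0 /\ b = 0;
  oe_grade : forall i a b, gr i (j a + j b * u) ->
    gr i a /\ (b = 0 \/ exists2 l, i = (l + k)%N & gr l b);
  oe_univ : forall (C : gca) (f : gmor R C) c, gr k c ->
    exists h : gmor R' C, (forall a, h (j a) = f a) /\ h u = c }.

Lemma sgn_eq a b : odd a = odd b -> (-1) ^+ a = (-1) ^+ b :> rat.
Proof. by move=> e; rewrite -signr_odd e signr_odd. Qed.

Lemma zmod_id1 (V : zmodType) (P Q S T X : V) :
  P + Q + (S + T) = P - X + S + (Q + (T + X)).
Proof. by rewrite (addrA Q) (addrC (Q + T)) [RHS]addrA [P - X + S]addrAC subrK addrACA. Qed.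

Section Shift.
Variables (R : gca) (s : nat).
Lemma hcomp_shift_sum (x : R) M : (bnd x + s <= M)%N ->
  x = \sum_(n < M) (if (s <= n)%N then hcomp (n - s) x else 0).
Proof.
move=> hM; rewrite -(big_mkord xpredT (fun n => if (s <= n)%N then hcomp (n - s) x else 0)).
rewrite (big_cat_nat (n := s)) //=; last by lia.
rewrite big_nat big1 ?add0r; last first.
  by move=> i ik; case/andP: ik => _ ik; rewrite leqNgt ik.
rewrite -{1}[s]add0n big_addn big_mkord.
under eq_bigr do rewrite leq_addl addnK.
by rewrite -hcomp_sumE //; lia.
Qed.
(** A family that is homogeneous after a shift of degrees by s; below s the
    only such element is 0. *)
Lemma gr_direct_shift N (g : nat -> R) :
  (forall n, g n = 0 \/ exists2 l, n = (l + s)%N & gr l (g n)) ->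
  \sum_(n < N) g n = 0 -> forall n, (n < N)%N -> g n = 0.
Proof.
move=> fg e2 i iN; pose f2 l := g (l + s)%N.
have h l : gr l (f2 l).
  rewrite /f2; case: (fg (l + s)%N) => [->|[l' e]]; first exact: gr0.
  by have -> : l' = l by lia.
have small l : (l < s)%N -> g l = 0.
  by case: (fg l) => [//|[l' e _]]; lia.
have [/small //|ki] := ltnP i s.
have := gr_direct (N := N - s) h; rewrite /f2.
have -> : \sum_(l < N - s) g (l + s)%N = 0; last first.
  by move=> /(_ erefl (i - s)%N); rewrite subnK // => -> //; lia.
rewrite -[RHS]e2.
rewrite -(big_mkord xpredT g) (big_cat_nat (n := s)) //=; last by lia.
rewrite [X in _ = X + _]big_nat [X in _ = X + _]big1 ?add0r; last first.
  by move=> l lk; apply: small; case/andP: lk.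
by rewrite -[X in _ = \sum_(X <= _ < _) _]add0n big_addn big_mkord.
Qed.
End Shift.

(** The pair (a, b) stands for a + b u. Moving u past c costs the sign
    involution, hence the twisted product. *)
Section OddExtConstr.
Variables (R : cdga) (k : nat) (z : R).
Hypotheses (ok : odd k) (zg : gr k.+1 z) (zc : diff z = 0).

Definition oT := (R * R)%type.
Definition oadd (x y : oT) : oT := (x.1 + y.1, x.2 + y.2).
Definition oopp (x : oT) : oT := (- x.1, - x.2).
Definition omul (x y : oT) : oT := (x.1 * y.1, x.1 * y.2 + x.2 * sg y.1).
Definition oscale (c : rat) (x : oT) : oT := (c *: x.1, c *: x.2).

Fact o_laws : alg_laws (0, 0) (1, 0) oopp oadd omul oscale.
Proof.
split.
- by move=> [a b] [c d] [e f]; rewrite /oadd /= !addrA.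
- by move=> [a b] [c d]; rewrite /oadd /= [a + c]addrC [b + d]addrC.
- by move=> [a b]; rewrite /oadd /= !add0r.
- by move=> [a b]; rewrite /oadd /= !addNr.
- move=> [a b] [c d] [e f]; rewrite /omul /= !mulrA; congr (_, _).
  by rewrite scM !mulrDr !mulrDl !mulrA addrA.
- by move=> [a b]; rewrite /omul /= !mul1r mul0r addr0.
- by move=> [a b]; rewrite /omul /= !mulr1 mulr0 sc1 mulr1 add0r.
- move=> [a b] [c d] [e f]; rewrite /omul /oadd /= !mulrDl; congr (_, _).
  by rewrite addrACA.
- move=> [a b] [c d] [e f]; rewrite /omul /oadd /= !scD !mulrDr; congr (_, _).
  by rewrite addrACA.
- by move=> a b [c d]; rewrite /oscale /= !scalerA.
- by move=> [c d]; rewrite /oscale /= !scale1r.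
- by move=> a [b c] [d e]; rewrite /oscale /oadd /= !scalerDr.
- by move=> [d e] a b; rewrite /oscale /oadd /= !scalerDl.
- by move=> [] /eqP; rewrite oner_eq0.
- by move=> a [b c] [d e]; rewrite /oscale /omul /= !scalerAl scalerDr !scalerAl.
- move=> a [b c] [d e]; rewrite /oscale /omul /=.
  by rewrite scZ -!scalerAr scalerDr.
Qed.

Definition oalg : algType rat := mk_alg o_laws.

Definition ogr (i : nat) : set oalg :=
  [set x : oalg | gr i x.1 /\ (x.2 = 0 \/ exists2 l, i = (l + k)%N & gr l x.2)].

Fact ogr0 i : ogr i 0.
Proof. by split; [exact: gr0 | left]. Qed.
Fact ogrL i c (x y : oalg) : ogr i x -> ogr i y -> ogr i (c *: x + y).
Proof.
case: x y => [a b] [d e] [/= ha hb] [/= hd he]; split; first exact: grL.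
case: hb he => [->|[l ? hb]] [->|[l' ? he]] /=.
- by left; rewrite scaler0 addr0.
- by right; exists l' => //; rewrite scaler0 add0r.
- by right; exists l => //; rewrite addr0; exact: grZ.
- by right; exists l => //; apply: grL => //; have -> : l = l' by lia.
Qed.
Fact ogr_lift i a : gr i a -> ogr i ((a, 0) : oalg).
Proof. by move=> h; split => //; left. Qed.
Fact ogr_liftu i b : gr i b -> ogr (i + k) ((0, b) : oalg).
Proof. by move=> h; split; [exact: gr0 | right; exists i]. Qed.
Lemma oaddE (a b c d : R) : ((a, b) : oalg) + ((c, d) : oalg) = ((a + c, b + d) : oalg).
Proof. by []. Qed.
Lemma omulE (a b c d : R) :
  ((a, b) : oalg) * ((c, d) : oalg) = ((a * c, a * d + b * sg c) : oalg).
Proof. by []. Qed.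
Lemma oscE s (a b : R) : s *: ((a, b) : oalg) = ((s *: a, s *: b) : oalg).
Proof. by []. Qed.
Lemma osumE (I : Type) (s : seq I) (P : pred I) (F : I -> oalg) :
  \sum_(i <- s | P i) F i =
    ((\sum_(i <- s | P i) (F i).1, \sum_(i <- s | P i) (F i).2) : oalg).
Proof. by elim/big_rec3: _ => // i x y w _ ->; case: (F i). Qed.

Fact ogr_sum (x : oalg) : exists (N : nat) (f : nat -> oalg),
  (forall i, ogr i (f i)) /\ x = \sum_(i < N) f i.
Proof.
case: x => a b.
exists (maxn (bnd a) (bnd b + k)),
  (fun i => (hcomp i a, if (k <= i)%N then hcomp (i - k) b else 0)); split.
- move=> i; split; first exact: gr_hcomp.
  case: leqP => /= ki; last by left.
  by right; exists (i - k)%N; [lia | exact: gr_hcomp].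
- rewrite osumE /=; congr (_, _); first by apply: hcomp_sumE; lia.
  by apply: hcomp_shift_sum; lia.
Qed.
Fact ogr_direct (N : nat) (f : nat -> oalg) : (forall i, ogr i (f i)) ->
  \sum_(i < N) f i = 0 -> forall i, (i < N)%N -> f i = 0.
Proof.
move=> fg; rewrite osumE => - [e1 e2] i iN.
suff [h1 h2] : (f i).1 = 0 /\ (f i).2 = 0 by case: (f i) h1 h2 => ? ? /= -> ->.
split; first by apply: (gr_direct (f := fun i => (f i).1) _ e1) => // l; case: (fg l).
apply: (gr_direct_shift (g := fun n => (f n).2) (s := k) _ e2 iN) => n.
by case: (fg n).
Qed.
Fact ogr1 : ogr 0 (1 : oalg).
Proof. by split; [exact: gr1 | left]. Qed.
Fact ogrM i l (x y : oalg) : ogr i x -> ogr l y -> ogr (i + l) (x * y).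
Proof.
case: x y => [a b] [c d] [/= ha hb] [/= hc hd]; rewrite omulE.
have -> : ((a * c, a * d + b * sg c) : oalg) =
   1 *: ((a * c, 0) : oalg) + (1 *: ((0, a * d) : oalg) + ((0, b * sg c) : oalg)).
  by rewrite !scale1r !oaddE !addr0 !add0r.
apply: ogrL; first by apply: ogr_lift; exact: grM.
apply: ogrL.
  case: hd => [->|[l' -> hd]]; first by rewrite mulr0; exact: ogr0.
  by rewrite addnA; apply: ogr_liftu; exact: grM.
case: hb => [->|[i' -> hb]]; first by rewrite mul0r; exact: ogr0.
rewrite addnAC; apply: ogr_liftu; apply: grM => //.
exact: gr_sc.
Qed.
Fact ogrC i l (x y : oalg) : ogr i x -> ogr l y ->
  x * y = (-1) ^+ (i * l) * (y * x).
Proof.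
case: x y => [a b] [c d] [/= ha hb] [/= hc hd]; rewrite gr_signE !omulE oscE.
congr (_, _); first by rewrite (grC ha hc) gr_signE.
rewrite scalerDr [RHS]addrC; congr (_ + _).
  case: hd => [->|[l' -> hd]]; first by rewrite mulr0 mul0r scaler0.
  rewrite (grC ha hd) gr_signE (sc_gr _ ha) -scalerAr scalerA -exprD.
  congr (_ *: _); apply: sgn_eq.
  by rewrite oddD !oddM oddD ok; case: (odd i) (odd l') => [] [].
case: hb => [->|[i' -> hb]]; first by rewrite mulr0 mul0r scaler0.
rewrite (sc_gr _ hc) -scalerAr (grC hb hc) gr_signE scalerA -exprD.
congr (_ *: _); apply: sgn_eq.
by rewrite oddD !oddM oddD ok; case: (odd l) (odd i') => [] [].
Qed.
Definition ogca : gca := Gca ogr0 ogrL ogr_sum ogr_direct ogr1 ogrM ogrC.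

Definition odiff (x : ogca) : ogca := (diff x.1 + sg x.2 * z, diff x.2).
Lemma sgz : sg z = z.
Proof. by apply: sg_even zg; rewrite /= ok. Qed.
Lemma zC (x : R) : z * x = x * z.
Proof. by apply: even_mulC zg; rewrite /= ok. Qed.
Fact odiffL (c : rat) (x y : ogca) : odiff (c *: x + y) = c *: odiff x + odiff y.
Proof.
case: x y => [a b] [d e]; rewrite /odiff oscE oaddE /= oaddE; congr (_, _).
  rewrite !diffL scD scZ mulrDl -scalerAl addrACA scalerDr //.
by rewrite diffL.
Qed.
Fact odiff_gr i (x : ogca) : gr i x -> gr i.+1 (odiff x).
Proof.
case: x => a b [/= ha hb]; split => /=.
  apply: grD; first exact: diff_gr.
  case: hb => [->|[l -> hb]]; first by rewrite sc0 mul0r; exact: gr0.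
  by rewrite -addnS; apply: grM => //; exact: gr_sc.
case: hb => [->|[l -> hb]]; first by left; rewrite diff0.
by right; exists l.+1 => //; exact: diff_gr.
Qed.
Fact odiffM i (x y : ogca) : gr i x ->
  odiff (x * y) = odiff x * y + (-1) ^+ i * (x * odiff y).
Proof.
case: x y => [a b] [c d] [/= ha hb]; rewrite gr_signE.
change (odiff (omul (a, b) (c, d)) = oadd (omul (odiff (a, b)) (c, d))
  (oscale ((-1) ^+ i) (omul (a, b) (odiff (c, d))))).
rewrite /odiff /omul /oscale /oadd /=.
congr (_, _).
  rewrite (diffM _ ha) gr_signE scD !scM sgK.
  rewrite [RHS](_ : _ = (diff a * c + (-1) ^+ i *: (a * diff c)) +
     (sg b * z * c + (-1) ^+ i *: (a * (sg d * z)))); last first.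
    by rewrite mulrDl mulrDr scalerDr; rewrite addrACA.
  congr (_ + _); rewrite mulrDl addrC -!mulrA zC.
  by rewrite [sg a](sc_gr _ ha) -scalerAl.
have sb : sg b = - ((-1) ^+ i *: b).
  case: hb => [->|[l -> hb]]; first by rewrite sc0 scaler0 oppr0.
  rewrite (sc_gr _ hb) -scaleNr; congr (_ *: _).
  by rewrite exprD -(signr_odd _ k) ok expr1 mulrN1 opprK.
rewrite diffD (diffM _ ha) gr_signE diffMs diff_sg scD scM sgK sgz sb.
rewrite mulrDl mulrN mulNr opprK mulrDr scalerDr.
rewrite mulNr mulNr -!scalerAl scalerDr -!mulrA zC.
exact: zmod_id1.
Qed.
Fact odiffK (x : ogca) : odiff (odiff x) = 0.
Proof.
case: x => a b; rewrite /odiff /=; rewrite diffD !diffK add0r.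
by rewrite diffMs zc mulr0 addr0 diff_sg mulNr addNr.
Qed.
Definition ocdga : cdga := @Cdga ogca odiff odiffL odiff_gr odiffM odiffK.

Definition oj_fun (a : R) : ocdga := ((a, 0) : oalg).
Definition oj_mor : gmor R ocdga.
Proof.
refine (@mk_mor R ocdga oj_fun _ _ _ _).
- by move=> c x y; rewrite /oj_fun oscE oaddE scaler0 addr0.
- by [].
- by move=> x y; rewrite /oj_fun omulE mulr0 mul0r addr0.
- by move=> i x; exact: ogr_lift.
Defined.
Definition oj : dmor R ocdga.
Proof.
refine (@mk_dmor R ocdga oj_mor _) => x.
by rewrite /oj_mor !mk_morE /oj_fun /= /odiff /= sc0 mul0r addr0 diff0.
Defined.
Definition ou : ocdga := ((0, 1) : oalg).
Lemma oE (a b : R) : oj a + oj b * ou = ((a, b) : oalg).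
Proof. by rewrite /= /oj_fun /ou omulE oaddE !mulr0 mulr1 mul0r !addr0 add0r. Qed.
Lemma odd_ext_holds : odd_ext oj k z ou.
Proof.
split=> //.
- by split; [exact: gr0 | right; exists 0%N => //; exact: gr1].
- by rewrite /= /odiff /= diff0 diff1 sc1 mul1r add0r.
- by move=> [a b]; exists a, b; rewrite oE.
- by move=> a b; rewrite oE => - [].
- by move=> i a b; rewrite oE => - [].
- move=> C f c cg.
  pose h (x : ocdga) := f x.1 + f x.2 * c.
  have hL (s : rat) x y : h (s *: x + y) = s *: h x + h y.
    rewrite /h; case: x y => [a b] [d e]; rewrite oscE oaddE /=.
    by rewrite !gmE mulrDl addrACA scalerDr -scalerAl.
  have h1 : h 1 = 1 by rewrite /h /= gm1 gm0 mul0r addr0.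
  have hM x y : h (x * y) = h x * h y.
    rewrite /h; case: x y => [a b] [d e]; rewrite omulE /= !gmE !mulrDl !mulrDr.
    have e1 : f b * c * f d = f b * sg (f d) * c by rewrite -!mulrA (odd_mulC _ ok cg).
    have e2 : f b * c * (f e * c) = 0.
      by rewrite mulrA -[f b * c * _]mulrA (odd_mulC _ ok cg) -!mulrA (odd_sqr0 ok cg) !mulr0.
    by rewrite e1 e2 addr0 -gmor_sc mulrA addrA.
  have hg i x : gr i x -> gr i (h x).
    case: x => a b [/= ha hb]; apply: grD; first exact: gmor_gr.
    case: hb => [->|[l -> hb]]; first by rewrite gm0 mul0r; exact: gr0.
    by apply: grM => //; exact: gmor_gr.
  exists (mk_mor hL h1 hM hg); split => [a|]; rewrite mk_morE /h /=.
    by rewrite gm0 mul0r addr0.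
  by rewrite gm0 gm1 add0r mul1r.
Qed.
End OddExtConstr.

Lemma odd_ext_exists (R : cdga) k (z : R) : odd k -> gr k.+1 z -> diff z = 0 ->
  exists (R' : cdga) (j : dmor R R') (u : R'), odd_ext j k z u.
Proof.
by move=> ok zg zc; exists (ocdga ok zg zc), (oj ok zg zc), (ou ok zg zc);
   exact: odd_ext_holds.
Qed.

(** R' = R (x) Q[u] with u of even degree k and du = z. *)
Record even_ext (R R' : cdga) (j : dmor R R') (k : nat) (z : R) (u : R') : Prop :=
  EvenExt {
  ee_even : ~~ odd k;
  ee_gr : gr k u;
  ee_d : diff u = j z;
  ee_gen : forall e, exists N (f : nat -> R), e = \sum_(l < N) j (f l) * u ^+ l;
  ee_inj : forall N (f : nat -> R), \sum_(l < N) j (f l) * u ^+ l = 0 ->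
    forall l, (l < N)%N -> f l = 0;
  ee_univ : forall (C : gca) (f : gmor R C) c, gr k c ->
    exists h : gmor R' C, (forall a, h (j a) = f a) /\ h u = c }.

(** An even generator is central, so polynomials over R have the right product
    even though R is only graded-commutative. The differential is the sum of
    the coefficientwise one and of z d/du, with a sign because the odd element
    z is moved to the right. *)
Section EvenExtConstr.
Variables (R : cdga) (k : nat) (z : R).
Hypotheses (ek : ~~ odd k) (zg : gr k.+1 z) (zc : diff z = 0).

Definition escale (c : rat) (p : {poly R}) : {poly R} := (c%:A : R) *: p.
Lemma coef_escale c p l : (escale c p)`_l = c *: p`_l.
Proof. by rewrite coefZ mulr_algl. Qed.
Fact e_laws : alg_laws (0 : {poly R}) 1 -%R +%R *%R escale.
Proof.
split.
- exact: addrA.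
- exact: addrC.
- exact: add0r.
- exact: addNr.
- exact: mulrA.
- exact: mul1r.
- exact: mulr1.
- exact: mulrDl.
- exact: mulrDr.
- by move=> a b v; apply/polyP => l; rewrite !coef_escale scalerA.
- by move=> v; apply/polyP => l; rewrite !coef_escale scale1r.
- by move=> a u v; apply/polyP => l; rewrite !(coef_escale, coefD) scalerDr.
- by move=> v a b; apply/polyP => l; rewrite !(coef_escale, coefD) scalerDl.
- by move=> /eqP; rewrite oner_eq0.
- move=> a u v; apply/polyP => l; rewrite !(coef_escale, coefM) scaler_sumr.
  by apply: eq_bigr => i _; rewrite coef_escale scalerAl.
- move=> a u v; apply/polyP => l; rewrite !(coef_escale, coefM) scaler_sumr.
  by apply: eq_bigr => i _; rewrite coef_escale scalerAr.
Qed.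
Definition ealg : algType rat := mk_alg e_laws.
Definition cf (p : ealg) (l : nat) : R := (p : {poly R})`_l.
Lemma cfP (p q : ealg) : (forall l, cf p l = cf q l) -> p = q.
Proof. by move=> h; apply/polyP. Qed.
Lemma cfL c (p q : ealg) l : cf (c *: p + q) l = c *: cf p l + cf q l.
Proof.
by change ((escale c p + q : {poly R})`_l = c *: p`_l + q`_l); rewrite coefD coef_escale.
Qed.
Lemma cfM (p q : ealg) l : cf (p * q) l = \sum_(i < l.+1) cf p i * cf q (l - i).
Proof. exact: coefM. Qed.
Lemma cfMr (p q : ealg) l : cf (p * q) l = \sum_(i < l.+1) cf p (l - i) * cf q i.
Proof. exact: coefMr. Qed.
Lemma cf0 l : cf 0 l = 0. Proof. exact: coef0. Qed.
Lemma cf_sum (I : Type) (s : seq I) (P : pred I) (F : I -> ealg) l :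
  cf (\sum_(i <- s | P i) F i) l = \sum_(i <- s | P i) cf (F i) l.
Proof.
elim/big_rec2: _ => [|i a b _ <-]; first exact: cf0.
by have := cfL 1 (F i) b l; rewrite !scale1r.
Qed.
Definition mkp (N : nat) (g : nat -> R) : ealg := \poly_(i < N) g i.
Lemma cf_mkp N g l : cf (mkp N g) l = if (l < N)%N then g l else 0.
Proof. exact: coef_poly. Qed.
Definition sz (p : ealg) : nat := size (p : {poly R}).
Lemma cf_big p l : (sz p <= l)%N -> cf p l = 0.
Proof. by move=> h; apply: nth_default. Qed.

(** Degree i after a shift by s. Degrees are natural numbers, so i < s has to
    mean x = 0. *)
Definition hgr (i s : nat) (x : R) := x = 0 \/ exists2 l, i = (l + s)%N & gr l x.
Lemma hgr_L i s c x y : hgr i s x -> hgr i s y -> hgr i s (c *: x + y).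
Proof.
move=> [->|[l el hx]] [->|[l' e hy]].
- by left; rewrite scaler0 addr0.
- by right; exists l' => //; rewrite scaler0 add0r.
- by right; exists l => //; rewrite addr0; exact: grZ.
- by right; exists l => //; apply: grL => //; have -> : l = l' by lia.
Qed.
Lemma hgr_sum i s n (F : 'I_n -> R) :
  (forall l, hgr i s (F l)) -> hgr i s (\sum_(l < n) F l).
Proof.
move=> h; apply: big_ind => [|x y hx hy|//]; first by left.
by rewrite -[x]scale1r; exact: hgr_L.
Qed.
Lemma hgr_M i s i' s' x y : hgr i s x -> hgr i' s' y -> hgr (i + i') (s + s') (x * y).
Proof.
move=> [->|[l -> hx]]; first by left; rewrite mul0r.
move=> [->|[l' -> hy]]; first by left; rewrite mulr0.
by right; exists (l + l')%N; [lia | exact: grM].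
Qed.

Definition egr (i : nat) : set ealg := [set p | forall l, hgr i (l * k) (cf p l)].
Fact egr0 i : egr i 0.
Proof. by move=> l; left; rewrite cf0. Qed.
Fact egrL i c (x y : ealg) : egr i x -> egr i y -> egr i (c *: x + y).
Proof. by move=> hx hy l; rewrite cfL; exact: hgr_L. Qed.
Fact egr_sum (x : ealg) : exists (N : nat) (f : nat -> ealg),
  (forall i, egr i (f i)) /\ x = \sum_(i < N) f i.
Proof.
pose c n l := if (l * k <= n)%N then hcomp (n - l * k) (cf x l) else 0.
have /= := leqnn (\max_(l < sz x) (bnd (cf x l) + l * k)).
set M := (X in (_ <= X)%N -> _) => _.
exists M, (fun n => mkp (sz x) (c n)); split.
- move=> n l; rewrite cf_mkp; case: ifP => _; last by left.
  rewrite /c; case: leqP => h; last by left.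
  by right; exists (n - l * k)%N; [lia | exact: gr_hcomp].
- apply: cfP => l; rewrite cf_sum.
  have [h|h] := ltnP l (sz x); last first.
    by rewrite cf_big // big1 // => i _; rewrite cf_mkp ltnNge h.
  under eq_bigr do rewrite cf_mkp h.
  apply: hcomp_shift_sum.
  exact: (leq_bigmax (Ordinal h)).
Qed.
Fact egr_direct (N : nat) (f : nat -> ealg) : (forall i, egr i (f i)) ->
  \sum_(i < N) f i = 0 -> forall i, (i < N)%N -> f i = 0.
Proof.
move=> fg e i iN; apply: cfP => l; rewrite cf0.
apply: (gr_direct_shift (g := fun n => cf (f n) l) (s := l * k) _ _ iN).
  by move=> n; exact: fg.
by rewrite -cf_sum e cf0.
Qed.
Lemma cf1 l : cf 1 l = if l == 0%N then 1 else 0.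
Proof. by rewrite -[LHS]/((1 : {poly R})`_l) coef1; case: eqP. Qed.
Fact egr1 : egr 0 (1 : ealg).
Proof.
move=> l; rewrite cf1; case: eqP => [->|_]; last by left.
by right; exists 0%N => //; exact: gr1.
Qed.
Fact egrM i l (x y : ealg) : egr i x -> egr l y -> egr (i + l) (x * y).
Proof.
move=> hx hy n; rewrite cfM; apply: hgr_sum => a.
have -> : (n * k = a * k + (n - a) * k)%N by have := ltn_ord a; nia.
exact: hgr_M.
Qed.
Fact egrC i l (x y : ealg) : egr i x -> egr l y ->
  x * y = (-1) ^+ (i * l) * (y * x).
Proof.
move=> hx hy; rewrite gr_signE; apply: cfP => n.
rewrite -[_ *: _]addr0 cfL cf0 addr0 cfM cfMr scaler_sumr.
apply: eq_bigr => a _.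
case: (hx a) => [->|[b -> ha]]; first by rewrite mul0r mulr0 scaler0.
case: (hy (n - a)%N) => [->|[b' -> ha']]; first by rewrite mul0r mulr0 scaler0.
rewrite (grC ha ha') gr_signE; congr (_ *: _); apply: sgn_eq.
by rewrite !(oddM, oddD) (negbTE ek) !andbF !addbF.
Qed.
Definition egca : gca := Gca egr0 egrL egr_sum egr_direct egr1 egrM egrC.

Definition eS (p : ealg) : ealg := mkp (sz p) (fun l => sg (cf p l)).
Definition eD (p : ealg) : ealg := mkp (sz p) (fun l => diff (cf p l)).
Definition eZ (p : ealg) : ealg := mkp (sz p) (fun l => (sg (cf p l.+1) * z) *+ l.+1).
Lemma cf_S p l : cf (eS p) l = sg (cf p l).
Proof. by rewrite cf_mkp; case: ltnP => // /cf_big ->; rewrite sc0. Qed.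
Lemma cf_D p l : cf (eD p) l = diff (cf p l).
Proof. by rewrite cf_mkp; case: ltnP => // /cf_big ->; rewrite diff0. Qed.
Lemma cf_Z p l : cf (eZ p) l = (sg (cf p l.+1) * z) *+ l.+1.
Proof.
rewrite cf_mkp; case: ltnP => // h; rewrite cf_big ?(leqW h) //.
by rewrite sc0 mul0r mul0rn.
Qed.
Definition ediff (p : egca) : egca := eD p + eZ p.
Lemma cfDD (p q : ealg) l : cf (p + q) l = cf p l + cf q l.
Proof. exact: coefD. Qed.
Lemma cf_diff p l : cf (ediff p) l = diff (cf p l) + (sg (cf p l.+1) * z) *+ l.+1.
Proof. by rewrite /ediff cfDD cf_D cf_Z. Qed.
Lemma zsC (x : R) : z * x = sg x * z.
Proof. by apply: odd_mulC zg; rewrite /= ek. Qed.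
Fact ediffL (c : rat) (x y : egca) : ediff (c *: x + y) = c *: ediff x + ediff y.
Proof.
apply: cfP => l; rewrite cfL !cf_diff !cfL diffL scD scZ mulrDl -scalerAl.
by rewrite mulrnDl scalerDr scalerMnr addrACA.
Qed.
Fact ediff_gr i (x : egca) : gr i x -> gr i.+1 (ediff x).
Proof.
move=> hx l; rewrite cf_diff -[diff _]scale1r; apply: hgr_L.
  case: (hx l) => [->|[a -> ha]]; first by left; rewrite diff0.
  by right; exists a.+1 => //; exact: diff_gr.
case: (hx l.+1) => [->|[a -> ha]]; first by left; rewrite sc0 mul0r mul0rn.
right; exists (a + k.+1)%N; first by rewrite mulSn; lia.
by rewrite -scaler_nat; apply: grZ; apply: grM => //; exact: gr_sc.
Qed.
Lemma eZE (p : ealg) : eZ p = ((eS p : {poly R})^`() * z%:P : {poly R}).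
Proof.
apply: cfP => l; rewrite cf_Z /cf coefMC coef_deriv mulrnAl.
by congr (_ * _ *+ _); exact/esym/cf_S.
Qed.
Lemma eSM (p q : ealg) : eS (p * q) = eS p * eS q.
Proof.
apply: cfP => l; rewrite cf_S !cfM (raddf_sum (@sc R (-1))) /=.
by apply: eq_bigr => i _; rewrite !cf_S scM.
Qed.
Lemma eSz (q : ealg) : (eS q : {poly R}) * z%:P = z%:P * (q : {poly R}).
Proof. by apply/polyP => l; rewrite coefMC coefCM zsC; congr (_ * _); exact: cf_S. Qed.
Lemma eZM (p q : ealg) : eZ (p * q) = eZ p * q + eS p * eZ q.
Proof.
rewrite eZE eSM.
change (((eS p : {poly R}) * eS q)^`() * z%:P =
  ((eZ p : {poly R}) * q + (eS p : {poly R}) * eZ q)%R :> {poly R}).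
by rewrite derivM !eZE mulrDl -!mulrA eSz.
Qed.
Lemma eDM (p q : ealg) : eD (p * q) = eD p * q + eS p * eD q.
Proof.
apply: cfP => l; rewrite cfDD cf_D !cfM diff_sum -big_split /=.
by apply: eq_bigr => i _; rewrite diffMs !cf_D cf_S.
Qed.
Fact ediffM i (x y : egca) : gr i x ->
  ediff (x * y) = ediff x * y + (-1) ^+ i * (x * ediff y).
Proof.
move=> hx; have Sx : eS x = (-1) ^+ i *: x.
  apply: cfP => l; rewrite -[_ *: _]addr0 cfL cf0 addr0 cf_S.
  case: (hx l) => [->|[a -> ha]]; first by rewrite sc0 scaler0.
  rewrite (sc_gr _ ha); congr (_ *: _); apply: sgn_eq.
  by rewrite !(oddM, oddD) (negbTE ek) andbF addbF.
rewrite gr_signE /ediff eDM eZM Sx mulrDr mulrDl addrACA scalerDr.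
by rewrite -!scalerAl.
Qed.
Fact ediffK (x : egca) : ediff (ediff x) = 0.
Proof.
apply: cfP => l; rewrite !cf_diff cf0 diffD diffK add0r.
rewrite -!scaler_nat diffZ diffMs zc mulr0 addr0 diff_sg.
rewrite scD mulrDl scZ scM sgK.
have zz : z * z = 0 by apply: odd_sqr0 zg; rewrite /= ek.
have sgzz : sg z * z = 0 by rewrite (sc_gr _ zg) -scalerAl zz scaler0.
by rewrite -scalerAl -mulrA sgzz mulr0 scaler0 addr0 mulNr scalerN addNr.
Qed.
Definition ecdga : cdga := @Cdga egca ediff ediffL ediff_gr ediffM ediffK.

Definition ej_fun (a : R) : ecdga := (a%:P : {poly R}).
Lemma cf_ej a l : cf (ej_fun a) l = if l == 0%N then a else 0.
Proof. exact: coefC. Qed.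
Definition ej_mor : gmor R ecdga.
Proof.
refine (@mk_mor R ecdga ej_fun _ _ _ _).
- move=> c x y; apply: cfP => l; rewrite cfL !cf_ej.
  by case: eqP; rewrite // scaler0 addr0.
- by apply: cfP => l; rewrite cf_ej.
- by move=> x y; exact: polyCM.
- move=> i x hx l; rewrite cf_ej; case: eqP => [->|_]; last by left.
  by right; exists i; rewrite ?mul0n ?addn0.
Defined.
Definition ej : dmor R ecdga.
Proof.
refine (@mk_dmor R ecdga ej_mor _) => x; rewrite /ej_mor !mk_morE.
apply: cfP => l; rewrite cf_diff !cf_ej /= sc0 mul0r mul0rn addr0.
by case: eqP; rewrite ?diff0.
Defined.
Definition eu : ecdga := ('X : {poly R}).
Lemma cf_eu l : cf eu l = if l == 1%N then 1 else 0.
Proof. by rewrite /cf coefX; case: eqP. Qed.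
Lemma eXn l : eu ^+ l = ('X^l : {poly R}).
Proof.
elim: l => [|l ih]; first by rewrite !expr0.
by rewrite exprS ih [RHS]exprS.
Qed.
Lemma cf_mono a i l : cf (ej a * eu ^+ i) l = if l == i then a else 0.
Proof.
rewrite eXn; rewrite -[LHS]/((a%:P * 'X^i : {poly R})`_l) coefCM coefXn.
by case: eqP; rewrite ?mulr1 ?mulr0.
Qed.
Lemma cf_rep N (f : nat -> R) l :
  cf (\sum_(i < N) ej (f i) * eu ^+ i) l = if (l < N)%N then f l else 0.
Proof.
rewrite cf_sum; under eq_bigr do rewrite cf_mono.
case: ltnP => h.
  rewrite (bigD1 (Ordinal h)) //= eqxx big1 ?addr0 // => i.
  by rewrite -val_eqE /= eq_sym => /negbTE ->.
rewrite big1 // => i _; have := ltn_ord i.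
by case: eqP => [<-|_] //; rewrite ltnNge h.
Qed.
Lemma e_rep (e : ecdga) : e = \sum_(i < sz e) ej (cf e i) * eu ^+ i.
Proof. by apply: cfP => l; rewrite cf_rep; case: ltnP => // /cf_big. Qed.
Lemma even_ext_holds : even_ext ej k z eu.
Proof.
split=> //.
- move=> l; rewrite cf_eu; case: eqP => [->|_]; last by left.
  by right; exists 0%N; [rewrite mul1n | exact: gr1].
- apply: cfP => -[|l]; rewrite cf_diff cf_ej !cf_eu /=.
    by rewrite diff0 add0r sc1 mul1r.
  by rewrite sc0 mul0r mul0rn addr0; case: eqP; rewrite ?diff0 ?diff1.
- by move=> e; exists (sz e), (cf e); exact: e_rep.
- move=> N f h l lN; have := congr1 (cf^~ l) h.
  by rewrite /= cf_rep lN cf0.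
- move=> C f c cg.
  pose h (x : ecdga) := \sum_(i < sz x) f (cf x i) * c ^+ i.
  have hE M x : (sz x <= M)%N -> h x = \sum_(i < M) f (cf x i) * c ^+ i.
    move=> hM; rewrite /h (big_ord_widen M (fun i => f (cf x i) * c ^+ i) hM) big_mkcond.
    apply: eq_bigr => i _; case: ltnP => // /cf_big ->; by rewrite gm0 mul0r.
  have hL (s : rat) x y : h (s *: x + y) = s *: h x + h y.
    pose M := maxn (sz (s *: x + y)) (maxn (sz x) (sz y)).
    rewrite !(hE M); [|rewrite /M; lia..].
    rewrite scaler_sumr -big_split /=; apply: eq_bigr => i _.
    by rewrite cfL !gmE mulrDl -scalerAl.
  have hm a l : h (ej a * eu ^+ l) = f a * c ^+ l.
    pose M := maxn (sz (ej a * eu ^+ l)) l.+1.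
    have lM : (l < M)%N by rewrite /M; lia.
    rewrite (hE M) ?leq_maxl // (bigD1 (Ordinal lM)) //= cf_mono eqxx.
    rewrite big1 ?addr0 // => i; rewrite -val_eqE /= => /negbTE il.
    by rewrite cf_mono il gm0 mul0r.
  have h1 : h 1 = 1 by have := hm 1 0%N; rewrite (gm1 ej) (gm1 f) !expr0 !mulr1.
  have h0 : h 0 = 0 by have := hL (-1) 0 0; rewrite scaler0 addr0 scaleN1r addNr.
  have hD x y : h (x + y) = h x + h y by have := hL 1 x y; rewrite !scale1r.
  have hs n (F : 'I_n -> ecdga) : h (\sum_(i < n) F i) = \sum_(i < n) h (F i).
    by elim/big_rec2: _ => // i a b _ <-; rewrite hD.
  have eum : ~~ odd k by [].
    (* u is central, and so is its image c. *)
have uC (b : ecdga) i : eu ^+ i * b = b * eu ^+ i.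
    apply: (even_mulC (k := i * k)); first by rewrite oddM (negbTE ek) andbF.
    by move=> l; rewrite -(mul1r (_ ^+ _)) -(gm1 ej) cf_mono;
      case: eqP => [->|_]; [right; exists 0%N => //; exact: gr1 | left].
  have cC b i : c ^+ i * b = b * c ^+ i.
    elim: i => [|i ih]; first by rewrite !expr0 mulr1 mul1r.
    by rewrite !exprS -mulrA ih mulrA (even_mulC b ek cg) mulrA.
  have hM x y : h (x * y) = h x * h y.
    rewrite [x in LHS]e_rep [y in LHS]e_rep [x in RHS]e_rep [y in RHS]e_rep.
    rewrite mulr_suml !hs mulr_suml; apply: eq_bigr => i _.
    rewrite !mulr_sumr hs; apply: eq_bigr => l _.
    rewrite !hm -mulrA (mulrA (eu ^+ i)) uC -!mulrA -exprD mulrA -gmM hm gmM.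
    by rewrite exprD -!mulrA; congr (_ * _); rewrite [RHS]mulrA [in RHS]cC mulrA.
  have hg i x : gr i x -> gr i (h x).
    move=> hx; apply: gr_bigsum => l _.
    case: (hx l) => [->|[a -> ha]]; first by rewrite gm0 mul0r; exact: gr0.
    apply: grM; first exact: gmor_gr.
    elim: {hx ha} (nat_of_ord l) => [|n ih]; first exact: gr1.
    by rewrite exprS mulSn; apply: grM.
  exists (mk_mor hL h1 hM hg); split => [a|]; rewrite mk_morE.
    by have := hm a 0%N; rewrite !expr0 !mulr1.
  by have := hm 1 1%N; rewrite (gm1 ej) (gm1 f) !expr1 !mul1r.
Qed.
End EvenExtConstr.

Lemma even_ext_exists (R : cdga) k (z : R) : ~~ odd k -> gr k.+1 z -> diff z = 0 ->
  exists (R' : cdga) (j : dmor R R') (u : R'), even_ext j k z u.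
Proof.
by move=> ok zg zc; exists (ecdga ok zg zc), (ej ok zg zc), (eu ok zg zc);
   exact: even_ext_holds.
Qed.

(** * Consequences of the universal property *)

(** The elements on which h commutes with the differentials form a subalgebra;
    a morphism is therefore a chain map as soon as this holds on generators.
    *)
Lemma dcomm_ind (R C : cdga) (h : gmor R C) :
  let P x := h (diff x) = diff (h x) in
  [/\ (forall x y, P x -> P y -> P (x + y)), (forall x y, P x -> P y -> P (x * y)),
      P 0, P 1 & forall c x, P x -> P (c *: x)].
Proof.
split; rewrite /= ?gmE ?diff0 ?diff1 ?gmE ?diff0 ?diff1 //.
- by move=> x y hx hy; rewrite !diffD !gmE hx hy diffD.
- by move=> x y hx hy; rewrite !diffMs !gmE hx hy diffMs gmor_sc.
- by move=> c x hx; rewrite diffZ !gmE hx diffZ.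
Qed.

Lemma odd_ext_d (R R' : cdga) (j : dmor R R') k z u : odd_ext j k z u ->
  forall a b, diff (j a + j b * u) = j (diff a + sg b * z) + j (diff b) * u.
Proof.
move=> H a b; rewrite diffD diffMs -!dmor_diff (oe_d H) -gmor_sc !gmE.
by rewrite -addrA; congr (_ + _); rewrite addrC.
Qed.

(** What odd and even generators have in common, for arguments that do not
    depend on the parity. The square of an odd u is zero, so the expansion in
    [on_gen] is not unique. *)
Record one_ext (R R' : cdga) (j : dmor R R') (k : nat) (z : R) (u : R') : Prop :=
  OneExt {
  on_gr : gr k u;
  on_d : diff u = j z;
  on_gen : forall e, exists N (f : nat -> R), e = \sum_(l < N) j (f l) * u ^+ l;
  on_univ : forall (C : gca) (f : gmor R C) c, gr k c ->
    exists h : gmor R' C, (forall a, h (j a) = f a) /\ h u = c }.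

Lemma odd_one (R R' : cdga) (j : dmor R R') k z u :
  odd_ext j k z u -> one_ext j k z u.
Proof.
move=> H; split; [exact: oe_gr H|exact: oe_d H| |exact: oe_univ H].
move=> e; have [a [b ->]] := oe_gen H e.
exists 2, (fun l => if l is 0 then a else b).
by rewrite big_ord_recl big_ord1 /= expr0 mulr1 expr1.
Qed.
Lemma even_one (R R' : cdga) (j : dmor R R') k z u :
  even_ext j k z u -> one_ext j k z u.
Proof. by move=> H; split; [exact: ee_gr H|exact: ee_d H|exact: ee_gen H|exact: ee_univ H]. Qed.

Section OneExt.
Variables (R R' : cdga) (j : dmor R R') (k : nat) (z : R) (u : R').
Hypothesis H : one_ext j k z u.
Lemma one_ind (P : R' -> Prop) : (forall a, P (j a)) -> P u ->
  (forall x y, P x -> P y -> P (x + y)) ->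
  (forall x y, P x -> P y -> P (x * y)) -> forall x, P x.
Proof.
move=> Pj Pu PD PM x; have [N [f ->]] := on_gen H x.
apply: big_ind => // [|i _]; first by rewrite -(gm0 j).
apply: (PM) => //; elim: (nat_of_ord i) => [|n ih]; first by rewrite expr0 -(gm1 j).
by rewrite exprS; exact: (PM).
Qed.
Lemma one_eq (C : gca) (h h' : gmor R' C) : (forall a, h (j a) = h' (j a)) ->
  h u = h' u -> forall x, h x = h' x.
Proof.
move=> e1 e2; apply: one_ind => // x y hx hy; first by rewrite !gmD hx hy.
by rewrite !gmM hx hy.
Qed.
Lemma one_map (C : cdga) (f : dmor R C) c : gr k c -> diff c = f z ->
  exists h : dmor R' C, (forall a, h (j a) = f a) /\ h u = c.
Proof.
move=> cg cd; have [h [h1 h2]] := on_univ H f cg.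
have [PD PM P0 P1 PZ] := dcomm_ind h.
have hd x : h (diff x) = diff (h x).
  elim/one_ind: x => //; first by move=> a; rewrite -dmor_diff !h1 dmor_diff.
  by rewrite h2 cd (on_d H) h1.
by exists (mk_dmor hd).
Qed.
End OneExt.

(** * Retractions and odd extensions *)

(** A homotopy retraction in which E may be any cdga, so that the notion is
    stable under base change along odd extensions. *)
Definition retractable (T B : cdga) (rho : dmor T B) : Prop :=
  exists (E : cdga) (iota : dmor T E) (phi : dmor E B) (tau : dmor E T),
    [/\ quasi_iso phi, forall a, phi (iota a) = rho a & forall a, tau (iota a) = a].

(** A cocycle killed by rho becomes a boundary in E, and tau carries the
    primitive back. *)
Lemma retractable_exact (T B : cdga) (rho : dmor T B) t :
  retractable rho -> diff t = 0 -> rho t = 0 -> exists y, diff y = t.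
Proof.
move=> [E [iota [phi [tau [[inj _] e1 e2]]]]] dt rt.
have [||y _ hy] := inj (iota t); first by rewrite /cocycle /= -dmor_diff dt gm0.
  by exists 0 => //; rewrite diff0 e1 rt.
by exists (tau y); rewrite -dmor_diff hy e2.
Qed.

Lemma zmod_id2 (V : zmodType) (p q s t U W : V) :
  p + q - s - t + s + W = p + (U + W) - (- q + U + t).
Proof.
rewrite [p + q - s - t]addrAC subrK !opprD opprK [U + W]addrC !addrA.
by rewrite [p + W + U + q]addrAC addrK [p + W + q]addrAC [LHS]addrAC.
Qed.

(** The five lemma for the extension 0 -> E -> E (x) Lambda(u) -> E -> 0,
    whose connecting map is multiplication by z; the chase is done on elements
    a + b u. *)
Lemma quasi_iso_odd (E B E' B' : cdga) (phi : dmor E B) (jE : dmor E E')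
    (jB : dmor B B') k z uE uB (phi' : dmor E' B') :
  odd_ext jE k z uE -> odd_ext jB k (phi z) uB ->
  (forall a, phi' (jE a) = jB (phi a)) -> phi' uE = uB ->
  quasi_iso phi -> quasi_iso phi'.
Proof.
move=> HE HB e1 e2 [inj surj].
have phiE a b : phi' (jE a + jE b * uE) = jB (phi a) + jB (phi b) * uB.
  by rewrite !gmE !e1 e2.
have dz : diff z = 0.
  apply: (oe_inj HE (b := 0) _).1; rewrite gm0 mul0r addr0.
  by rewrite dmor_diff -(oe_d HE) diffK.
have dz' : diff (phi z) = 0 by rewrite -dmor_diff dz gm0.
have split0 a b a' b' : jB a + jB b * uB = jB a' + jB b' * uB -> a = a' /\ b = b'.
  move=> /eqP; rewrite -subr_eq0 opprD addrACA -mulrBl -!gmB => /eqP /(oe_inj HB).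
  by move=> [/eqP + /eqP]; rewrite !subr_eq0 => /eqP -> /eqP ->.
split=> [x|y].
- have [a [b ->]] := oe_gen HE x; rewrite /cocycle /= (odd_ext_d HE).
  move=> /(oe_inj HE) [h1 h2] [y _].
  have [a1 [b1 ->]] := oe_gen HB y; rewrite (odd_ext_d HB) phiE => /split0 [h3 h4].
  have [||b0 _ hb0] := inj b; [by []|by exists b1|].
  have [|c0 [dc0 [be _ hbe]]] := surj (phi b0 - b1).
    by rewrite /cocycle /= diffB h4 -dmor_diff hb0 subrr.
  have {}hbe : phi (b0 - c0) = b1 + diff be.
    by rewrite hbe gmB [RHS]addrA [b1 + _]addrC subrK.
  have hb2 : diff (b0 - c0) = b by rewrite diffB hb0 dc0 subr0.
  move: (b0 - c0) hbe hb2 => b2 hbe hb2.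
  have [||a3 _ ha3] := inj (a - sg b2 * z).
  + rewrite /cocycle /= diffB diffMs dz mulr0 addr0 diff_sg hb2 mulNr opprK.
    exact: h1.
  + exists (a1 + sg be * phi z) => //.
    rewrite diffD diffMs dz' mulr0 addr0 diff_sg gmB gmM gmor_sc hbe scD -h3.
    by rewrite mulrDl opprD addrA addrK mulNr.
  exists (jE a3 + jE b2 * uE) => //.
  by rewrite (odd_ext_d HE) ha3 hb2 subrK.
- have [a' [b' ->]] := oe_gen HB y; rewrite /cocycle /= (odd_ext_d HB).
  move=> /(oe_inj HB) [h1 h2].
  have [//|b [db [be _ hbe]]] := surj b'.
  have hb' : b' = phi b + diff be by rewrite hbe addrC subrK.
  have [||a _ ha] := inj (sg b * z).
  + by rewrite /cocycle /= diffMs dz mulr0 addr0 diff_sg db sc0 oppr0 mul0r.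
  + exists (sg be * phi z - a') => //.
    rewrite diffB diffMs dz' mulr0 addr0 diff_sg gmM gmor_sc.
    have -> : phi b = b' - diff be by rewrite hb' addrK.
    rewrite scB mulrBl mulNr addrC; congr (_ + _).
    by apply/eqP; rewrite eq_sym -addr_eq0 addrC h1.
  have [|c [dc [et _ het]]] := surj (a' + phi a - sg be * phi z).
    rewrite /cocycle /= diffB diffD diffMs dz' mulr0 addr0 diff_sg -dmor_diff ha.
    rewrite gmM gmor_sc mulNr opprK -addrA -mulrDl -scD.
    by rewrite -hb' h1.
  exists (jE (- a) + jE b * uE + jE c); split.
    rewrite /cocycle /= diffD (odd_ext_d HE) -dmor_diff dc gm0 addr0 db gm0 mul0r addr0.
    by rewrite diffN ha addNr gm0.
  exists (jB et + jB be * uB) => //.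
  rewrite (odd_ext_d HB) (gmD phi') phiE e1 het hb' gmN.
  rewrite [jB (phi b + _)]gmD mulrDl.
  set U := jB (phi b) * uB; set W := jB (diff be) * uB.
  rewrite !(gmD, gmB, gmN).
  exact: zmod_id2.
Qed.

(** Adjoin a generator of the same degree to T, B and E: all three maps
    extend, the extended phi is a quasi-isomorphism by [quasi_iso_odd], and
    the identities between them hold on generators. *)
Lemma retractable_odd (T B T' : cdga) (rho : dmor T B) (j : dmor T T') k z u :
  odd_ext j k z u -> retractable rho ->
  exists (B' : cdga) (rho' : dmor T' B') (jB : dmor B B'),
    retractable rho' /\ forall a, rho' (j a) = jB (rho a).
Proof.
move=> H [E [iota [phi [tau [qi e1 e2]]]]].
have ok := oe_odd H.
have dz : diff z = 0.
  apply: (oe_inj H (b := 0) _).1; rewrite gm0 mul0r addr0.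
  by rewrite dmor_diff -(oe_d H) diffK.
have zg : gr k.+1 z.
  have := diff_gr (oe_gr H); rewrite (oe_d H) -[j z]addr0 -(mul0r u) -(gm0 j).
  by move=> /(oe_grade H) [].
have dgi (C : cdga) (f : dmor T C) : gr k.+1 (f z) /\ diff (f z) = 0.
  by split; [exact: gmor_gr | rewrite -dmor_diff dz gm0].
have [zEg dzE] := dgi _ iota; have [zBg dzB] := dgi _ rho.
have [E' [jE [uE HE]]] := odd_ext_exists ok zEg dzE.
have [B' [jB [uB HB]]] := odd_ext_exists ok zBg dzB.
have [r' [r1 r2]] := one_map (odd_one H) (f := dcomp jB rho) (oe_gr HB) (oe_d HB).
have [i' [i1 i2]] := one_map (odd_one H) (f := dcomp jE iota) (oe_gr HE) (oe_d HE).
have dB : diff uB = dcomp jB phi (iota z) by rewrite (oe_d HB) dcompE e1.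
have [p' [p1 p2]] := one_map (odd_one HE) (oe_gr HB) dB.
have dt : diff u = dcomp j tau (iota z) by rewrite (oe_d H) dcompE e2.
have [t' [t1 t2]] := one_map (odd_one HE) (oe_gr H) dt.
exists B', r', jB; split; last by move=> a; rewrite r1.
exists E', i', p', t'; split.
- by apply: (quasi_iso_odd HE (uB := uB) (jB := jB) _ p1 p2 qi); rewrite e1.
- apply: (one_eq (odd_one H) (h := dcomp p' i') (h' := r')) => [a|].
    by rewrite dcompE i1 dcompE p1 r1 !dcompE e1.
  by rewrite dcompE i2 p2 r2.
- apply: (one_eq (odd_one H) (h := dcomp t' i') (h' := did _)) => [a|].
    by rewrite dcompE i1 dcompE t1 dcompE e2.
  by rewrite dcompE i2 t2.
Qed.

(** * Vanishing of cohomology in high word length *)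

(** Word length is encoded by an algebra endomorphism th that multiplies each
    generator by 2: the elements of length k are those with th x = 2 ^ k x,
    and no grading has to be carried along an extension. The primitive is
    required to have length k - 1. *)
Definition vanish (R : cdga) (th : gmor R R) (c : nat) : Prop :=
  forall k (x : R), (c < k)%N -> th x = 2 ^+ k *: x -> diff x = 0 ->
  exists y, diff y = x /\ th y = 2 ^+ k.-1 *: y.

Lemma odd_ext_split (R R' : cdga) (j : dmor R R') k z u : odd_ext j k z u ->
  forall a b a' b', j a + j b * u = j a' + j b' * u -> a = a' /\ b = b'.
Proof.
move=> H a b a' b' /eqP; rewrite -subr_eq0 opprD addrACA -mulrBl -!gmB => /eqP /(oe_inj H).
by move=> [/eqP + /eqP]; rewrite !subr_eq0 => /eqP -> /eqP ->.
Qed.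

Lemma scale2_inj (V : lmodType rat) (x y : V) : 2 *: x = 2 *: y -> x = y.
Proof. by apply: scalerI. Qed.

Section VanishOdd.
Variables (R R' : cdga) (j : dmor R R') (k : nat) (z : R) (u : R').
Hypothesis H : odd_ext j k z u.
Variables (th : gmor R R) (th' : gmor R' R').
Hypotheses (thj : forall a, th' (j a) = j (th a)) (thu : th' u = 2 *: u)
  (thz : th z = 4 *: z).

Lemma th_split l a b : th' (j a + j b * u) = 2 ^+ l.+1 *: (j a + j b * u) ->
  th a = 2 ^+ l.+1 *: a /\ th b = 2 ^+ l *: b.
Proof.
rewrite gmD gmM !thj thu -scalerAr scalerDr !scalerAl -!(gmZ j).
move=> /(odd_ext_split H) [-> e]; split=> //.
by apply: scale2_inj; rewrite e scalerA -exprS.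
Qed.
Lemma th_join l a b : th a = 2 ^+ l.+1 *: a -> th b = 2 ^+ l *: b ->
  th' (j a + j b * u) = 2 ^+ l.+1 *: (j a + j b * u).
Proof.
move=> ha hb; rewrite gmD gmM !thj thu ha hb !gmZ -scalerAr -!scalerAl.
by rewrite scalerA -exprS scalerDr.
Qed.
Lemma th_sgz l b : th b = 2 ^+ l *: b -> th (sg b * z) = 2 ^+ l.+2 *: (sg b * z).
Proof.
move=> hb; rewrite gmM gmor_sc hb thz scZ -scalerAl -scalerAr scalerA.
by rewrite !exprSr -mulrA.
Qed.

Lemma odd_ext_dz : diff z = 0.
Proof.
apply: (oe_inj H (b := 0) _).1; rewrite gm0 mul0r addr0.
by rewrite dmor_diff -(oe_d H) diffK.
Qed.

(** For a cocycle a + b u the coefficient b is a cocycle one length lower, so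
    b = dg; subtracting d(g u) leaves a cocycle of R. *)
Lemma vanish_odd c : vanish th c -> vanish th' c.+1.
Proof.
move=> V [//|[//|l]] x ck; have [a [b ->]] := oe_gen H x.
move=> /th_split [wa wb]; rewrite (odd_ext_d H).
move=> /(oe_inj H) [h1 h2].
have [//|g [dg wg]] := V _ b _ wb h2.
have [| |h [dh wh]] := V _ (a - sg g * z) (ltnW ck).
- by rewrite gmB wa (th_sgz wg) scalerBr.
- rewrite diffB diffMs odd_ext_dz mulr0 addr0 diff_sg dg mulNr opprK.
  exact: h1.
- exists (j h + j g * u); split; last exact: th_join.
  by rewrite (odd_ext_d H) dh dg subrK.
Qed.

(** A cocycle x of length c + 1 makes x z a cocycle of length c + 3, which
    bounds by the weaker hypothesis on R. This turns x u into a cocycle of R'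
    of length c + 2, which bounds; the coefficient of u in a primitive is a
    primitive of x. *)
Lemma vanish_odd_conv c : vanish th' c.+1 -> vanish th c.+1 -> vanish th c.
Proof.
move=> V' V k' x ck wx dx; have [ck'|ek] : (c.+1 < k')%N \/ k' = c.+1 by lia.
  exact: V.
have [||| a [da wa]] := V k'.+2 (sg x * z).
- by rewrite ek; lia.
- exact: th_sgz.
- by rewrite diffMs odd_ext_dz mulr0 addr0 diff_sg dx sc0 oppr0 mul0r.
have [|||y [dy wy]] := V' k'.+1 (j (- a) + j x * u).
- by rewrite ek.
- apply: th_join => //; by rewrite gmN wa scalerN.
- by rewrite (odd_ext_d H) diffN da addNr dx !gm0 mul0r addr0.
have [a1 [b1 ey]] := oe_gen H y.
move: dy wy; rewrite ey (odd_ext_d H) => /(odd_ext_split H) [_ db1].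
by rewrite ek /= => /th_split [_ wb1]; exists b1.
Qed.
End VanishOdd.

Lemma even_ext_inj3 (R R' : cdga) (j : dmor R R') k z x : even_ext j k z x ->
  forall a b c, j a + j b * x + c * x ^+ 2 = 0 -> [/\ a = 0, b = 0 & c = 0].
Proof.
move=> H a b c; have [N [f ->]] := ee_gen H c => e.
pose f' l := if l is l'.+1 then if l' is l''.+1 then f l'' else b else a.
have e' : \sum_(l < N.+2) j (f' l) * x ^+ l = 0.
  rewrite !big_ord_recl /= expr0 mulr1 expr1 -[RHS]e mulr_suml addrA; congr (_ + _).
  by apply: eq_bigr => i _; rewrite /bump /= !add1n -mulrA -exprD addn2.
have f0 := ee_inj H e'; split; [exact: (f0 0%N) | exact: (f0 1%N) |].
rewrite big1 // => i _; have := f0 i.+2; rewrite /= !ltnS ltn_ord => -> //.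
by rewrite gm0 mul0r.
Qed.

Section VanishSquare.
Variables (R Rx R' : cdga) (j : dmor R Rx) (j2 : dmor Rx R') (k ku : nat)
  (x : Rx) (u : R').
Hypotheses (Hx : even_ext j k 0 x) (Hu : odd_ext j2 ku (x ^+ 2) u).
Variables (th : gmor R R) (th' : gmor R' R').
Hypotheses (thj : forall a, th' (j2 (j a)) = j2 (j (th a)))
  (thx : th' (j2 x) = 2 *: j2 x) (thu : th' u = 2 *: u).

(** R[x, u] with du = x^2 has the cohomology of R + R x. Dividing the constant
    coefficient p of a cocycle p + q u by x^2, with quotient p', the boundary
    d(sg p' u) removes q and leaves p0 + p1 x with p0 and p1 cocycles of R. *)
Lemma vanish_square c : vanish th c -> vanish th' c.+1.
Proof.
move=> V.
have [thX [thX1 thX2]] := on_univ (even_one Hx) (gcomp j th) (grZ 2 (ee_gr Hx)).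
have thj2 a : th' (j2 a) = j2 (thX a).
  apply: (one_eq (even_one Hx) (h := gcomp th' j2) (h' := gcomp j2 thX)) => [b|].
    by rewrite gcompE thj gcompE thX1.
  by rewrite !gcompE thx thX2 gmZ.
have thxx : thX (x ^+ 2) = 4 *: (x ^+ 2).
  by rewrite expr2 gmM thX2 -scalerAl -scalerAr scalerA.
have dx : diff x = 0 by rewrite (ee_d Hx) gm0.
have xev : sg x = x := sg_even (ee_even Hx) (ee_gr Hx).
have sx2 : sg (x ^+ 2) = x ^+ 2 by rewrite expr2 scM xev.
have dx2 : diff (x ^+ 2) = 0 by rewrite expr2 diffMs dx mul0r mulr0 addr0.
have d3 a b : diff (j a + j b * x) = j (diff a) + j (diff b) * x.
  by rewrite diffD diffMs dx mulr0 addr0 -!dmor_diff.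
move=> [//|[//|l]] e ck; have [p [q ->]] := oe_gen Hu e.
move=> /(th_split Hu thj2 thu) [wp wq]; rewrite (odd_ext_d Hu).
move=> /(oe_inj Hu) [h1 h2].
have [p0 [p1 [p' ep]]] : exists a b c, p = j a + j b * x + c * x ^+ 2.
  have [N [f ef]] := ee_gen Hx p.
  pose g i := if (i < N)%N then f i else 0.
  exists (g 0%N), (g 1%N), (\sum_(i < N) j (g i.+2) * x ^+ i).
  have -> : p = \sum_(i < N.+2) j (g i) * x ^+ i.
    rewrite ef (big_ord_widen N.+2 (fun i => j (f i) * x ^+ i)) ?leqW //.
    rewrite big_mkcond; apply: eq_bigr => i _; rewrite /g.
    by case: ifP => // _; rewrite gm0 mul0r.
  rewrite !big_ord_recl /= expr0 mulr1 expr1 addrA mulr_suml; congr (_ + _).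
  by apply: eq_bigr => i _; rewrite /bump /= !add1n -mulrA -exprD addn2.
have [w0 w1 w'] : [/\ th p0 = 2 ^+ l.+2 *: p0, th p1 = 2 ^+ l.+1 *: p1 &
    thX p' = 2 ^+ l *: p'].
  have wE : thX p = j (th p0) + j (2 *: th p1) * x + (4 *: thX p') * x ^+ 2.
    rewrite ep [LHS]gmD [thX (j p0 + _)]gmD [thX (j p1 * x)]gmM [thX (p' * _)]gmM.
    by rewrite !thX1 thxx thX2 gmZ -!scalerAl -!scalerAr.
  have e0 : j (th p0 - 2 ^+ l.+2 *: p0) + j (2 *: th p1 - 2 ^+ l.+2 *: p1) * x +
      (4 *: thX p' - 2 ^+ l.+2 *: p') * x ^+ 2 = 0.
    rewrite (gmB j (th p0)) (gmB j (2 *: th p1)) (gmZ j _ p0) (gmZ j _ p1).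
    rewrite [(j _ - _) * x]mulrBl [(4 *: _ - _) * _]mulrBl.
    rewrite [X in X + _]addrACA [LHS]addrACA -wE wp {1}ep.
    by rewrite -!opprD -!scalerAl -!scalerDr subrr.
  have [/eqP + /eqP + /eqP] := even_ext_inj3 Hx e0.
  rewrite !subr_eq0 => /eqP e1 /eqP e2 /eqP e3; split=> //.
    by apply: scale2_inj; rewrite e2 scalerA -exprS.
  do 2!apply: scale2_inj; transitivity (4 *: thX p'); first by rewrite scalerA.
  by rewrite e3 !scalerA -mulrA -!exprS.
pose s := sg p'.
have ws : thX s = 2 ^+ l *: s by rewrite /s gmor_sc w' scZ.
pose q' := q - diff s.
have [dp0 dp1 q0] : [/\ diff p0 = 0, diff p1 = 0 & sg q' = 0].
  apply: (even_ext_inj3 Hx); rewrite -d3 -[RHS]h1 ep [in RHS]diffD -addrA.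
  congr (_ + _); rewrite diffMs dx2 mulr0 addr0 -mulrDl; congr (_ * _).
  rewrite /q' scB addrC; congr (_ + _).
  by rewrite /s diff_sg scN sgK opprK.
have eq : q = diff s.
  apply/eqP; rewrite -subr_eq0 -/q'; apply/eqP.
  by rewrite -(sgK q') q0 sc0.
have [y0 [dy0 wy0]] := V l.+2 p0 (ltnW ck) w0 dp0.
have [y1 [dy1 wy1]] := V l.+1 p1 ck w1 dp1.
exists (j2 (j y0 + j y1 * x) + j2 s * u); split.
  rewrite (odd_ext_d Hu) d3 dy0 dy1 -eq ep; congr (j2 (_ + _) + _).
  by rewrite /s sgK.
rewrite [in RHS]/=; apply: (th_join thj2 thu _ ws).
rewrite [LHS]gmD [thX (_ * _)]gmM !thX1 !gcompE thX2 wy0 wy1 !(gmZ j) -scalerAl -scalerAr scalerA.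
by rewrite -exprSr scalerDr.
Qed.
End VanishSquare.

(** * Finite towers of extensions *)

(** Several odd generators with differentials in R, kept with the properties
    that pass from one generator to all of them: universal property,
    retractions, nonvanishing of the top product of closed generators
    ([ot_top]) and vanishing of cohomology in both directions. *)
Record odd_tower (R M : cdga) (j : dmor R M) (s : nat) (k : 'I_s -> nat)
    (z : 'I_s -> R) (u : 'I_s -> M) : Prop := OddTower {
  ot_gr : forall i, gr (k i) (u i);
  ot_d : forall i, diff (u i) = j (z i);
  ot_ind : forall P : M -> Prop, (forall a, P (j a)) -> (forall i, P (u i)) ->
    (forall x y, P x -> P y -> P (x + y)) ->
    (forall x y, P x -> P y -> P (x * y)) -> forall x, P x;
  ot_univ : forall (C : gca) (f : gmor R C) (c : 'I_s -> C),
    (forall i, gr (k i) (c i)) ->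
    exists h : gmor M C, (forall a, h (j a) = f a) /\ forall i, h (u i) = c i;
  ot_indep : forall a (c : 'I_s -> rat), j a + \sum_i c i *: u i = 0 ->
    a = 0 /\ forall i, c i = 0;
  ot_retr : forall (B : cdga) (rho : dmor R B), retractable rho ->
    exists (B' : cdga) (rho' : dmor M B') (jB : dmor B B'),
      retractable rho' /\ forall a, rho' (j a) = jB (rho a);
  ot_top : (forall i, z i = 0) -> forall a, (forall y, diff y <> a) ->
    forall y, diff y <> j a * \prod_i u i;
  ot_vanish : forall (th : gmor R R) (th' : gmor M M),
    (forall a, th' (j a) = j (th a)) -> (forall i, th' (u i) = 2 *: u i) ->
    (forall i, th (z i) = 4 *: z i) ->
    (forall c, vanish th c -> vanish th' (c + s)) /\
    (forall c c0, vanish th' (c + s) -> vanish th c0 -> vanish th c)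
}.

Lemma vanish_le (R : cdga) (th : gmor R R) c c' :
  (c <= c')%N -> vanish th c -> vanish th c'.
Proof. by move=> cc V k x ck; apply: V; exact: leq_ltn_trans ck. Qed.

Lemma vanish_ext (R : cdga) (th th' : gmor R R) c :
  (forall x, th x = th' x) -> vanish th c -> vanish th' c.
Proof.
move=> e V k x ck wx dx; have [|y [dy wy]] := V k x ck _ dx; first by rewrite e.
by exists y; rewrite -e.
Qed.

Lemma odd_tower0 (R : cdga) (k : 'I_0 -> nat) z u : odd_tower (did R) k z u.
Proof.
split.
- by case.
- by case.
- by move=> P Pj *; exact: Pj.
- by move=> C f c _; exists f; split => // -[].
- by move=> a c; rewrite big_ord0 addr0 didE => ->; split=> // -[].
- by move=> B rho H; exists B, rho, (did B).
- by move=> _ a h y; rewrite big_ord0 mulr1; exact: h.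
- move=> th th' e1 _ _; split=> [c|c c0]; rewrite addn0.
    by apply: vanish_ext => x; rewrite -[x]/(did R x) e1.
  by move=> V _; move: V; apply: vanish_ext => x; rewrite -[x]/(did R x) e1.
Qed.

(** Downwards, the second part of [ot_vanish] is a repeated use of
    [vanish_odd_conv], which lowers a bound by one only when the bound above
    it is already known: one descends from c0 to c. *)
Lemma odd_tower_step (R R' M : cdga) (j : dmor R R') (j' : dmor R' M) s
    (k : 'I_s.+1 -> nat) (z : 'I_s.+1 -> R) (u0 : R') (us : 'I_s -> M) :
  odd_ext j (k ord0) (z ord0) u0 ->
  odd_tower j' (fun i => k (lift ord0 i)) (fun i => j (z (lift ord0 i))) us ->
  odd_tower (dcomp j' j) k z
    (fun i => if unlift ord0 i is Some i' then us i' else j' u0).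
Proof.
move=> H T; set u := fun i => _.
have uS i : u (lift ord0 i) = us i by rewrite /u liftK.
have u00 : u ord0 = j' u0 by rewrite /u unlift_none.
have ordP (P : 'I_s.+1 -> Prop) : P ord0 -> (forall i, P (lift ord0 i)) -> forall i, P i.
  by move=> P0 PS i; case: (unliftP ord0 i) => [i' ->|->].
have H1 := odd_one H.
split.
- apply: ordP => [|i]; first by rewrite u00; apply: gmor_gr; exact: oe_gr H.
  by rewrite uS; exact: ot_gr T i.
- apply: ordP => [|i]; first by rewrite u00 -dmor_diff (oe_d H).
  by rewrite uS (ot_d T) dcompE.
- move=> P Pj Pu PD PM; apply: (ot_ind T) => // [a|i]; last by rewrite -uS.
  apply: (one_ind H1 (P := fun a => P (j' a))) => // [|x y|x y].
  + by rewrite -u00.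
  + by rewrite gmD; exact: PD.
  + by rewrite gmM; exact: PM.
- move=> C f c cg; have [h [h1 h2]] := on_univ H1 f (cg ord0).
  have [h' [h1' h2']] := ot_univ T h (fun i => cg (lift ord0 i)).
  exists h'; split=> [a|]; first by rewrite dcompE h1' h1.
  by apply: ordP => [|i]; rewrite ?u00 ?uS ?h2' ?h1' ?h2.
- move=> a c; rewrite big_ord_recl u00 dcompE.
  under eq_bigr do rewrite uS.
  rewrite addrA -gmZ -gmD => /(ot_indep T) [e1 e2].
  have : j a + j (c ord0 *: 1) * u0 = 0 by rewrite gmZ gm1 -scalerAl mul1r.
  move=> /(oe_inj H) [-> /eqP]; rewrite scaler_eq0 oner_eq0 orbF => /eqP c0.
  by split=> //; apply: ordP.
- move=> B rho hr; have [B1 [rho1 [jB [hr1 e1]]]] := retractable_odd H hr.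
  have [B2 [rho2 [jB2 [hr2 e2]]]] := ot_retr T hr1.
  by exists B2, rho2, (dcomp jB2 jB); split=> // a; rewrite !dcompE e2 e1.
- move=> z0 a ha y; rewrite big_ord_recl u00 dcompE mulrA -gmM.
  under eq_bigr do rewrite uS.
  apply: (ot_top T) => [i|{}y]; first by rewrite z0 gm0.
  have [al [be ->]] := oe_gen H y; rewrite (odd_ext_d H) z0 mulr0 addr0.
  rewrite -[RHS]add0r -(gm0 j) => /(odd_ext_split H) [_]; exact: ha.
- move=> th th' e1 e2 e3.
  have [th1 [f1 f2]] := on_univ H1 (gcomp j th) (grZ 2 (oe_gr H)).
  have e4 a : th' (j' a) = j' (th1 a).
    apply: (one_eq H1 (h := gcomp th' j') (h' := gcomp j' th1)) => [b|].
      by rewrite !gcompE f1 gcompE -dcompE e1.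
    by rewrite !gcompE f2 -u00 e2 u00 gmZ.
  have [||A1 A2] := ot_vanish T e4.
  + by move=> i; rewrite -uS e2.
  + by move=> i; rewrite f1 gcompE e3 gmZ.
  have f1' a : th1 (j a) = j (th a) by rewrite f1.
  have V1 := vanish_odd H f1' f2 (e3 ord0).
  have V2 := vanish_odd_conv H f1' f2 (e3 ord0).
  split=> [c V|c c0]; first by rewrite addnS -addSn; apply: A1; exact: V1.
  rewrite addnS -addSn => V' V0.
  have V3 := A2 _ c0.+1 V' (V1 _ V0).
  elim: c0 V0 => [|c0 ih] V0; first by apply: vanish_le V0.
  have [cc|cc] := ltnP c0.+1 c; first by apply: vanish_le V0; exact: ltnW.
  have [e|cn] := eqVneq c c0.+1; first by rewrite e.
  by apply: ih; apply: V2 V0; apply: vanish_le V3; lia.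
Qed.

Lemma odd_tower_exists (R : cdga) s (k : 'I_s -> nat) (z : 'I_s -> R) :
  (forall i, odd (k i)) -> (forall i, gr (k i).+1 (z i)) ->
  (forall i, diff (z i) = 0) ->
  exists (M : cdga) (j : dmor R M) (u : 'I_s -> M), odd_tower j k z u.
Proof.
elim: s R k z => [|s ih] R k z ok zg zc.
  by exists R, (did R), (fun i => 0); exact: odd_tower0.
have [R' [j [u0 H]]] := odd_ext_exists (ok ord0) (zg ord0) (zc ord0).
have [|||M [j' [us T]]] := ih R' (fun i => k (lift ord0 i)) (fun i => j (z (lift ord0 i))).
- by move=> i; exact: ok.
- by move=> i; apply: gmor_gr; exact: zg.
- by move=> i; rewrite -dmor_diff zc gm0.
by exists M, (dcomp j' j), (fun i => if unlift ord0 i is Some i' then us i' else j' u0);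
   exact: odd_tower_step H T.
Qed.

Section OddTower.
Variables (R M : cdga) (j : dmor R M) (s : nat) (k : 'I_s -> nat)
  (z : 'I_s -> R) (u : 'I_s -> M).
Hypothesis T : odd_tower j k z u.
Lemma ot_eq (C : gca) (h h' : gmor M C) : (forall a, h (j a) = h' (j a)) ->
  (forall i, h (u i) = h' (u i)) -> forall x, h x = h' x.
Proof.
move=> e1 e2; apply: (ot_ind T) => // x y hx hy; first by rewrite !gmD hx hy.
by rewrite !gmM hx hy.
Qed.
Lemma ot_map (C : cdga) (f : dmor R C) (c : 'I_s -> C) :
  (forall i, gr (k i) (c i)) -> (forall i, diff (c i) = f (z i)) ->
  exists h : dmor M C, (forall a, h (j a) = f a) /\ forall i, h (u i) = c i.
Proof.
move=> cg cd; have [h [h1 h2]] := ot_univ T f cg.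
have [PD PM P0 P1 PZ] := dcomm_ind h.
have hd x : h (diff x) = diff (h x).
  move: x; apply: (ot_ind T) => // [a|i].
    by rewrite -dmor_diff !h1 dmor_diff.
  by rewrite h2 cd (ot_d T) h1.
by exists (mk_dmor hd).
Qed.
End OddTower.

(** M = R (x) Q[x_1, ..., x_n] (x) Lambda(u_1, ..., u_n) with du_i = x_i ^ 2.
    *)
Record square_tower (R M : cdga) (j : dmor R M) (s : nat) (k : 'I_s -> nat)
    (x u : 'I_s -> M) : Prop := SquareTower {
  st_xgr : forall i, gr (k i) (x i);
  st_ugr : forall i, gr (2 * k i).-1 (u i);
  st_dx : forall i, diff (x i) = 0;
  st_du : forall i, diff (u i) = x i ^+ 2;
  st_ind : forall P : M -> Prop, (forall a, P (j a)) -> (forall i, P (x i)) ->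
    (forall i, P (u i)) ->
    (forall x y, P x -> P y -> P (x + y)) ->
    (forall x y, P x -> P y -> P (x * y)) -> forall x, P x;
  st_univ : forall (C : gca) (f : gmor R C) (cx cu : 'I_s -> C),
    (forall i, gr (k i) (cx i)) -> (forall i, gr (2 * k i).-1 (cu i)) ->
    exists h : gmor M C, [/\ forall a, h (j a) = f a,
       forall i, h (x i) = cx i & forall i, h (u i) = cu i];
  st_vanish : forall (th : gmor R R) (th' : gmor M M),
    (forall a, th' (j a) = j (th a)) -> (forall i, th' (x i) = 2 *: x i) ->
    (forall i, th' (u i) = 2 *: u i) ->
    forall c, vanish th c -> vanish th' (c + s)
}.

Lemma square_tower_exists (R : cdga) s (k : 'I_s -> nat) :
  (forall i, ~~ odd (k i)) -> (forall i, (0 < k i)%N) ->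
  exists (M : cdga) (j : dmor R M) (x u : 'I_s -> M), square_tower j k x u.
Proof.
elim: s R k => [|s ih] R k ek k0.
  exists R, (did R), (fun i => 0), (fun i => 0); split; try by case.
  - by move=> P Pj *; exact: Pj.
  - by move=> C f cx cu _ _; exists f; split => // -[].
  - move=> th th' e1 _ _ c; rewrite addn0.
    by apply: vanish_ext => x; rewrite -[x]/(did R x) e1.
have [Rx [j1 [x0 Hx]]] := even_ext_exists (ek ord0) (gr0 R _) (diff0 R).
have xg2 : gr (2 * k ord0).-1.+1 (x0 ^+ 2).
  rewrite prednK ?muln_gt0 ?k0 // mul2n -addnn expr2.
  by apply: grM; exact: ee_gr Hx.
have dx0 : diff x0 = 0 by rewrite (ee_d Hx) gm0.
have dx2 : diff (x0 ^+ 2) = 0 by rewrite expr2 diffMs dx0 mul0r mulr0 addr0.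
have ou : odd (2 * k ord0).-1.
  have := k0 ord0; case: (k ord0) => // n _.
  by rewrite mul2n doubleS /= odd_double.
have [R' [j2 [u0 Hu]]] := odd_ext_exists ou xg2 dx2.
have [||M [j' [xs [us T]]]] := ih R' (fun i => k (lift ord0 i)); [by move=> i..|].
exists M, (dcomp j' (dcomp j2 j1)),
  (fun i => if unlift ord0 i is Some i' then xs i' else j' (j2 x0)),
  (fun i => if unlift ord0 i is Some i' then us i' else j' u0).
set x := fun i => _; set u := fun i => _.
have uS i : u (lift ord0 i) = us i by rewrite /u liftK.
have u00 : u ord0 = j' u0 by rewrite /u unlift_none.
have xS i : x (lift ord0 i) = xs i by rewrite /x liftK.
have x00 : x ord0 = j' (j2 x0) by rewrite /x unlift_none.
have ordP (P : 'I_s.+1 -> Prop) : P ord0 -> (forall i, P (lift ord0 i)) -> forall i, P i.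
  by move=> P0 PS i; case: (unliftP ord0 i) => [i' ->|->].
have Hx1 := even_one Hx; have Hu1 := odd_one Hu.
split.
- apply: ordP => [|i]; first by rewrite x00; do 2!apply: gmor_gr; exact: ee_gr Hx.
  by rewrite xS; exact: st_xgr T i.
- apply: ordP => [|i]; first by rewrite u00; apply: gmor_gr; exact: oe_gr Hu.
  by rewrite uS; exact: st_ugr T i.
- apply: ordP => [|i]; first by rewrite x00 -!dmor_diff dx0 !gm0.
  by rewrite xS (st_dx T).
- apply: ordP => [|i]; first by rewrite u00 x00 -!dmor_diff (oe_d Hu) !gmX.
  by rewrite xS uS (st_du T).
- move=> P Pj Px Pu PD PM; apply: (st_ind T) => // [a|i|i].
  + apply: (one_ind Hu1 (P := fun a => P (j' a))) => // [{}a| |y y'|y y'].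
    * apply: (one_ind Hx1 (P := fun a => P (j' (j2 a)))) => // [|y y'|y y'].
      - by rewrite -x00.
      - by rewrite !gmD; exact: PD.
      - by rewrite !gmM; exact: PM.
    * by rewrite -u00.
    * by rewrite gmD; exact: PD.
    * by rewrite gmM; exact: PM.
  + by rewrite -xS.
  + by rewrite -uS.
- move=> C f cx cu cxg cug; have [h [h1 h2]] := on_univ Hx1 f (cxg ord0).
  have [h' [h1' h2']] := on_univ Hu1 h (cug ord0).
  have [h'' [a1 a2 a3]] := st_univ T h' (fun i => cxg (lift ord0 i)) (fun i => cug (lift ord0 i)).
  exists h''; split=> [a||]; first by rewrite !dcompE a1 h1' h1.
    by apply: ordP => [|i]; rewrite ?x00 ?xS ?a2 ?a1 ?h1' ?h2.
  by apply: ordP => [|i]; rewrite ?u00 ?uS ?a3 ?a1 ?h2'.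
- move=> th th' e1 e2 e3 c V.
  have [th0 [f1 f2]] := on_univ Hx1 (gcomp j1 th) (grZ 2 (ee_gr Hx)).
  have [th1 [g1 g2]] := on_univ Hu1 (gcomp j2 th0) (grZ 2 (oe_gr Hu)).
  have e4 a : th' (j' a) = j' (th1 a).
    apply: (one_eq Hu1 (h := gcomp th' j') (h' := gcomp j' th1)) => [b|].
      rewrite !gcompE g1 gcompE.
      apply: (one_eq Hx1 (h := gcomp th' (gcomp j' j2)) (h' := gcomp j' (gcomp j2 th0))) => [d|].
        by rewrite !gcompE f1 gcompE -!dcompE e1.
      by rewrite !gcompE f2 -x00 e2 x00 !gmZ.
    by rewrite !gcompE g2 -u00 e3 u00 gmZ.
  rewrite addnS -addSn; apply: (st_vanish T (th := th1)) => // [i|i|].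
  + by rewrite -xS e2.
  + by rewrite -uS e3.
  apply: (vanish_square Hx Hu _ _ g2 V) => [a|].
    by rewrite g1 gcompE f1.
  by rewrite g1 gcompE f2 gmZ.
Qed.

Section SquareTower.
Variables (R M : cdga) (j : dmor R M) (s : nat) (k : 'I_s -> nat)
  (x u : 'I_s -> M).
Hypothesis T : square_tower j k x u.
Lemma st_eq (C : gca) (h h' : gmor M C) : (forall a, h (j a) = h' (j a)) ->
  (forall i, h (x i) = h' (x i)) ->
  (forall i, h (u i) = h' (u i)) -> forall x, h x = h' x.
Proof.
move=> e1 e2 e3; apply: (st_ind T) => // a b ha hb; first by rewrite !gmD ha hb.
by rewrite !gmM ha hb.
Qed.
Lemma st_map (C : cdga) (f : dmor R C) (cx cu : 'I_s -> C) :
  (forall i, gr (k i) (cx i)) -> (forall i, gr (2 * k i).-1 (cu i)) ->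
  (forall i, diff (cx i) = 0) -> (forall i, diff (cu i) = cx i ^+ 2) ->
  exists h : dmor M C, [/\ forall a, h (j a) = f a,
       forall i, h (x i) = cx i & forall i, h (u i) = cu i].
Proof.
move=> cxg cug dx du; have [h [h1 h2 h3]] := st_univ T f cxg cug.
have [PD PM P0 P1 PZ] := dcomm_ind h.
have hd a : h (diff a) = diff (h a).
  move: a; apply: (st_ind T) => // [a|i|i].
  - by rewrite -dmor_diff !h1 dmor_diff.
  - by rewrite h2 dx (st_dx T) gm0.
  - by rewrite h3 du (st_du T) gmX h2.
by exists (mk_dmor hd).
Qed.
End SquareTower.

(** * Linear algebra *)

Section Span.
Variable M : lmodType rat.
Implicit Types (S Z : set M).

Definition subsp (Z : set M) : Prop :=
  Z 0 /\ forall (c : rat) x y, Z x -> Z y -> Z (c *: x + y).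

Lemma subsp_sum Z (I : Type) (s : seq I) (P : pred I) (F : I -> M) :
  subsp Z -> (forall i, P i -> Z (F i)) -> Z (\sum_(i <- s | P i) F i).
Proof.
move=> [Z0 ZL] h; apply: big_ind => // x y hx hy.
by rewrite -[x]scale1r; exact: ZL.
Qed.
Lemma subspZ Z c x : subsp Z -> Z x -> Z (c *: x).
Proof. by move=> [Z0 ZL] hx; rewrite -[_ *: _]addr0; exact: ZL. Qed.
Lemma subspD Z x y : subsp Z -> Z x -> Z y -> Z (x + y).
Proof. by move=> [Z0 ZL] hx; rewrite -[x]scale1r; exact: ZL. Qed.
Lemma subspB Z x y : subsp Z -> Z x -> Z y -> Z (x - y).
Proof. by move=> Zs hx hy; apply: subspD => //; rewrite -scaleN1r; exact: subspZ. Qed.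

Lemma lspan_gen S x : S x -> lspan S x.
Proof.
move=> hx; exists 1%N, (fun=> 1), (fun=> x); split=> //.
by rewrite big_ord1 scale1r.
Qed.
Lemma lspan_ind S (P : set M) : subsp P -> (forall x, S x -> P x) ->
  forall x, lspan S x -> P x.
Proof.
move=> Ps h x [n [c [v [vS ->]]]]; apply: subsp_sum => // i _.
by apply: subspZ => //; apply: h.
Qed.
Lemma lspan_subsp S : subsp (lspan S).
Proof.
split; first by exists 0%N, (fun=> 0), (fun=> 0); split; [case | rewrite big_ord0].
move=> c x y [n [a [v [vS ->]]]] [m [b [w [wS ->]]]].
exists (n + m)%N,
  (fun i => match split i with inl i => c * a i | inr i => b i end),
  (fun i => match split i with inl i => v i | inr i => w i end); split.
  by move=> i; case: split.
rewrite big_split_ord /= scaler_sumr; congr (_ + _); apply: eq_bigr => i _.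
  by rewrite (unsplitK (inl i)) scalerA.
by rewrite (unsplitK (inr i)).
Qed.
Lemma lspan_mono S S' : S `<=` S' -> lspan S `<=` lspan S'.
Proof.
move=> h; apply: (@lspan_ind S); first exact: lspan_subsp.
by move=> x /h; exact: lspan_gen.
Qed.
Lemma lspan_seq (s : seq M) x : lspan [set` s] x ->
  exists c : 'I_(size s) -> rat, x = \sum_i c i *: s`_i.
Proof.
move: x; apply: lspan_ind.
  split; first by exists (fun=> 0); rewrite big1 // => i _; rewrite scale0r.
  move=> c x y [a ->] [b ->]; exists (fun i => c * a i + b i).
  rewrite scaler_sumr -big_split /=; apply: eq_bigr => i _.
  by rewrite scalerDl scalerA.
move=> x /= xs; have h : (index x s < size s)%N by rewrite index_mem.
exists (fun i => (i == Ordinal h)%:R).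
rewrite (bigD1 (Ordinal h)) //= eqxx scale1r nth_index // big1 ?addr0 //.
by move=> i /negbTE ->; rewrite scale0r.
Qed.
Lemma lspan_family n (v : 'I_n -> M) x : lspan (range v) x ->
  exists c : 'I_n -> rat, x = \sum_i c i *: v i.
Proof.
move: x; apply: lspan_ind.
  split; first by exists (fun=> 0); rewrite big1 // => i _; rewrite scale0r.
  move=> c x y [a ->] [b ->]; exists (fun i => c * a i + b i).
  rewrite scaler_sumr -big_split /=; apply: eq_bigr => i _.
  by rewrite scalerDl scalerA.
move=> _ [h _ <-]; exists (fun i => (i == h)%:R).
rewrite (bigD1 h) //= eqxx scale1r big1 ?addr0 //.
by move=> i /negbTE ->; rewrite scale0r.
Qed.

Lemma lin_indep_size (s : seq M) n (v : 'I_n -> M) :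
  (forall i, lspan [set` s] (v i)) -> lin_indep v -> (n <= size s)%N.
Proof.
move=> vs vi; have /choice [a ha] := fun i => lspan_seq (vs i).
pose B : 'M[rat]_(n, size s) := \matrix_(i, l) a i l.
suff /eqP <- : row_free B by exact: rank_leq_col.
apply: inj_row_free => w wB; apply/rowP => i; rewrite mxE.
apply: (vi (w ord0)) i.
under eq_bigr => i _ do rewrite ha scaler_sumr.
rewrite exchange_big big1 // => l _ /=.
under eq_bigr do rewrite scalerA.
rewrite -scaler_suml (_ : \sum_i _ = 0) ?scale0r //.
transitivity ((w *m B) ord0 l); last by rewrite wB mxE.
by rewrite mxE; apply: eq_bigr => i _; rewrite mxE.
Qed.

Lemma fin_dim_size S : fin_dim S -> exists N, forall n (v : 'I_n -> M),
  (forall i, S (v i)) -> lin_indep v -> (n <= N)%N.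
Proof.
move=> [s hs]; exists (size s) => n v vS; apply: lin_indep_size => i.
exact/hs/vS.
Qed.

(** A basis of (lspan H + Z) / Z taken from H: a family of elements of H that
    is independent modulo Z and of maximal length. With Z = 0 it is a
    homogeneous basis, with Z the cocycles a complement, with Z the boundaries
    a basis of cohomology. *)
Lemma rel_basis (H Z : set M) : fin_dim H -> subsp Z ->
  exists d (h : 'I_d -> M), [/\ forall i, H (h i),
    forall c : 'I_d -> rat, Z (\sum_i c i *: h i) -> forall i, c i = 0 &
    forall x, lspan H x -> exists c : 'I_d -> rat, Z (x - \sum_i c i *: h i)].
Proof.
move=> /fin_dim_size [N hN] Zs.
pose P d := `[< exists h : 'I_d -> M, (forall i, H (h i)) /\
    forall c : 'I_d -> rat, Z (\sum_i c i *: h i) -> forall i, c i = 0 >].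
have P0 : exists d, P d.
  by exists 0%N; apply/asboolP; exists (fun=> 0); split=> [[]//|c _ []].
have PN d : P d -> (d <= N)%N.
  move=> /asboolP [h [hH hi]]; apply: (hN _ h) => // c c0; apply: hi.
  by rewrite c0; case: Zs.
case: (ex_maxnP P0 PN) => d /asboolP [h [hH hi]] dmax.
exists d, h; split=> //; apply: lspan_ind.
  split; first by exists (fun=> 0); rewrite big1 ?subr0 //; [case: Zs|move=> i _; rewrite scale0r].
  move=> c x y [a ha] [b hb]; exists (fun i => c * a i + b i).
  have -> : \sum_i (c * a i + b i) *: h i = c *: (\sum_i a i *: h i) + \sum_i b i *: h i.
    by rewrite scaler_sumr -big_split; apply: eq_bigr => i _; rewrite scalerDl scalerA.
  rewrite opprD addrACA -scalerBr; apply: subspD => //; exact: subspZ.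
move=> x Hx; apply: contrapT => nex.
suff : P d.+1 by move=> /dmax; rewrite ltnn.
apply/asboolP; exists (fun i => if unlift ord0 i is Some i' then h i' else x); split.
  by move=> i; case: unlift.
move=> c; rewrite big_ord_recl unlift_none.
under eq_bigr do rewrite liftK.
move=> Zc; have c0 : c ord0 = 0.
  apply/eqP; apply: contrapT => /negP c0; apply: nex.
  exists (fun i => - ((c ord0)^-1 * c (lift ord0 i))).
  have := subspZ (c ord0)^-1 Zs Zc; rewrite scalerDr scalerA mulVf // scale1r.
  congr (Z (_ + _)); rewrite scaler_sumr -sumrN; apply: eq_bigr => i _.
  by rewrite scalerA scaleNr opprK.
move: Zc; rewrite c0 scale0r add0r => /hi hi' i.
by case: (unliftP ord0 i) => [i' ->|->].
Qed.
End Span.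

Lemma lspan_mulr (R : algType rat) (S S' U : set R) : subsp U ->
  (forall a b, S a -> S' b -> U (a * b)) ->
  forall a b, lspan S a -> lspan S' b -> U (a * b).
Proof.
move=> [U0 UL] h a b ha hb; move: a ha; apply: lspan_ind.
  by split; [rewrite mul0r | move=> c v w; rewrite mulrDl -scalerAl; exact: UL].
move=> a Sa; move: b hb; apply: lspan_ind; last by move=> b; exact: h.
by split; [rewrite mulr0 | move=> c v w; rewrite mulrDr -scalerAr; exact: UL].
Qed.

Lemma subsp0 (M : lmodType rat) : subsp [set x : M | x = 0].
Proof. by split=> // c x y /= -> ->; rewrite scaler0 addr0. Qed.
Lemma fin_dim_sub (M : lmodType rat) (S S' : set M) :
  S `<=` S' -> fin_dim S' -> fin_dim S.
Proof. by move=> h [s hs]; exists s => x /h /hs. Qed.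

Section Spaces.
Variable A : gca.
Implicit Types S : set A.

Lemma hpart_subsp P S : subsp (@hpart A P S). Proof. exact: lspan_subsp. Qed.
Lemma hpart_gen (P : pred nat) S k x : P k -> S x -> gr k x -> hpart P S x.
Proof. by move=> pk sx gx; apply: lspan_gen; split=> //; exists k. Qed.
Lemma graded_subsp P S : @graded A P S -> subsp S.
Proof. by move=> ->; exact: lspan_subsp. Qed.
Lemma graded_out (P : pred nat) S : graded P S -> forall x k, S x -> ~~ P k -> hcomp k x = 0.
Proof.
move=> gS x k; rewrite {1}gS => + pk; move: x; apply: lspan_ind.
  split; first exact: hcomp0.
  by move=> c x y hx hy; rewrite hcompD hcompZ hx hy scaler0 addr0.
move=> x [Sx [i pi gi]]; rewrite (hcomp_gr k gi).
by case: eqP pi pk => // -> ->.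
Qed.
Lemma graded_sub (P : pred nat) S x : graded P S -> S x -> forall k, gr k x -> x != 0 -> P k.
Proof.
move=> gS Sx k gx; apply: contraNT => pk.
by rewrite -(hcomp_id gx) (graded_out gS Sx pk).
Qed.
Lemma hpart_even S x : even_part S x -> sg x = x.
Proof.
move: x; apply: lspan_ind.
  by split; [exact: sc0 | move=> c x y hx hy; rewrite scD scZ hx hy].
by move=> x [_ [k ek gk]]; exact: sg_even gk.
Qed.
Lemma hpart_sub P S : subsp S -> @hpart A P S `<=` S.
Proof. by move=> Ss; apply: lspan_ind => // x []. Qed.
End Spaces.

(** A function on the span of independent vectors prescribed on these vectors,
    in the form that [free_ext] asks for. *)
Lemma coord_map (A C : gca) s (u : 'I_s -> A) (k : 'I_s -> nat) (u' : 'I_s -> C) :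
  lin_indep u -> (forall i, gr (k i) (u i)) -> (forall i, gr (k i) (u' i)) ->
  exists g : A -> C, [/\ forall (c : rat) x y, lspan (range u) x -> lspan (range u) y ->
      g (c *: x + y) = c *: g x + g y,
    forall l x, lspan (range u) x -> gr l x -> gr l (g x) & forall i, g (u i) = u' i].
Proof.
move=> ui ug ug'.
have /choice [a ha] : forall v, exists a : 'I_s -> rat,
    lspan (range u) v -> v = \sum_i a i *: u i.
  move=> v; have [/lspan_family [a e]|nv] := pselect (lspan (range u) v); first by exists a.
  by exists (fun=> 0).
have aE v b : lspan (range u) v -> v = \sum_i b i *: u i -> forall i, a v i = b i.
  move=> Vv e i; apply/eqP; rewrite -subr_eq0; apply/eqP; move: i.
  apply: (ui (fun i => a v i - b i)); under eq_bigr do rewrite scalerBl.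
  by rewrite sumrB -e -ha // subrr.
exists (fun v => \sum_i a v i *: u' i); split.
- move=> c x y Vx Vy; have e := aE (c *: x + y) (fun i => c * a x i + a y i).
  have {}e : forall i, a (c *: x + y) i = c * a x i + a y i.
    apply: e; first exact: (lspan_subsp _).2.
    rewrite {1}(ha _ Vx) {1}(ha _ Vy) scaler_sumr -big_split /=.
    by apply: eq_bigr => i _; rewrite scalerDl scalerA.
  rewrite scaler_sumr -big_split /=.
  by apply: eq_bigr => i _; rewrite e scalerDl scalerA.
- move=> l x Vx gx.
  have e : forall i, a x i = if k i == l then a x i else 0.
    apply: aE => //; rewrite -{1}(hcomp_id gx) {1}(ha x Vx) hcomp_sum.
    apply: eq_bigr => i _; rewrite hcompZ (hcomp_gr l (ug i)) eq_sym.
    by case: eqP; rewrite ?scaler0 ?scale0r.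
  apply: gr_bigsum => i _; rewrite e; case: eqP => [<-|_]; first exact: grZ.
  by rewrite scale0r; exact: gr0.
- move=> i; have e : forall l, a (u i) l = (l == i)%:R.
    apply: aE; first by apply: lspan_gen; exists i.
    by rewrite (bigD1 i) //= eqxx scale1r big1 ?addr0 // => l /negbTE ->; rewrite scale0r.
  rewrite (bigD1 i) //= e eqxx scale1r big1 ?addr0 // => l /negbTE li.
  by rewrite e li scale0r.
Qed.

(** * Pure coformal models in coordinates *)

(** A pure coformal Sullivan algebra as a presentation: even closed generators
    x_i, odd generators y_i whose differentials are quadratic forms in the
    x_i, and the universal property of the free algebra on them. The
    coefficients of the forms are normalised ([md_c]) so that every term that
    occurs has the degree of dy_i. *)
Record model (A : cdga) (V : set A) (n m : nat) (kx : 'I_n -> nat)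
    (ky : 'I_m -> nat) (x : 'I_n -> A) (y : 'I_m -> A)
    (c : 'I_m -> 'I_n -> 'I_n -> rat) : Prop := Model {
  md_xgr : forall i, gr (kx i) (x i);
  md_ygr : forall i, gr (ky i) (y i);
  md_kx : forall i, ~~ odd (kx i) /\ (1 < kx i)%N;
  md_ky : forall i, odd (ky i) /\ (1 < ky i)%N;
  md_Vs : subsp V;
  md_xV : forall i, V (x i);
  md_yV : forall i, V (y i);
  md_ev : forall v, even_part V v -> exists a : 'I_n -> rat, v = \sum_i a i *: x i;
  md_od : forall v, odd_part V v -> exists a : 'I_m -> rat, v = \sum_i a i *: y i;
  md_V : forall v, V v -> exists (a : 'I_n -> rat) (b : 'I_m -> rat),
    v = \sum_i a i *: x i + \sum_i b i *: y i;
  md_dx : forall i, diff (x i) = 0;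
  md_dy : forall i, diff (y i) = \sum_p \sum_q c i p q *: (x p * x q);
  md_c : forall i p q, c i p q != 0 -> (kx p + kx q)%N = (ky i).+1;
  md_univ : forall (C : cdga) (cx : 'I_n -> C) (cy : 'I_m -> C),
    (forall i, gr (kx i) (cx i)) -> (forall i, gr (ky i) (cy i)) ->
    exists h : gmor A C, (forall i, h (x i) = cx i) /\ forall i, h (y i) = cy i;
  md_eq : forall (C : cdga) (h h' : gmor A C), (forall i, h (x i) = h' (x i)) ->
    (forall i, h (y i) = h' (y i)) -> forall a, h a = h' a
}.

(** The sign involution separates the two parts. *)
Lemma even_odd_indep (A : gca) n m (x : 'I_n -> A) (y : 'I_m -> A) :
  lin_indep x -> (forall i, sg (x i) = x i) ->
  lin_indep y -> (forall i, sg (y i) = - y i) ->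
  forall (a : 'I_n -> rat) (b : 'I_m -> rat),
  \sum_i a i *: x i + \sum_i b i *: y i = 0 ->
  (forall i, a i = 0) /\ (forall i, b i = 0).
Proof.
move=> xi xs yi ys a b e; have := congr1 (@sc A (-1)) e; rewrite scD sc0 !sc_sum.
under eq_bigr do rewrite scZ xs.
under [X in _ + X]eq_bigr do rewrite scZ ys scalerN.
rewrite sumrN; move: e; set X := \sum_i a i *: x i; set Y := \sum_i b i *: y i => e1 e2.
have X0 : X = 0.
  apply: scale2_inj; rewrite scaler0 scaler_nat mulr2n -[RHS]addr0 -{2}e2 -e1.
  by rewrite addrACA subrr addr0.
by split; [exact: xi X0 | apply: yi; rewrite -[RHS]e1 X0 add0r].
Qed.

Section ModelExists.
Variables (A : cdga) (V : set A) (n : nat) (x : 'I_n -> A).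
Hypotheses (hmodel : sullivan_model V) (hcoformal : coformal V)
  (hpure : pure V) (hell : elliptic V) (hx : hom_basis (even_part V) x).

Let gV2 : graded (leq 2) V. Proof. by case: hmodel. Qed.
Let gV : graded xpredT V. Proof. by case: hmodel => [[[]]]. Qed.
Let Vs : subsp V := graded_subsp gV.

Lemma lin_indep_neq0 (M : lmodType rat) s (v : 'I_s -> M) i : lin_indep v -> v i != 0.
Proof.
move=> vi; apply/eqP => v0; have := vi (fun l => (l == i)%:R).
rewrite (bigD1 i) //= v0 scaler0 add0r big1; last by move=> l /negbTE ->; rewrite scale0r.
by move=> /(_ erefl i); rewrite eqxx => /eqP; rewrite oner_eq0.
Qed.

(** The differential of an odd generator is a polynomial in V^even by purity
    and of length 2 by coformality. Applying the endomorphism that fixes the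
    x_i and kills the odd generators, which fixes polynomials in the x_i,
    removes the odd factors from a quadratic expression. *)
Lemma model_exists : exists m kx ky (y : 'I_m -> A) c, model V kx ky x y c.
Proof.
have [xh xi ex] := hx.
have xV i : V (x i).
  by apply: (hpart_sub (P := fun k => ~~ odd k)) => //; rewrite -/(even_part V) ex;
     apply: lspan_gen; exists i.
have xE i : even_part V (x i) by rewrite ex; apply: lspan_gen; exists i.
have xs i : sg (x i) = x i := hpart_even (xE i).
have x0 i := lin_indep_neq0 i xi.
have /choice [kx xg] := xh.
have hkx i : ~~ odd (kx i) /\ (1 < kx i)%N.
  split; last exact: (graded_sub gV2 (xV i) (xg i) (x0 i)).
  apply/negP => ok; have := xs i; rewrite (sg_odd ok (xg i)) => /eqP.
  rewrite eq_sym -subr_eq0 opprK -mulr2n -scaler_nat scaler_eq0 (negbTE (x0 i)).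
  by rewrite pnatr_eq0.
pose H := [set v : A | V v /\ exists2 k, odd k & gr k v].
have Hfd : fin_dim H by apply: fin_dim_sub hell.1 => v [].
have [m [y [yH yi hy]]] := rel_basis Hfd (subsp0 A).
have {}yi : lin_indep y by move=> c e; exact: yi.
have yV i : V (y i) by case: (yH i).
have /choice [ky yk] : forall i, exists k, odd k /\ gr k (y i).
  by move=> i; have [_ [k ok gk]] := yH i; exists k.
have yg i := (yk i).2.
have hky i : odd (ky i) /\ (1 < ky i)%N.
  split; first by case: (yk i).
  exact: (graded_sub gV2 (yV i) (yg i) (lin_indep_neq0 i yi)).
have ys i : sg (y i) = - y i := sg_odd (hky i).1 (yg i).
have hev v : even_part V v -> exists a : 'I_n -> rat, v = \sum_i a i *: x i.
  by rewrite ex; exact: lspan_family.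
have hod v : odd_part V v -> exists a : 'I_m -> rat, v = \sum_i a i *: y i.
  move=> /hy [a /eqP]; rewrite subr_eq0 => /eqP ->; by exists a.
have hV v : V v -> exists (a : 'I_n -> rat) (b : 'I_m -> rat),
    v = \sum_i a i *: x i + \sum_i b i *: y i.
  rewrite {1}gV; move: v; apply: lspan_ind.
    split.
      exists (fun=> 0), (fun=> 0); rewrite !big1 ?addr0 // => i _; exact: scale0r.
    move=> c v w [a [b ->]] [a' [b' ->]].
    exists (fun i => c * a i + a' i), (fun i => c * b i + b' i).
    rewrite scalerDr !scaler_sumr addrACA -!big_split /=.
    by congr (_ + _); apply: eq_bigr => i _; rewrite scalerDl scalerA.
  move=> v [Vv [k _ gk]]; have [ok|ek] := boolP (odd k).
    have [a ->] := hod v (hpart_gen (P := odd) ok Vv gk).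
    by exists (fun=> 0), a; rewrite [X in X + _]big1 ?add0r // => i _; exact: scale0r.
  have [a ->] := hev v (hpart_gen (P := fun k => ~~ odd k) ek Vv gk).
  by exists a, (fun=> 0); rewrite [X in _ + X]big1 ?addr0 // => i _; exact: scale0r.
pose bas (i : 'I_(n + m)) := match split i with inl p => x p | inr q => y q end.
pose kb (i : 'I_(n + m)) := match split i with inl p => kx p | inr q => ky q end.
have basg i : gr (kb i) (bas i) by rewrite /kb /bas; case: split.
have sumb (M : lmodType rat) (f : 'I_n -> M) (g : 'I_m -> M) (d : 'I_(n + m) -> rat) :
    \sum_i d i *: match split i with inl p => f p | inr q => g q end =
    \sum_p d (lshift m p) *: f p + \sum_q d (rshift n q) *: g q.
  rewrite big_split_ord; congr (_ + _); apply: eq_bigr => i _.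
    by rewrite (unsplitK (inl i)).
  by rewrite (unsplitK (inr i)).
have basi : lin_indep bas.
  move=> d; rewrite /bas sumb => /(even_odd_indep xi xs yi ys) [d1 d2] i.
  by rewrite -(splitK i); case: split.
have VE : V = lspan (range bas).
  apply/seteqP; split=> v.
    move=> /hV [a [a' ->]]; apply: subspD; [exact: lspan_subsp| |];
      apply: subsp_sum => [|i _]; try exact: lspan_subsp;
      apply: subspZ; try exact: lspan_subsp; apply: lspan_gen.
      by exists (lshift m i) => //; rewrite /bas (unsplitK (inl i)).
    by exists (rshift n i) => //; rewrite /bas (unsplitK (inr i)).
  by apply: lspan_ind => // _ [i _ <-]; rewrite /bas; case: split.
have fr : free_ext (unit_mor A) V by case: hmodel => [[]].
have univ (C : cdga) (cx : 'I_n -> C) (cy : 'I_m -> C) :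
    (forall i, gr (kx i) (cx i)) -> (forall i, gr (ky i) (cy i)) ->
    exists h : gmor A C, (forall i, h (x i) = cx i) /\ forall i, h (y i) = cy i.
  move=> cxg cyg.
  pose cb (i : 'I_(n + m)) := match split i with inl p => cx p | inr q => cy q end.
  have cbg i : gr (kb i) (cb i) by rewrite /kb /cb; case: split.
  have [g [gL gg gb]] := coord_map basi basg cbg; rewrite -VE in gL gg.
  have [h [_ hg _]] := fr.2 C (unit_mor C) g gL gg.
  exists h; split=> i; rewrite hg //.
    by have := gb (lshift m i); rewrite /bas /cb (unsplitK (inl i)).
  by have := gb (rshift n i); rewrite /bas /cb (unsplitK (inr i)).
have meq (C : cdga) (h h' : gmor A C) : (forall i, h (x i) = h' (x i)) ->
    (forall i, h (y i) = h' (y i)) -> forall a, h a = h' a.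
  move=> e1 e2.
  have unitE (f : gmor A C) a : f (unit_mor A a) = unit_mor C a by rewrite /= gmZ gm1.
  have eV v : V v -> h v = h' v.
    move=> /hV [a [b ->]]; rewrite !gmD !gm_sum.
    by congr (_ + _); apply: eq_bigr => i _; rewrite !gmZ ?e1 ?e2.
  have [|k v _ gv|h0 [_ _ h0u] a] := fr.2 C (unit_mor C) h.
  - by move=> c v w _ _; rewrite gmD gmZ.
  - exact: gmor_gr.
  by rewrite (h0u h) // (h0u h') // => v /eV ->.
have dx i : diff (x i) = 0 by apply: hpure.1.
have [h [hx1 hy1]] := univ A x (fun=> 0) xg (fun i => gr0 A (ky i)).
have hE v : even_part V v -> h v = v.
  move=> /hev [a ->]; rewrite gm_sum; apply: eq_bigr => i _; by rewrite gmZ hx1.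
have hP v : wpow_if xpredT (even_part V) v -> h v = v.
  move: v; apply: lspan_ind.
    by split; [exact: gm0 | move=> c v w; rewrite gmD gmZ => -> ->].
  move=> v [p _]; move: v; apply: lspan_ind.
    by split; [exact: gm0 | move=> c v w; rewrite gmD gmZ => -> ->].
  move=> _ [w [wV ->]]; rewrite rmorph_prod.
  by apply: eq_bigr => i _; exact: hE.
have yO i : odd_part V (y i).
  by apply: (hpart_gen (P := odd) (hky i).1 (yV i) (yg i)).
have /choice [c hc] : forall i, exists c : 'I_n -> 'I_n -> rat,
    diff (y i) = \sum_p \sum_q c p q *: (x p * x q).
  move=> i; rewrite -(hP _ (hpure.2 _ (yO i))).
  have := hcoformal (yV i); move: (diff (y i)); apply: lspan_ind.
    split.
      exists (fun _ _ => 0); rewrite gm0 big1 // => p _.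
      by rewrite big1 // => q _; rewrite scale0r.
    move=> a v w [b hv] [d hw]; exists (fun p q => a * b p q + d p q).
    rewrite gmD gmZ hv hw scaler_sumr -big_split; apply: eq_bigr => p _.
    rewrite scaler_sumr -big_split; apply: eq_bigr => q _ /=.
    by rewrite scalerA scalerDl.
  move=> _ [v [vV ->]]; rewrite big_ord_recl big_ord1 gmM.
  have hx2 w : V w -> exists a : 'I_n -> rat, h w = \sum_p a p *: x p.
    move=> /hV [a [b ->]]; exists a; rewrite gmD !gm_sum [X in _ + X]big1 ?addr0.
      by apply: eq_bigr => p _; rewrite gmZ hx1.
    by move=> p _; rewrite gmZ hy1 scaler0.
  have [a ->] := hx2 _ (vV ord0); have [b ->] := hx2 _ (vV (lift ord0 ord0)).
  exists (fun p q => a p * b q); rewrite mulr_suml; apply: eq_bigr => p _.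
  rewrite mulr_sumr; apply: eq_bigr => q _.
  by rewrite -scalerAl -scalerAr scalerA.
pose c' i p q := if (kx p + kx q == (ky i).+1)%N then c i p q else 0.
exists m, kx, ky, y, c'; split=> //; last first.
  by move=> i p q; rewrite /c'; case: ifP => [/eqP|]; rewrite ?eqxx.
move=> i; rewrite -(hcomp_id (diff_gr (yg i))) hc hcomp_sum.
apply: eq_bigr => p _; rewrite hcomp_sum; apply: eq_bigr => q _.
rewrite hcompZ (hcomp_gr _ (grM (xg p) (xg q))) /c' eq_sym.
by case: eqP; rewrite ?scaler0 ?scale0r.
Qed.
End ModelExists.

(** * Morphisms out of tensor powers *)

Section MkLin.
Variables (M N : lmodType rat) (f : M -> N).
Hypothesis fL : forall (c : rat) x y, f (c *: x + y) = c *: f x + f y.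
Fact mk_lin_linear : linear f. Proof. by move=> c x y; exact: fL. Qed.
Definition mk_lin : {linear M -> N} :=
  HB.pack_for {linear M -> N} f
    (GRing.isLinear.Build rat M N *:%R f mk_lin_linear).
Lemma mk_linE x : mk_lin x = f x. Proof. by []. Qed.
End MkLin.

Lemma gr_swap (A : gca) d (u x : A) : gr d u -> u * x = sc ((-1) ^+ d) x * u.
Proof.
move=> hu; rewrite -signr_odd; case: (boolP (odd d)) => od.
  by rewrite expr1; exact: odd_mulC od hu.
by rewrite expr0 sc_one; exact: even_mulC od hu.
Qed.

Lemma prod_multilinear_seq (A D : gca) (I : eqType) (f : I -> gmor A D) (s : seq I)
    (k : I) (c : rat) (a b h : I -> A) :
  (forall j, j != k -> h j = a j /\ h j = b j) ->
  h k = c *: a k + b k -> uniq s -> k \in s ->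
  \prod_(l <- s) f l (h l) =
     c *: \prod_(l <- s) f l (a l) + \prod_(l <- s) f l (b l).
Proof.
move=> hj hk; elim: s => // l s ih /andP[ls us]; rewrite !big_cons inE.
case: eqVneq => [ek|lk] /= ks.
  rewrite -ek; have e (a' : I -> A) : (forall j, j != k -> h j = a' j) ->
      \prod_(j <- s) f j (a' j) = \prod_(j <- s) f j (h j).
    move=> e; apply: eq_big_seq => j js; rewrite e //.
    by apply/eqP => ej; move: ls; rewrite -ek -ej js.
  rewrite (e a) => [|j /hj[]//]; rewrite (e b) => [|j /hj[]//].
  by rewrite hk gmD gmZ mulrDl -scalerAl.
have [e1 e2] := hj l (contra_neq (@esym _ _ _) lk).
by rewrite ih // mulrDr -scalerAr -{1}e1 -e2.
Qed.

Lemma prod_multilinear (A D : gca) r (f : 'I_r -> gmor A D) :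
  multilinear (fun a : 'I_r -> A => \prod_(k < r) f k (a k)).
Proof.
move=> k c a b h hj hk; apply: prod_multilinear_seq hj hk _ _.
  exact: index_enum_uniq.
exact: mem_index_enum.
Qed.

(** Moving a homogeneous a to its place in a product of tensor factors only
    changes signs, and the signs depend on the degrees alone: the resulting
    factors b' serve for every target D at once. *)
Lemma insert_factor (A : gca) (I : eqType) (s : seq I) (k : I) d (a : A) (b : I -> A) :
  uniq s -> k \in s -> gr d a -> exists b' : I -> A,
  forall (D : gca) (f : I -> gmor A D),
    f k a * \prod_(l <- s) f l (b l) = \prod_(l <- s) f l (b' l).
Proof.
move=> + + da; elim: s => // l s ih /andP[ls us]; rewrite inE.
have upd (v : A) (b' : I -> A) (D : gca) (f : I -> gmor A D) :
    \prod_(j <- s) f j (if j == l then v else b' j) = \prod_(j <- s) f j (b' j).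
  by apply: eq_big_seq => j js; case: eqP ls => // <-; rewrite js.
case: eqVneq => [->|lk] /= ks.
  exists (fun j => if j == l then a * b l else b j) => D f.
  by rewrite !big_cons upd eqxx gmM mulrA.
have [b' hb] := ih us ks.
exists (fun j => if j == l then sc ((-1) ^+ d) (b l) else b' j) => D f.
rewrite !big_cons upd eqxx mulrA (gr_swap _ (gmor_gr _ da)) -gmor_sc -mulrA.
by rewrite hb.
Qed.

Section TensorMap.
Variables (r : nat) (A T : cdga) (iota : 'I_r -> dmor A T).
Hypothesis HT : tensor_power iota.

Lemma tensor_ext (N : lmodType rat) (L L' : {linear T -> N}) :
  (forall a : 'I_r -> A, L (\prod_k iota k (a k)) = L' (\prod_k iota k (a k))) ->
  forall t, L t = L' t.
Proof.
move=> e t.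
have ml : multilinear (fun a => L (\prod_k iota k (a k))).
  move=> k c a b h hj hk.
  by rewrite (@prod_multilinear A T r (fun l => iota l) _ _ _ _ _ hj hk) linearP.
have [h [_ hu]] := HT ml.
by rewrite (hu L) // (hu L').
Qed.

(** The tensor power is only known to represent multilinear maps. Every other
    property of the linear map obtained from the f_k (multiplicative, graded,
    commuting with d) is an equality of two linear maps, which [tensor_ext]
    reduces to pure tensors; degrees are tested with [sc 2]. *)
Lemma tensor_map (D : cdga) (f : 'I_r -> dmor A D) :
  exists psi : dmor T D, forall k a, psi (iota k a) = f k a.
Proof.
have [h [hp _]] := HT (@prod_multilinear A D r (fun l => f l)).
have hL c x y : h (c *: x + y) = c *: h x + h y by rewrite linearP.
have K k a t : h (iota k a * t) = f k a * h t.
  have L1 c x y : h (iota k a * (c *: x + y)) = c *: h (iota k a * x) + h (iota k a * y).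
    by rewrite mulrDr -scalerAr hL.
  have L2 c x y : f k a * h (c *: x + y) = c *: (f k a * h x) + f k a * h y.
    by rewrite hL mulrDr -scalerAr.
  apply: (tensor_ext (L := mk_lin L1) (L' := mk_lin L2)) => {t} b.
  rewrite !mk_linE hp; move: a {L1 L2}; apply: (@gr_ind A).
  - by rewrite !gm0 !mul0r linear0.
  - by move=> a a' ha ha'; rewrite !gmD !mulrDl linearD ha ha'.
  - move=> d a da; have [b' hb'] := insert_factor b (index_enum_uniq _) (mem_index_enum k) da.
    by rewrite (hb' T (fun l => iota l)) (hb' D (fun l => f l)) hp.
have K2 (s : seq 'I_r) a t :
    h ((\prod_(l <- s) iota l (a l)) * t) = (\prod_(l <- s) f l (a l)) * h t.
  elim: s t => [|l s ih] t; first by rewrite !big_nil !mul1r.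
  by rewrite !big_cons -!mulrA K ih.
have hM x t : h (x * t) = h x * h t.
  have L1 c y z : h ((c *: y + z) * t) = c *: h (y * t) + h (z * t).
    by rewrite mulrDl -scalerAl hL.
  have L2 c y z : h (c *: y + z) * h t = c *: (h y * h t) + h z * h t.
    by rewrite hL mulrDl -scalerAl.
  apply: (tensor_ext (L := mk_lin L1) (L' := mk_lin L2)) => a.
  by rewrite !mk_linE K2 hp.
have h1 : h 1 = 1.
  have := hp (fun=> 1); rewrite !big1 // => k _; exact: gm1.
have hsc t : h (sc 2 t) = sc 2 (h t).
  have L1 c y z : h (sc 2 (c *: y + z)) = c *: h (sc 2 y) + h (sc 2 z).
    by rewrite scD scZ hL.
  have L2 c y z : sc 2 (h (c *: y + z)) = c *: sc 2 (h y) + sc 2 (h z).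
    by rewrite hL scD scZ.
  apply: (tensor_ext (L := mk_lin L1) (L' := mk_lin L2)) => a.
  rewrite !mk_linE hp.
  have scp (D' : cdga) (g : 'I_r -> dmor A D') :
      sc 2 (\prod_k g k (a k)) = \prod_k g k (sc 2 (a k)).
    rewrite -[LHS]/(scm D' 2 _) rmorph_prod; apply: eq_bigr => k _.
    by rewrite gmor_sc.
  by rewrite !scp hp.
have hg k t : gr k t -> gr k (h t).
  by move=> gt; apply: gr_sc2; rewrite -hsc (sc_gr _ gt) linearZ.
pose hm := mk_mor hL h1 hM hg.
have hi k a : hm (iota k a) = f k a.
  by rewrite -[iota k a]mulr1 mk_morE K h1 mulr1.
have [PD PM P0 P1 PZ] := dcomm_ind hm.
have hd t : hm (diff t) = diff (hm t).
  have L1 c y z : hm (diff (c *: y + z)) = c *: hm (diff y) + hm (diff z).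
    by rewrite diffL gmD gmZ.
  have L2 c y z : diff (hm (c *: y + z)) = c *: diff (hm y) + diff (hm z).
    by rewrite gmD gmZ diffL.
  apply: (tensor_ext (L := mk_lin L1) (L' := mk_lin L2)) => a.
  rewrite !mk_linE; apply: (big_ind (fun t => hm (diff t) = diff (hm t))) => // k _.
  by rewrite -dmor_diff !hi dmor_diff.
by exists (mk_dmor hd).
Qed.
End TensorMap.

(** * Free extensions *)

Lemma graded_range (A : gca) (P : pred nat) s (u : 'I_s -> A) (k : 'I_s -> nat) :
  (forall i, gr (k i) (u i)) -> (forall i, P (k i)) -> graded P (lspan (range u)).
Proof.
move=> ug Pk; apply/seteqP; split; last first.
  by apply: hpart_sub; exact: lspan_subsp.
apply: lspan_mono => _ [i _ <-]; split; last by exists (k i).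
by apply: lspan_gen; exists i.
Qed.

Lemma ot_free (R M : cdga) (j : dmor R M) s k z (u : 'I_s -> M) :
  odd_tower j k z u -> free_ext j (lspan (range u)) /\ lin_indep u.
Proof.
move=> T; split; last first.
  move=> c e; have := ot_indep T (a := 0) (c := c).
  by rewrite gm0 add0r => /(_ e) [].
split; first by apply: (graded_range (ot_gr T)).
move=> C f g gL gg.
have uW i : lspan (range u) (u i) by apply: lspan_gen; exists i.
have [|h [h1 h2]] := ot_univ T f (c := fun i => g (u i)).
  by move=> i; apply: gg => //; exact: ot_gr T i.
have g0 : g 0 = 0.
  have := gL (-1) 0 0; rewrite scaler0 addr0 scaleN1r addNr => -> //.
    by case: (lspan_subsp (range u)).
  by case: (lspan_subsp (range u)).
exists h; split=> // [w|h' h1' h2' e].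
  have [W0 WL] := lspan_subsp (range u).
  suff : [set w | lspan (range u) w /\ h w = g w] `<=` [set w | h w = g w].
    move=> _ hw; have : [set w | lspan (range u) w /\ h w = g w] w; last by case.
    move: w hw; apply: lspan_ind; last by move=> _ [i _ <-]; rewrite /= h2.
    split; first by rewrite /= gm0 g0.
    move=> c x y [Wx hx] [Wy hy] /=; split; first exact: WL.
    by rewrite gmD gmZ hx hy gL.
  by move=> x [].
apply: (ot_eq T) => [a|i]; first by rewrite h1 h1'.
by rewrite h2 h2'.
Qed.

(** Both algebras are freely generated over A by elements u_i with the same
    differentials; the comparison maps are inverse to each other by
    uniqueness. *)
Lemma square_ext_iso (A : cdga) n (x : 'I_n -> A) (k : 'I_n -> nat) (E : cdga)
    (iota : dmor A E) (u : 'I_n -> E) (E' : cdga) (j : dmor A E') (u' : 'I_n -> E') :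
  (forall i, gr (k i) (x i)) ->
  square_ext x iota u ->
  odd_tower j (fun i => (2 * k i).-1) (fun i => x i ^+ 2) u' ->
  exists (F : dmor E E') (F' : dmor E' E), [/\ forall a, F (iota a) = j a,
    forall i, F (u i) = u' i & forall e, F' (F e) = e].
Proof.
move=> xg [fr ui ug du] T.
have ugr i : gr (2 * k i).-1 (u i) by apply: ug.
have [F' [F'1 F'2]] := ot_map T (f := iota) ugr (fun i => etrans (du i) (esym (gmX _ _ _))).
have [g [gL gg gu]] := coord_map ui ugr (ot_gr T).
have [F [F1 F2 _]] := fr.2 E' j g gL gg.
have uW i : lspan (range u) (u i) by apply: lspan_gen; exists i.
have Fu i : F (u i) = u' i by rewrite F2.
have FF' : forall e, F (F' e) = e.
  apply: (ot_eq T (h := gcomp F F') (h' := gid _)) => [a|i]; rewrite !gcompE.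
    by rewrite F'1 F1.
  by rewrite F'2 Fu.
have F'F : forall e, F' (F e) = e.
  have [h0 [_ _ h0u]] := fr.2 E iota id (fun _ _ _ _ _ => erefl) (fun _ _ _ h => h).
  move=> e; transitivity (h0 e); last by apply/esym/(h0u (gid _)).
  apply: (h0u (gcomp F' F)) => [a|w]; first by rewrite gcompE F1 F'1.
  move=> /lspan_family [a ->]; rewrite gm_sum; apply: eq_bigr => i _.
  by rewrite gmZ gcompE Fu F'2.
have Fd e : F (diff e) = diff (F e) by rewrite -{1}(F'F e) -dmor_diff FF'.
by exists (mk_dmor Fd), F'; split.
Qed.

Lemma gm_prod (A B : gca) (h : gmor A B) I (s : seq I) (P : pred I) (F : I -> A) :
  h (\prod_(i <- s | P i) F i) = \prod_(i <- s | P i) h (F i).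
Proof. exact: rmorph_prod. Qed.

(** * Maps out of a model *)

Section ModelTheory.
Variables (A : cdga) (V : set A) (n m : nat) (kx : 'I_n -> nat)
    (ky : 'I_m -> nat) (x : 'I_n -> A) (y : 'I_m -> A)
    (c : 'I_m -> 'I_n -> 'I_n -> rat).
Hypothesis H : model V kx ky x y c.

(** Uniqueness in the universal property implies generation: the identity of A
    factors through the explicit tower on generators of the same degrees,
    where generation holds by construction. The even generators of that tower
    come with elements u_i bounding their squares, which are sent to 0. *)
Lemma md_ind (P : A -> Prop) : (forall s : rat, P (s *: 1)) ->
  (forall i, P (x i)) -> (forall i, P (y i)) ->
  (forall a b, P a -> P b -> P (a + b)) ->
  (forall a b, P a -> P b -> P (a * b)) -> forall a, P a.
Proof.
move=> P1 Px Py PD PM a.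
have [||C1 [j1 [x1 [u1 T1]]]] := @square_tower_exists cdgaQ n kx.
- by move=> i; case: (md_kx H i).
- by move=> i; case: (md_kx H i) => _ /ltnW.
have [|||C2 [j2 [y2 T2]]] := @odd_tower_exists C1 m ky (fun=> 0).
- by move=> i; case: (md_ky H i).
- by move=> i; exact: gr0.
- by move=> i; exact: diff0.
have [ev1 [e1 e2 e3]] := st_univ T1 (unit_mor A) (md_xgr H) (fun i => gr0 A _).
have [ev2 [f1 f2]] := ot_univ T2 ev1 (md_ygr H).
have [h [h1 h2]] := md_univ H (fun i => gmor_gr j2 (st_xgr T1 i)) (ot_gr T2).
have -> : a = ev2 (h a).
  apply: (md_eq H (h := gid A) (h' := gcomp ev2 h)) => i.
    by rewrite gcompE h1 f1 e2.
  by rewrite gcompE h2 f2.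
move: {a} (h a); apply: (ot_ind T2 (P := fun a => P (ev2 a))) => [a|i|a b|a b].
- rewrite f1; move: a; apply: (st_ind T1 (P := fun a => P (ev1 a))) => [a|i|i|a b|a b].
  + by rewrite e1; exact: P1.
  + by rewrite e2.
  + by rewrite e3 -(scale0r 1).
  + by rewrite gmD; exact: PD.
  + by rewrite gmM; exact: PM.
- by rewrite f2.
- by rewrite gmD; exact: PD.
- by rewrite gmM; exact: PM.
Qed.

Lemma md_map (C : cdga) (cx : 'I_n -> C) (cy : 'I_m -> C) :
  (forall i, gr (kx i) (cx i)) -> (forall i, gr (ky i) (cy i)) ->
  (forall i, diff (cx i) = 0) ->
  (forall i, diff (cy i) = \sum_p \sum_q c i p q *: (cx p * cx q)) ->
  exists h : dmor A C, (forall i, h (x i) = cx i) /\ forall i, h (y i) = cy i.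
Proof.
move=> gx gy dx dy; have [h [h1 h2]] := md_univ H gx gy.
have [PD PM P0 P1 PZ] := dcomm_ind h.
have hd a : h (diff a) = diff (h a).
  move: a; apply: md_ind => // [s|i|i]; first exact: PZ.
    by rewrite (md_dx H) gm0 h1 dx.
  rewrite (md_dy H) h2 dy gm_sum; apply: eq_bigr => p _.
  by rewrite gm_sum; apply: eq_bigr => q _; rewrite gmZ gmM !h1.
by exists (mk_dmor hd).
Qed.
Lemma md_x2 i : [/\ odd (2 * kx i).-1, gr (2 * kx i).-1.+1 (x i ^+ 2) & diff (x i ^+ 2) = 0].
Proof.
have [_ k1] := md_kx H i.
split.
- by case: (kx i) k1 => // l _; rewrite mul2n doubleS /= odd_double.
- rewrite prednK ?muln_gt0 ?(ltnW k1) // mul2n -addnn expr2.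
  by apply: grM; exact: md_xgr H i.
- by rewrite expr2 diffMs (md_dx H) mul0r mulr0 addr0.
Qed.

Lemma md_squares : exists (E : cdga) (j : dmor A E) (u : 'I_n -> E),
  odd_tower j (fun p => (2 * kx p).-1) (fun p => x p ^+ 2) u.
Proof. by apply: odd_tower_exists => p; case: (md_x2 p). Qed.
End ModelTheory.

(** * Powers of an ideal in an extension *)

Section IdealPower.
Variables (T A M : cdga) (mu : dmor T A) (j : dmor T M).

(** The q-th power of the ideal of M generated by ker mu; the factors are
    taken homogeneous, so that they commute up to sign. *)
Definition ipow (q : nat) : set M :=
  lspan [set z | exists (s : M) (t : 'I_q -> T),
    (forall l, mu (t l) = 0 /\ exists d, gr d (t l)) /\
    z = s * j (\prod_l t l)].

Lemma ipow_subsp q : subsp (ipow q). Proof. exact: lspan_subsp. Qed.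

Lemma ipow0 z : ipow 0 z.
Proof.
by apply: lspan_gen; exists z, (fun=> 0); split=> [[]//|]; rewrite big_ord0 gm1 mulr1.
Qed.

Lemma ipow1_gen d s t : mu t = 0 -> gr d t -> ipow 1 (s * j t).
Proof.
move=> mt dt; apply: lspan_gen; exists s, (fun=> t); rewrite big_ord1; split=> // l.
by split=> //; exists d.
Qed.

Lemma ipow1_mulr z s : ipow 1 z -> ipow 1 (z * s).
Proof.
move: z; apply: lspan_ind.
  split; first by rewrite mul0r; case: (ipow_subsp 1).
  by move=> a z w hz hw; rewrite mulrDl -scalerAl; exact: (ipow_subsp 1).2.
move=> _ [s' [t [ht ->]]]; rewrite big_ord1; have [mt [d dt]] := ht ord0.
by rewrite -mulrA (gr_swap _ (gmor_gr j dt)) mulrA; exact: ipow1_gen dt.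
Qed.

(** The generators of an ideal power are homogeneous so that they can be moved
    past coefficients at the cost of a sign involution. *)
Lemma ipow_mul1 q z w : ipow q z -> ipow 1 w -> ipow q.+1 (z * w).
Proof.
apply: lspan_mulr => [|_ _ [s [t [ht ->]]] [s' [t' [ht' ->]]]]; first exact: ipow_subsp.
rewrite big_ord1; move: (t' ord0) (ht' ord0) => {}t' [mt' [d' dt']] {ht'}.
have [d dt] : exists d, gr d (\prod_l t l).
  have hh : forall k : nat, forall t : 'I_k -> T, (forall l, exists d, gr d (t l)) ->
      exists d, gr d (\prod_l t l).
    elim=> [|k ih] t0 ht0; first by exists 0%N; rewrite big_ord0; exact: gr1.
    have [d1 h1] := ht0 ord0; have [d2 h2] := ih (fun l => t0 (lift ord0 l)) (fun l => ht0 _).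
    by exists (d1 + d2)%N; rewrite big_ord_recl; exact: grM.
  by apply: hh => l; case: (ht l).
rewrite -mulrA (mulrA (j _)) (gr_swap _ (gmor_gr j dt)) -mulrA -gmM mulrA.
apply: lspan_gen; eexists; exists (fun i => if unlift ord_max i is Some i' then t i' else t').
split; last first.
  rewrite big_ord_recr /=; congr (_ * j (_ * _)); last by rewrite unlift_none.
  apply: eq_bigr => l _.
  have -> : widen_ord (leqnSn q) l = lift ord_max l.
    by apply: val_inj; rewrite /= /bump leqNgt ltn_ord.
  by rewrite liftK.
move=> l; case: (unliftP ord_max l) => [i' _|_]; first exact: ht.
by split=> //; exists d'.
Qed.

Lemma ipow_le q q' : (q <= q')%N -> ipow q' `<=` ipow q.
Proof.
move=> qq; rewrite -(subnK qq); elim: (q' - q)%N => [//|k ih] z hz; apply: ih.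
move: z hz; rewrite addSn; apply: lspan_ind; first exact: ipow_subsp.
move=> _ [s [t [ht ->]]]; rewrite big_ord_recl gmM mulrA; apply: lspan_gen.
by exists (s * j (t ord0)), (fun l => t (lift ord0 l)).
Qed.

Lemma ipow_prod s (z : 'I_s -> M) q w :
  ipow q w -> (forall i, ipow 1 (z i)) -> ipow (q + s) (w * \prod_i z i).
Proof.
move=> hw; elim: s z => [|s ih] z hz; first by rewrite big_ord0 mulr1 addn0.
rewrite big_ord_recr addnS mulrA; apply: ipow_mul1 => //.
by apply: ih.
Qed.

Lemma ipow_vanish (B BM : cdga) (rho : dmor T B) (jB : dmor B BM) (rhoM : dmor M BM) q z :
  (forall t, rho t = 0 <-> wpow [set t | mu t = 0] q t) ->
  (forall a, rhoM (j a) = jB (rho a)) -> ipow q z -> rhoM z = 0.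
Proof.
move=> kr e; move: z; apply: lspan_ind.
  by split; [exact: gm0 | move=> a z w /=; rewrite gmD gmZ => -> ->; rewrite scaler0 addr0].
move=> _ [s [t [ht ->]]]; rewrite /= gmM e (_ : rho _ = 0) ?gm0 ?mulr0 //.
apply/kr/lspan_gen; exists t; split=> // l; by case: (ht l).
Qed.
End IdealPower.

Lemma prod_cocycle (R : cdga) s (z : 'I_s -> R) :
  (forall i, diff (z i) = 0) -> diff (\prod_i z i) = 0.
Proof.
move=> h; apply: (big_ind (fun a => diff a = 0)) => //; first exact: diff1.
by move=> a b ha hb; rewrite diffMs ha hb mul0r mulr0 addr0.
Qed.

(** * The lower bound for topological complexity *)

(** The generators needed below are indexed by pairs. *)
Lemma odd_tower_fin (R : cdga) (I : finType) (k : I -> nat) (z : I -> R) :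
  (forall i, odd (k i)) -> (forall i, gr (k i).+1 (z i)) ->
  (forall i, diff (z i) = 0) ->
  exists (M : cdga) (j : dmor R M) (u : I -> M),
    odd_tower j (fun t : 'I_#|I| => k (enum_val t)) (fun t => z (enum_val t))
      (fun t => u (enum_val t)).
Proof.
move=> ok zg zc.
have [|||M [j [u T]]] := @odd_tower_exists R #|I| (fun t => k (enum_val t))
  (fun t => z (enum_val t)); [by move=> i..|].
exists M, j, (fun i => u (enum_rank i)).
by under [X in odd_tower _ _ _ X]eq_fun do rewrite enum_valK.
Qed.

Lemma half_add (M : lmodType rat) (a : M) : 2^-1 *: a + 2^-1 *: a = a.
Proof. by rewrite -scalerDl -[RHS]scale1r; congr (_ *: _); lra. Qed.

(** A product s s' - t t' written with the sums s + t and s' + t': the first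
    identity corrects y^(0) - y^(k), the second one defines the image of y
    under x |-> (x^(0) - x^(1)) / 2. *)
Lemma prod_split1 (R : algType rat) (s t s' t' : R) :
  2^-1 *: ((s + t) * (s' - t')) + 2^-1 *: ((s - t) * (s' + t')) = s * s' - t * t'.
Proof.
have e : (s + t) * (s' - t') + (s - t) * (s' + t') = (s * s' - t * t') + (s * s' - t * t').
  rewrite mulrDl mulrBl !mulrDr !mulrN opprD.
  move: (s * s') (s * t') (t * s') (t * t') => p q u w.
  by rewrite addrACA [p - q + _]addrACA addNr addr0 [u - w + _]addrACA subrr add0r addrACA.
by rewrite -scalerDr e scalerDr half_add.
Qed.

Lemma prod_split2 (R : algType rat) (s t s' t' : R) :
  2^-1 *: ((s + t) * s') + 2^-1 *: (2^-1 *: (s - t) * (s' + t')) =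
  s * s' - (2^-1 *: (s - t)) * (2^-1 *: (s' - t')).
Proof.
have h (a b : R) : 2^-1 *: (a + b) = a - 2^-1 *: (a - b).
  by rewrite -{2}(half_add a) scalerBr opprB scalerDr addrA addrAC addrK addrC.
have -> : 2^-1 *: ((s + t) * s') = (s - 2^-1 *: (s - t)) * s' by rewrite scalerAl (h s t).
rewrite [X in _ + X]scalerAr (h s' t').
by rewrite mulrBr mulrBl addrA subrK.
Qed.

Section LowerBound.
Variables (r1 : nat) (A : cdga) (V : set A) (n m : nat) (kx : 'I_n -> nat)
    (ky : 'I_m -> nat) (x : 'I_n -> A) (y : 'I_m -> A)
    (c : 'I_m -> 'I_n -> 'I_n -> rat).
Hypothesis H : model V kx ky x y c.

(** With r = r1 + 2. Were N smaller, a retraction would make a certain cocycle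
    in the ideal power of order (r - 1) m + i of an odd extension M of the
    tensor power a boundary, while a morphism out of M shows that it is not
    one. *)
Lemma TC_lower i N : has_odd_product V x i -> TC_le r1.+2 A N ->
  (r1.+1 * m + i <= N)%N.
Proof.
move=> [E [iotaE [uE [z [Hsq zodd znb]]]]] [T [iota [mu [HT muE [B [rho [rsurj rker hret]]]]]]].
rewrite leqNgt; apply/negP => ltN.
have retT : retractable rho.
  by case: hret => E0 [io [W [ph [ta [_ qi e1 e2]]]]]; exists E0, io, ph, ta.
(* Products can be computed in the explicit tower E', isomorphic to E. *)
have [E' [jE [u' TE]]] := md_squares H.
have [F [F' [F1 F2 F'F]]] := square_ext_iso (md_xgr H) Hsq TE.
have zc l : diff (F (z l)) = 0 by rewrite -dmor_diff (zodd l).1 gm0.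
have znb' d : diff d <> \prod_l F (z l).
  move=> hd; apply: znb; exists (F' d) => //.
  by rewrite -dmor_diff hd gm_prod; apply: eq_bigr => l _; rewrite F'F.
(* Adjoining w and u makes x_p^(0) + x_p^(k) and the squares of
   h_p = (x_p^(0) - x_p^(1)) / 2 bound. *)
pose X0 p := iota ord0 (x p); pose X1 (k : 'I_r1.+1) p := iota (lift ord0 k) (x p).
have X0g p : gr (kx p) (X0 p) by apply: gmor_gr; exact: md_xgr H p.
have X1g k p : gr (kx p) (X1 k p) by apply: gmor_gr; exact: md_xgr H p.
have dX0 p : diff (X0 p) = 0 by rewrite -dmor_diff (md_dx H) gm0.
have dX1 k p : diff (X1 k p) = 0 by rewrite -dmor_diff (md_dx H) gm0.
have kx1 p : (kx p).-1.+1 = kx p by case: (md_kx H p) => _; case: (kx p).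
have okx p : odd (kx p).-1.
  by case: (md_kx H p) => + _; rewrite -[in ~~ _](kx1 p) /= negbK.
have [|||M1 [j1 [w1 T1]]] := @odd_tower_fin T ('I_r1.+1 * 'I_n)%type
  (fun e => (kx e.2).-1) (fun e => X0 e.2 + X1 e.1 e.2).
- by move=> e; exact: okx.
- by move=> e; rewrite kx1; exact: grD.
- by move=> e; rewrite diffD dX0 dX1 addr0.
pose hb p := 2^-1 *: (X0 p - X1 ord0 p).
have hbg p : gr (kx p) (hb p) by apply: grZ; exact: grB.
have dhb p : diff (hb p) = 0 by rewrite diffZ diffB dX0 dX1 subr0 scaler0.
have [|||M [j2 [u2 T2]]] := @odd_tower_exists M1 n (fun p => (2 * kx p).-1)
  (fun p => j1 (hb p ^+ 2)).
- by move=> p; case: (md_x2 H p).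
- move=> p; apply: gmor_gr; case: (md_kx H p) => _ k1.
  rewrite prednK ?muln_gt0 ?(ltnW k1) // mul2n -addnn expr2; exact: grM.
- by move=> p; rewrite -dmor_diff expr2 diffMs dhb mul0r mulr0 addr0 gm0.
have [j jEq] : exists j : dmor T M, forall a, j a = j2 (j1 a).
  by exists (dcomp j2 j1).
pose w k p := j2 (w1 (k, p)).
have wg k p : gr (kx p).-1 (w k p).
  by apply: gmor_gr; have := ot_gr T1 (enum_rank (k, p)); rewrite enum_rankK.
have dw k p : diff (w k p) = j (X0 p + X1 k p).
  by rewrite -dmor_diff jEq; have := ot_d T1 (enum_rank (k, p)); rewrite enum_rankK => ->.
have [BM1 [rhoM1 [jB1 [ret1 eB1]]]] := ot_retr T1 retT.
have [BM [rhoM [jB2 [retM eB2]]]] := ot_retr T2 ret1.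
have eB a : rhoM (j a) = dcomp jB2 jB1 (rho a) by rewrite jEq dcompE eB2 eB1.
(* By prod_split2, x_p^(0) x_q^(0) - h_p h_q is a combination of multiples of
   x_p^(0) + x_p^(1) = dw_p and x_q^(0) + x_q^(1) = dw_q. Subtracting the
   corresponding multiples of w from y_l^(0) gives an element yh_l with
   dyh_l = dy_l (h), so that x |-> h, y |-> yh is a morphism. *)
have wodd k p (a : M) : diff a = 0 -> diff (w k p * a) = j (X0 p + X1 k p) * a.
  by move=> da; rewrite diffMs da mulr0 addr0 dw.
have oddw k p d (a : M) : ~~ odd d -> gr d a -> diff a = 0 ->
    diff (a * w k p) = a * j (X0 p + X1 k p).
  by move=> ed ga da; rewrite diffMs da mul0r add0r dw (sg_even ed ga).
have ekx p : ~~ odd (kx p) by case: (md_kx H p).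
have jhb p : j (hb p) = 2^-1 *: (j (X0 p) - j (X1 ord0 p)) by rewrite /hb gmZ gmB.
pose yh l := j (iota ord0 (y l)) - \sum_p \sum_q c l p q *:
   (2^-1 *: (w ord0 p * j (X0 q)) + 2^-1 *: (j (hb p) * w ord0 q)).
have kyc l p q : c l p q != 0 -> ((kx p).-1 + kx q = ky l)%N /\ (kx p + (kx q).-1 = ky l)%N.
  by move=> /(md_c H); have := kx1 p; have := kx1 q; lia.
have yhg l : gr (ky l) (yh l).
  apply: grB; first by do 2!apply: gmor_gr; exact: md_ygr H l.
  apply: gr_bigsum => p _; apply: gr_bigsum => q _.
  have [->|/kyc [e1 e2]] := eqVneq (c l p q) 0; first by rewrite scale0r; exact: gr0.
  apply: grZ; apply: grD; apply: grZ.
    by rewrite -e1; apply: grM => //; exact: gmor_gr.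
  by rewrite -e2; apply: grM => //; exact: gmor_gr.
have dyh l : diff (yh l) = \sum_p \sum_q c l p q *: (j (hb p) * j (hb q)).
  rewrite /yh diffB -!dmor_diff (md_dy H) !gm_sum diff_sum -sumrB; apply: eq_bigr => p _.
  rewrite !gm_sum diff_sum -sumrB; apply: eq_bigr => q _.
  rewrite (gmZ (iota ord0)) (gmZ j (c l p q)) diffZ -scalerBr; congr (_ *: _).
  rewrite diffD !diffZ (wodd _ _ (j (X0 q))); last by rewrite -dmor_diff dX0 gm0.
  rewrite (oddw _ _ _ (j (hb p)) (ekx p) (gmor_gr j (hbg p))); last first.
    by rewrite -dmor_diff dhb gm0.
  rewrite (gmM (iota ord0)) (gmM j (iota ord0 (x p))) !jhb !(gmD j).
  by rewrite prod_split2 opprB addrC subrK.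
have djhb p : diff (j (hb p)) = 0 by rewrite -dmor_diff dhb gm0.
have [G0 [G0x G0y]] := md_map H (fun p => gmor_gr j (hbg p)) yhg djhb dyh.
have [|G [G1 G2]] := ot_map TE (f := G0) (ot_gr T2).
  by move=> p; rewrite (ot_d T2) gmX (gmX G0) G0x jEq !gmX.
(* By prod_split1, d(y^(0) - y^(k)) is a combination of terms dw_p b_q and
   b_p dw_q with b = x^(0) - x^(k) in ker mu. *)
pose I := ('I_r1.+1 * 'I_m)%type.
pose b k p := X0 p - X1 k p.
have bg k p : gr (kx p) (b k p) by exact: grB.
have db k p : diff (j (b k p)) = 0 by rewrite -dmor_diff diffB dX0 dX1 subr0 gm0.
have mub k p : mu (b k p) = 0 by rewrite gmB !muE subrr.
pose yb (e : I) := j (iota ord0 (y e.2) - iota (lift ord0 e.1) (y e.2)) -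
  \sum_p \sum_q c e.2 p q *:
   (2^-1 *: (w e.1 p * j (b e.1 q)) + 2^-1 *: (j (b e.1 p) * w e.1 q)).
have dyb e : diff (yb e) = 0.
  rewrite /yb; case: e => k l /=.
  rewrite diffB -!dmor_diff diffB -!dmor_diff (md_dy H) !gm_sum -sumrB gm_sum.
  rewrite diff_sum -sumrB big1 // => p _.
  rewrite !gm_sum diff_sum -sumrB gm_sum -sumrB big1 // => q _.
  rewrite (gmZ (iota ord0)) (gmZ (iota (lift ord0 k))) -scalerBr (gmZ j) diffZ -scalerBr.
  rewrite diffD !diffZ (wodd _ _ (j (b k q))) //.
  rewrite (oddw _ _ _ (j (b k p)) (ekx p) (gmor_gr j (bg k p))) //.
  rewrite (gmM (iota ord0)) (gmM (iota (lift ord0 k))) -!(gmM j) -!(gmZ j) -(gmD j) -(gmB j).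
  by rewrite prod_split1 subrr gm0 scaler0.
have ybI e : ipow mu j 1 (yb e).
  have [I0 IL] := ipow_subsp mu j 1.
  apply: subspB; first exact: ipow_subsp.
    rewrite -[j _]mul1r; apply: (@ipow1_gen _ _ _ mu j (ky e.2)).
      by rewrite gmB !muE subrr.
    by apply: grB; apply: gmor_gr; exact: md_ygr H e.2.
  apply: subsp_sum; first exact: ipow_subsp.
  move=> p _; apply: subsp_sum; first exact: ipow_subsp.
  move=> q _; apply: subspZ; first exact: ipow_subsp.
  apply: subspD; first exact: ipow_subsp.
    apply: subspZ; first exact: ipow_subsp.
    exact: (ipow1_gen _ _ (mub _ _) (bg _ _)).
  apply: subspZ; first exact: ipow_subsp.
  apply: ipow1_mulr; rewrite -[j _]mul1r.
  exact: (ipow1_gen _ _ (mub _ _) (bg _ _)).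
have GzI l : ipow mu j 1 (G (F (z l))).
  have hI a : even_part V a -> ipow mu j 1 (G (F (iotaE a))).
    move=> /(md_ev H) [al ->]; rewrite F1 G1 gm_sum.
    apply: subsp_sum; first exact: ipow_subsp.
    move=> p _; rewrite gmZ G0x; apply: subspZ; first exact: ipow_subsp.
    rewrite -[j _]mul1r; apply: (@ipow1_gen _ _ _ mu j (kx p)) => //.
    by rewrite gmZ mub scaler0.
  have [I0 IL] := ipow_subsp mu j 1.
  have sub (S : set E) : (forall v, S v -> ipow mu j 1 (G (F v))) ->
      forall v, lspan S v -> ipow mu j 1 (G (F v)).
    move=> hS; apply: lspan_ind => //; split; first by rewrite !gm0.
    by move=> a v v' hv hv'; rewrite !gmD !gmZ; exact: IL.
  case: (zodd l) => _; apply: (sub) => v [p [q [op]]]; apply: (sub) => {}v.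
  move=> [a [a' [wa _ ->]]]; rewrite !gmM; apply: ipow1_mulr.
  move: a wa; apply: (sub) => _ [v' [hv' ->]].
  case: p op v' hv' => // p _ v' hv'; rewrite big_ord_recl !gmM; apply: ipow1_mulr.
  by have [a0 ha0 <-] := hv' ord0; exact: hI.
pose cc := (\prod_l G (F (z l))) * \prod_(t < #|{: I}|) yb (enum_val t).
have cI : ipow mu j N.+1 cc.
  apply: (@ipow_le _ _ _ mu j N.+1 (i + #|{: I}|)).
    by rewrite card_prod !card_ord addnC.
  have := ipow_prod (ipow0 mu j 1) GzI; rewrite mul1r add0n => hG.
  exact: (ipow_prod hG (fun t => ybI (enum_val t))).
have dcc : diff cc = 0.
  rewrite diffMs !prod_cocycle ?mul0r ?mulr0 ?addr0 // => l.
  by rewrite -dmor_diff zc gm0.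
have [d0 hd0] := retractable_exact retM dcc (ipow_vanish rker eB cI).
(* The sign change x |-> -x preserves the quadratic forms dy_l, so the factors
   k > 0 may be twisted by it, which makes x^(0) + x^(k) vanish and sends h_p
   to x_p; subtracting closed elements from y_l in these factors makes the
   corrected differences of the y_l independent. *)
have [|||D [jD [ev TD]]] := @odd_tower_fin E' I (fun e => ky e.2) (fun=> 0).
- by move=> e; case: (md_ky H e.2).
- by move=> e; exact: gr0.
- by move=> e; exact: diff0.
have evg e : gr (ky e.2) (ev e).
  by have := ot_gr TD (enum_rank e); rewrite enum_rankK.
have dev e : diff (ev e) = 0.
  by have := ot_d TD (enum_rank e); rewrite enum_rankK gm0.
pose inc := dcomp jD jE.
have /choice [tw htw] : forall k : 'I_r1.+1, exists h : dmor A D,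
    (forall p, h (x p) = - inc (x p)) /\ forall l, h (y l) = inc (y l) - ev (k, l).
  move=> k; apply: (md_map H) => [p|l|p|l].
  - by apply: grN; apply: gmor_gr; exact: md_xgr H p.
  - by apply: grB; [apply: gmor_gr; exact: md_ygr H l | exact: evg (k, l)].
  - by rewrite diffN -dmor_diff (md_dx H) gm0 oppr0.
  - rewrite diffB dev subr0 -dmor_diff (md_dy H) gm_sum; apply: eq_bigr => p _.
    rewrite gm_sum; apply: eq_bigr => q _.
    by rewrite gmZ gmM mulrNN.
have [P0 hP0] := tensor_map HT
  (fun k => if unlift ord0 k is Some k' then tw k' else inc).
have P00 a : P0 (iota ord0 a) = inc a by rewrite hP0 unlift_none.
have P0k k a : P0 (iota (lift ord0 k) a) = tw k a by rewrite hP0 liftK.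
have [||P1 [P1j P1w]] := ot_map T1 (f := P0) (c := fun=> 0).
- by move=> t; exact: gr0.
- by move=> t; rewrite diff0 gmD P00 P0k (htw _).1 subrr.
have P1hb p : P1 (j1 (hb p)) = inc (x p).
  by rewrite P1j gmZ gmB P00 P0k (htw _).1 opprK scalerDr half_add.
have [||P [Pj Pu]] := ot_map T2 (f := P1) (c := fun p => jD (u' p)).
- by move=> p; apply: gmor_gr; exact: ot_gr TE p.
- by move=> p; rewrite -dmor_diff (ot_d TE) !gmX P1hb.
have Pw k p : P (w k p) = 0.
  by rewrite Pj; have := P1w (enum_rank (k, p)); rewrite enum_rankK.
have PG0 a : P (G0 a) = inc a.
  apply: (md_eq H (h := gcomp P G0) (h' := inc)) => [p|l]; rewrite gcompE ?G0x ?G0y.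
    by rewrite jEq Pj P1hb.
  rewrite /yh gmB gm_sum big1 ?subr0.
    by rewrite jEq Pj P1j P00.
  move=> p _; rewrite gm_sum big1 // => q _.
  by rewrite gmZ gmD !gmZ !gmM !Pw mul0r mulr0 !scaler0 addr0 scaler0.
have PG e : P (G e) = jD e.
  apply: (ot_eq TE (h := gcomp P G) (h' := jD)) => [a|p]; rewrite gcompE.
    by rewrite G1 PG0.
  by rewrite G2 Pu.
have Pyb e : P (yb e) = ev e.
  rewrite /yb gmB gm_sum big1 ?subr0.
    rewrite jEq Pj P1j gmB P00 P0k (htw _).2 opprB addrC subrK.
    by case: (e).
  move=> p _; rewrite gm_sum big1 // => q _.
  by rewrite gmZ gmD !gmZ !gmM !Pw mul0r mulr0 !scaler0 addr0 scaler0.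
apply: (ot_top TD (fun=> erefl) znb' (y := P d0)).
rewrite -dmor_diff hd0 gmM !gm_prod; congr (_ * _).
  by apply: eq_bigr => l _; rewrite PG.
by apply: eq_bigr => t _; rewrite Pyb.
Qed.
End LowerBound.

(** * Word length *)

(** Eigenspaces for distinct eigenvalues are independent: apply th - 2 ^ N to
    a relation of length N + 1. *)
Lemma eigen_direct (M : lmodType rat) (th : M -> M) N (v : nat -> M) :
  (forall (c : rat) x y, th (c *: x + y) = c *: th x + th y) ->
  (forall l, th (v l) = 2 ^+ l *: v l) -> \sum_(l < N) v l = 0 ->
  forall l, (l < N)%N -> v l = 0.
Proof.
move=> thL; elim: N v => // N ih v hv e.
have th0 : th 0 = 0 by have := thL (-1) 0 0; rewrite scaler0 addr0 scaleN1r addNr.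
have ths k (w : nat -> M) : th (\sum_(l < k) w l) = \sum_(l < k) th (w l).
  elim/big_rec2: _ => [|i a b _ <-]; first exact: th0.
  by have := thL 1 (w i) b; rewrite !scale1r.
have v0 l : (l < N)%N -> v l = 0.
  move=> lN.
  have : (2 ^+ l - 2 ^+ N) *: v l = 0.
    apply: (ih (fun l => (2 ^+ l - 2 ^+ N) *: v l)) lN => [i|].
      have := thL (2 ^+ i - 2 ^+ N) (v i) 0; rewrite th0 !addr0 => ->.
      by rewrite hv !scalerA mulrC.
    under eq_bigr do rewrite scalerBl.
    rewrite sumrB -scaler_sumr.
    have e1 : \sum_(l < N) v l = - v N.
      by apply/eqP; rewrite -addr_eq0; move: e; rewrite big_ord_recr => ->.
    have e2 : \sum_(l < N) 2 ^+ l *: v l = - (2 ^+ N *: v N).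
      apply/eqP; rewrite -addr_eq0.
      have : th (\sum_(l < N.+1) v l) = 0 by rewrite e.
      rewrite ths; under eq_bigr do rewrite hv.
      by rewrite big_ord_recr => ->.
    by rewrite e1 e2 scalerN subrr.
  move=> /eqP; rewrite scaler_eq0 subr_eq0 => /orP[/eqP /(@ieexprIn rat 2 isT isT) el|/eqP //].
  by rewrite el ltnn in lN.
move=> l; rewrite ltnS leq_eqVlt => /orP[/eqP ->|]; last exact: v0.
move: e; rewrite big_ord_recr /= big1 ?add0r // => i _; exact: v0.
Qed.

Section WordLength.
Variables (A : cdga) (V : set A) (n m : nat) (kx : 'I_n -> nat)
    (ky : 'I_m -> nat) (x : 'I_n -> A) (y : 'I_m -> A)
    (c : 'I_m -> 'I_n -> 'I_n -> rat).
Hypothesis H : model V kx ky x y c.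
Variable th : gmor A A.
Hypotheses (thx : forall i, th (x i) = 2 *: x i) (thy : forall i, th (y i) = 2 *: y i).

Lemma thV v : V v -> th v = 2 *: v.
Proof.
move=> /(md_V H) [a [b ->]]; rewrite gmD !gm_sum scalerDr !scaler_sumr.
by congr (_ + _); apply: eq_bigr => i _; rewrite gmZ ?thx ?thy !scalerA mulrC.
Qed.

Lemma wpow_subsp k : subsp (wpow V k). Proof. exact: lspan_subsp. Qed.

Lemma wpow_th k v : wpow V k v -> th v = 2 ^+ k *: v.
Proof.
move: v; apply: lspan_ind.
  split; first by rewrite gm0 scaler0.
  by move=> a v w; rewrite gmD gmZ => -> ->; rewrite scalerDr !scalerA mulrC.
move=> _ [w [hw ->]]; rewrite gm_prod.
under eq_bigr => i _ do rewrite (thV (hw i)).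
by rewrite scaler_prod prodr_const card_ord.
Qed.

Lemma wpow_mul k l v w : wpow V k v -> wpow V l w -> wpow V (k + l) (v * w).
Proof.
apply: lspan_mulr => [|_ _ [{}v [hv ->]] [{}w [hw ->]]]; first exact: wpow_subsp.
apply: lspan_gen.
exists (fun i => match split i with inl i => v i | inr i => w i end); split.
  by move=> i; case: split.
rewrite big_split_ord /=; congr (_ * _); apply: eq_bigr => i _.
  by rewrite (unsplitK (inl i)).
by rewrite (unsplitK (inr i)).
Qed.

Lemma wpow0 s : wpow V 0 (s *: 1).
Proof.
apply: subspZ; first exact: wpow_subsp.
by apply: lspan_gen; exists (fun=> 0); rewrite big_ord0; split=> // -[].
Qed.
Lemma wpow0E v : wpow V 0 v -> exists s, v = s *: 1.
Proof.
move: v; apply: lspan_ind.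
  split; first by exists 0; rewrite scale0r.
  by move=> a v w [s ->] [t ->]; exists (a * s + t); rewrite scalerDl scalerA.
by move=> _ [w [_ ->]]; exists 1; rewrite big_ord0 scale1r.
Qed.
Lemma wpow1 v : V v -> wpow V 1 v.
Proof. by move=> Vv; apply: lspan_gen; exists (fun=> v); rewrite big_ord1. Qed.

(** Generation by V gives a decomposition into word lengths. As for degrees,
    the components are padded by zeros; their uniqueness comes from th, which
    acts on length l by 2 ^ l. *)
Lemma wdec a : { Nf : nat * (nat -> A) | [/\ forall l, wpow V l (Nf.2 l),
  forall l, (Nf.1 <= l)%N -> Nf.2 l = 0 &
  forall M, (Nf.1 <= M)%N -> a = \sum_(l < M) Nf.2 l] }.
Proof.
apply: cid.
have : lspan [set v | exists l, wpow V l v] a.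
  have [S0 SL] := lspan_subsp [set v : A | exists l, wpow V l v].
  move: a; apply: (md_ind H) => [s|i|i|a b ha hb|a b ha hb].
  - by apply: lspan_gen; exists 0%N; exact: wpow0.
  - by apply: lspan_gen; exists 1%N; apply: wpow1; exact: md_xV H i.
  - by apply: lspan_gen; exists 1%N; apply: wpow1; exact: md_yV H i.
  - exact: subspD.
  - apply: lspan_mulr ha hb => [//|{}a {}b [l hl] [l' hl']].
    by apply: lspan_gen; exists (l + l')%N; exact: wpow_mul.
move: a; apply: lspan_ind.
  split.
    exists (0%N, fun=> 0); split=> // [l|M _]; first by case: (wpow_subsp l).
    by rewrite big1.
  move=> s a b [[N f] [/= f1 f2 f3]] [[N' f'] [/= f1' f2' f3']].
  exists (maxn N N', fun l => s *: f l + f' l); split=> /= [l|l|M].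
  - exact: (wpow_subsp _).2.
  - by rewrite geq_max => /andP[/f2 -> /f2' ->]; rewrite scaler0 addr0.
  - by rewrite geq_max => /andP[/f3 {1}-> /f3' {1}->]; rewrite big_split scaler_sumr.
move=> a [l hl]; exists (l.+1, fun i => if i == l then a else 0); split=> /= [i|i|M lM].
- by case: eqP => [->|_] //; case: (wpow_subsp i).
- by case: eqP => [->|]; rewrite ?ltnn.
- rewrite (bigD1 (Ordinal lM)) //= eqxx big1 ?addr0 // => i.
  by rewrite -val_eqE /= => /negbTE ->.
Qed.

Definition wp (l : nat) (a : A) : A := (sval (wdec a)).2 l.
Definition wbnd (a : A) : nat := (sval (wdec a)).1.
Lemma wp_in l a : wpow V l (wp l a).
Proof. by rewrite /wp; case: (wdec a) => [[N f] []]. Qed.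
Lemma wp_big l a : (wbnd a <= l)%N -> wp l a = 0.
Proof. by rewrite /wp /wbnd; case: (wdec a) => [[N f] [? h ?]]; exact: h. Qed.
Lemma wp_sumE a M : (wbnd a <= M)%N -> a = \sum_(l < M) wp l a.
Proof. by rewrite /wp /wbnd; case: (wdec a) => [[N f] [? ? h]]; exact: h. Qed.

Lemma wp_uniq a M (f : nat -> A) : (forall l, th (f l) = 2 ^+ l *: f l) ->
  (forall l, (M <= l)%N -> f l = 0) ->
  a = \sum_(l < M) f l -> forall l, wp l a = f l.
Proof.
move=> hf f0 e l.
pose L := maxn l.+1 (maxn M (wbnd a)).
have eM : \sum_(i < M) f i = \sum_(i < L) f i.
  rewrite (big_ord_widen L f) ?big_mkcond; last by rewrite /L; lia.
  by apply: eq_bigr => i _; case: ltnP => // /f0.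
apply/eqP; rewrite -subr_eq0; apply/eqP.
apply: (@eigen_direct _ th L (fun l => wp l a - f l)).
- by move=> s v w; rewrite gmD gmZ.
- by move=> i; rewrite gmB hf (wpow_th (wp_in i a)) scalerBr.
- rewrite sumrB -wp_sumE; last by rewrite /L; lia.
  by rewrite -eM -e subrr.
- by rewrite /L; lia.
Qed.

Lemma wpL l s a b : wp l (s *: a + b) = s *: wp l a + wp l b.
Proof.
pose M := maxn (wbnd a) (wbnd b).
apply: (@wp_uniq _ M (fun l => s *: wp l a + wp l b)) => [i|i|].
- by rewrite gmD gmZ !(wpow_th (wp_in i _)) scalerDr !scalerA mulrC.
- by rewrite geq_max => /andP[/wp_big -> /wp_big ->]; rewrite scaler0 addr0.
- by rewrite big_split -scaler_sumr -!wp_sumE // ?leq_maxl ?leq_maxr.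
Qed.
Lemma wp0 l : wp l 0 = 0.
Proof. by have := wpL l (-1) 0 0; rewrite scaler0 addr0 scaleN1r addNr. Qed.
Lemma wpD l a b : wp l (a + b) = wp l a + wp l b.
Proof. by have := wpL l 1 a b; rewrite !scale1r. Qed.
Lemma wpZ l s a : wp l (s *: a) = s *: wp l a.
Proof. by have := wpL l s a 0; rewrite wp0 !addr0. Qed.
Lemma wpB l a b : wp l (a - b) = wp l a - wp l b.
Proof. by rewrite wpD -scaleN1r wpZ scaleN1r. Qed.
Lemma wp_sum l I (r : seq I) (P : pred I) (F : I -> A) :
  wp l (\sum_(i <- r | P i) F i) = \sum_(i <- r | P i) wp l (F i).
Proof. by elim/big_rec2: _ => [|i a b _ <-]; rewrite ?wp0 ?wpD. Qed.

Lemma wp_th k a : th a = 2 ^+ k *: a -> forall l, wp l a = if l == k then a else 0.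
Proof.
move=> ha l; apply: (@wp_uniq _ k.+1 (fun l => if l == k then a else 0)) => [i|i ki|].
- by case: eqP => [->|_] //; rewrite gm0 scaler0.
- by case: eqP ki => [->|] //; rewrite ltnn.
- rewrite big_ord_recr /= eqxx big1 ?add0r // => i _.
  by case: eqP => // e; have := ltn_ord i; rewrite e ltnn.
Qed.
Lemma wp_wpow k a : wpow V k a -> forall l, wp l a = if l == k then a else 0.
Proof. by move=> /wpow_th; exact: wp_th. Qed.
Lemma th_wpow k a : th a = 2 ^+ k *: a -> wpow V k a.
Proof. by move=> /wp_th /(_ k); rewrite eqxx => <-; exact: wp_in. Qed.
Lemma wp_inj a b : (forall l, wp l a = wp l b) -> a = b.
Proof.
move=> h; pose L := maxn (wbnd a) (wbnd b).
rewrite (@wp_sumE a L) ?leq_maxl // (@wp_sumE b L) ?leq_maxr //.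
exact: eq_bigr.
Qed.

Lemma wp_hcomp l k a : wp l (hcomp k a) = hcomp k (wp l a).
Proof.
apply: (@wp_uniq _ (wbnd a) (fun l => hcomp k (wp l a))) => [i|i /wp_big ->|].
- by rewrite gmor_hcomp (wpow_th (wp_in i a)) hcompZ.
- exact: hcomp0.
- by rewrite -hcomp_sum -wp_sumE.
Qed.

Lemma th_diff a : th (diff a) = 2 *: diff (th a).
Proof.
move: a; apply: (md_ind H) => [s|i|i|a b ha hb|a b ha hb].
- by rewrite gmZ gm1 diffZ diff1 gmZ gm0 !scaler0.
- by rewrite (md_dx H) gm0 thx diffZ (md_dx H) !scaler0.
- rewrite (md_dy H) thy diffZ (md_dy H) gm_sum !scaler_sumr; apply: eq_bigr => p _.
  rewrite gm_sum !scaler_sumr; apply: eq_bigr => q _.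
  rewrite gmZ gmM !thx -scalerAl -scalerAr !scalerA; congr (_ *: _).
  by rewrite [RHS]mulrC mulrA.
- by rewrite diffD !gmD ha hb diffD scalerDr.
- by rewrite diffMs !gmD !gmM ha hb diffMs scalerDr -scalerAl -scalerAr gmor_sc.
Qed.

Lemma wp_diff l a : wp l.+1 (diff a) = diff (wp l a).
Proof.
apply: (@wp_uniq _ (wbnd a).+1 (fun l => if l is l'.+1 then diff (wp l' a) else 0) _ _ _ l.+1).
- move=> [|i]; first by rewrite gm0 scaler0.
  by rewrite th_diff (wpow_th (wp_in i a)) diffZ scalerA -exprS.
- by move=> [|i] //; rewrite ltnS => /wp_big ->; rewrite diff0.
- by rewrite big_ord_recl add0r -diff_sum -wp_sumE.
Qed.
Lemma wp0_diff a : wp 0 (diff a) = 0.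
Proof.
apply: (@wp_uniq _ (wbnd a).+1 (fun l => if l is l'.+1 then diff (wp l' a) else 0) _ _ _ 0%N).
- move=> [|i]; first by rewrite gm0 scaler0.
  by rewrite th_diff (wpow_th (wp_in i a)) diffZ scalerA -exprS.
- by move=> [|i] //; rewrite ltnS => /wp_big ->; rewrite diff0.
- by rewrite big_ord_recl add0r -diff_sum -wp_sumE.
Qed.

(** Finitely many cocycles span the cohomology, and their components of large
    word length vanish. So a long cocycle is a boundary plus terms of smaller
    length; take components. *)
Lemma vanish_fin : fin_dim_cohomology A -> exists c0, vanish th c0.
Proof.
move=> [s [scoc sspan]]; exists (\max_(i < size s) wbnd (s`_i)) => k z ck wz dz.
have [w ws [eta _ heta]] := sspan z dz.
have wk : wp k w = 0.
  move: w ws {heta}; move=> w /lspan_seq [a ->]; rewrite wp_sum big1 // => i _.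
  rewrite wpZ wp_big ?scaler0 //; apply: leq_trans (ltnW ck).
  exact: (leq_bigmax i).
case: k ck wz wk => // k ck wz wk; exists (wp k eta); split; last exact: wpow_th (wp_in _ _).
by rewrite -wp_diff heta wpB wk subr0 (wp_th wz) eqxx.
Qed.
End WordLength.

(** * Vanishing above the number of odd generators *)

Section Vanishing.
Variables (A : cdga) (V : set A) (n m : nat) (kx : 'I_n -> nat)
    (ky : 'I_m -> nat) (x : 'I_n -> A) (y : 'I_m -> A)
    (c : 'I_m -> 'I_n -> 'I_n -> rat).
Hypothesis H : model V kx ky x y c.
Variable th : gmor A A.
Hypotheses (thx : forall i, th (x i) = 2 *: x i) (thy : forall i, th (y i) = 2 *: y i).

(** Lambda V [u_1, ..., u_n] can be built in two orders: the u_i after the odd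
    generators, or before them, on Q[x_i, u_i]. The second order bounds its
    cohomology by length n + m, and the first one descends from there to
    Lambda V by removing the n generators u_i. *)
Lemma md_vanish : fin_dim_cohomology A -> vanish th m.
Proof.
move=> /(vanish_fin H thx thy) [c0 V0].
have [||C1 [j1 [X [U T1]]]] := @square_tower_exists cdgaQ n kx.
- by move=> i; case: (md_kx H i).
- by move=> i; case: (md_kx H i) => _ /ltnW.
pose q l := \sum_p \sum_q c l p q *: (X p * X q).
have qg l : gr (ky l).+1 (q l).
  apply: gr_bigsum => p _; apply: gr_bigsum => q' _.
  have [->|/(md_c H) <-] := eqVneq (c l p q') 0; first by rewrite scale0r; exact: gr0.
  by apply: grZ; apply: grM; exact: st_xgr T1 _.
have qd l : diff (q l) = 0.
  rewrite diff_sum big1 // => p _; rewrite diff_sum big1 // => q' _.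
  by rewrite diffZ diffMs !(st_dx T1) mul0r mulr0 addr0 scaler0.
have [|||C2 [j2 [Y T2]]] := @odd_tower_exists C1 m ky q => //.
  by move=> l; case: (md_ky H l).
have [th1 [th1j th1x th1u]] := st_univ T1 (gcomp j1 (gid cdgaQ))
  (fun i => grZ 2 (st_xgr T1 i)) (fun i => grZ 2 (st_ugr T1 i)).
have [th2 [th2j th2y]] := ot_univ T2 (gcomp j2 th1) (fun i => grZ 2 (ot_gr T2 i)).
have VQ : vanish (gid cdgaQ) 0.
  move=> k s k0; rewrite gidE => es _; exists 0; rewrite diff0 gm0 scaler0; split=> //.
  apply/eqP; move: es => /eqP; rewrite -{1}[s]scale1r -subr_eq0 -scalerBl scaler_eq0.
  case/orP; last by rewrite eq_sym.
  rewrite subr_eq0 => /eqP /(@ieexprIn rat 2 isT isT 0%N) e.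
  by rewrite -e in k0.
have V1 : vanish th1 n by have := st_vanish T1 th1j th1x th1u VQ.
have q4 l : th1 (q l) = 4 *: q l.
  rewrite gm_sum scaler_sumr; apply: eq_bigr => p _.
  rewrite gm_sum scaler_sumr; apply: eq_bigr => q' _.
  rewrite gmZ gmM !th1x -scalerAl -scalerAr !scalerA; congr (_ *: _).
  by ring.
have V2 : vanish th2 (n + m) := (ot_vanish T2 th2j th2y q4).1 _ V1.
(* The two towers on the same generators; a retraction of C2 onto A' is enough
   to transfer the vanishing. *)
have [A' [jA [u TA]]] := md_squares H.
have [th' [th'j th'u]] := ot_univ TA (gcomp jA th) (fun i => grZ 2 (ot_gr TA i)).
have [||F [Fx Fy]] := md_map H (fun i => gmor_gr j2 (st_xgr T1 i)) (ot_gr T2).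
- by move=> i; rewrite -dmor_diff (st_dx T1) gm0.
- move=> l; rewrite (ot_d T2) gm_sum; apply: eq_bigr => p _.
  by rewrite gm_sum; apply: eq_bigr => q' _; rewrite gmZ gmM.
have [||F' [F'j F'u]] := ot_map TA (f := F) (c := fun i => j2 (U i)).
- by move=> i; apply: gmor_gr; exact: st_ugr T1 i.
- by move=> i; rewrite -dmor_diff (st_du T1) !gmX Fx.
have [|||ev1 [ev1j ev1x ev1u]] := st_map T1 (unit_mor A')
  (cx := fun i => jA (x i)) (cu := u) _ (ot_gr TA).
- by move=> i; apply: gmor_gr; exact: md_xgr H i.
- by move=> i; rewrite -dmor_diff (md_dx H) gm0.
- by move=> i; rewrite (ot_d TA) gmX.
have [||ev [evj evy]] := ot_map T2 (f := ev1) (c := fun i => jA (y i)).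
- by move=> i; apply: gmor_gr; exact: md_ygr H i.
- move=> l; rewrite -dmor_diff (md_dy H) !gm_sum; apply: eq_bigr => p _.
  by rewrite !gm_sum; apply: eq_bigr => q' _; rewrite !gmZ !gmM !ev1x.
have evF' : forall a, ev (F' a) = a.
  apply: (ot_eq TA (h := gcomp ev F') (h' := gid _)) => [a|i]; rewrite gcompE.
    rewrite F'j; apply: (md_eq H (h := gcomp ev F) (h' := jA)) => i; rewrite gcompE.
      by rewrite Fx evj ev1x.
    by rewrite Fy evy.
  by rewrite F'u evj ev1u.
have thF a : th2 (F a) = F (th a).
  apply: (md_eq H (h := gcomp th2 F) (h' := gcomp F th)) => i; rewrite !gcompE.
    by rewrite Fx thx gmZ Fx th2j gcompE th1x gmZ.
  by rewrite Fy thy gmZ Fy th2y.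
have thF' a : th2 (F' a) = F' (th' a).
  apply: (ot_eq TA (h := gcomp th2 F') (h' := gcomp F' th')) => {}a; rewrite !gcompE.
    by rewrite F'j th'j gcompE F'j thF.
  by rewrite F'u th'u gmZ F'u th2j gcompE th1u gmZ.
have thev1 a : th' (ev1 a) = ev1 (th1 a).
  apply: (st_eq T1 (h := gcomp th' ev1) (h' := gcomp ev1 th1)) => {}a; rewrite !gcompE.
  - by rewrite ev1j th1j gcompE gidE ev1j /= gmZ gm1.
  - by rewrite ev1x th1x gmZ ev1x th'j gcompE thx gmZ.
  - by rewrite ev1u th1u gmZ ev1u th'u.
have thev a : th' (ev a) = ev (th2 a).
  apply: (ot_eq T2 (h := gcomp th' ev) (h' := gcomp ev th2)) => {}a; rewrite !gcompE.
    by rewrite evj th2j gcompE evj thev1.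
  by rewrite evy th2y gmZ evy th'j gcompE thy gmZ.
have V' : vanish th' (n + m).
  move=> k z ck wz dz; have [||eta [deta weta]] := V2 k (F' z) ck.
  - by rewrite thF' wz gmZ.
  - by rewrite -dmor_diff dz gm0.
  exists (ev eta); rewrite -dmor_diff deta evF'; split=> //.
  by rewrite thev weta gmZ.
have x4 i : th (x i ^+ 2) = 4 *: (x i ^+ 2).
  by rewrite gmX thx exprZn.
by apply: (ot_vanish TA th'j th'u x4).2 V0; rewrite addnC.
Qed.
End Vanishing.

(** * Quotient by a differential ideal *)

Record dg_ideal (A : cdga) (I : set A) : Prop := DgIdeal {
  di_subsp : subsp I;
  di_mull : forall a i, I i -> I (a * i);
  di_mulr : forall a i, I i -> I (i * a);
  di_diff : forall i, I i -> I (diff i);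
  di_hcomp : forall k i, I i -> I (hcomp k i);
  di_proper : ~ I 1
}.

Section Quotient.
Variables (A : cdga) (I : set A).
Hypothesis HI : dg_ideal I.

Let Is := di_subsp HI.
(** A representative chosen from the set of all elements congruent to a, so
    that congruent elements have equal representatives. The fixed points of
    qrep form the quotient. *)
Definition qrep (a : A) : A := xget 0 [set b | I (a - b)].
Lemma qrepP a : I (a - qrep a).
Proof. by apply: (xgetI (P := [set b | I (a - b)]) 0 (x := a)); rewrite /= subrr; case: Is. Qed.
Lemma qrep_eq a b : I (a - b) -> qrep a = qrep b.
Proof.
move=> ab; congr (xget _ _); apply/seteqP; split=> d /= h.
  have -> : b - d = (a - d) - (a - b) by rewrite opprB [RHS]addrC addrA subrK.
  exact: subspB.
have -> : a - d = (a - b) + (b - d) by rewrite addrA subrK.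
exact: subspD.
Qed.
Lemma qrep_inj a b : qrep a = qrep b -> I (a - b).
Proof.
move=> e; have -> : a - b = (a - qrep a) - (b - qrep b).
  by rewrite e opprB addrA subrK.
exact: (subspB Is (qrepP _) (qrepP _)).
Qed.
Lemma qrepK a : qrep (qrep a) == qrep a.
Proof. by apply/eqP/qrep_eq; rewrite -opprB -scaleN1r; apply: subspZ => //; exact: qrepP. Qed.

Definition qT := {a : A | qrep a == a}.
Definition qpi (a : A) : qT := exist _ (qrep a) (qrepK a).
Lemma qpiE a b : qpi a = qpi b <-> I (a - b).
Proof.
split; first by move=> /(congr1 val) /= /qrep_inj.
by move=> /qrep_eq e; apply: val_inj.
Qed.
Lemma qpiP a b : I (a - b) -> qpi a = qpi b. Proof. by move=> /qpiE. Qed.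
Lemma qpi_val (q : qT) : qpi (val q) = q.
Proof. by apply: val_inj => /=; exact/eqP/(valP q). Qed.
Lemma qvalP a : I (val (qpi a) - a).
Proof. by apply/qpiE; rewrite qpi_val. Qed.

Definition qadd (p q : qT) := qpi (val p + val q).
Definition qopp (p : qT) := qpi (- val p).
Definition qmul (p q : qT) := qpi (val p * val q).
Definition qscale (s : rat) (p : qT) := qpi (s *: val p).

Lemma qaddE a b : qadd (qpi a) (qpi b) = qpi (a + b).
Proof.
apply: qpiP; rewrite opprD addrACA.
exact: (subspD Is (qvalP _) (qvalP _)).
Qed.
Lemma qoppE a : qopp (qpi a) = qpi (- a).
Proof. by apply: qpiP; rewrite -opprD -scaleN1r; apply: subspZ => //; exact: qvalP. Qed.
Lemma qscaleE s a : qscale s (qpi a) = qpi (s *: a).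
Proof. by apply: qpiP; rewrite -scalerBr; apply: subspZ => //; exact: qvalP. Qed.
Lemma qmulE a b : qmul (qpi a) (qpi b) = qpi (a * b).
Proof.
apply: qpiP.
have -> : val (qpi a) * val (qpi b) - a * b =
   (val (qpi a) - a) * val (qpi b) + a * (val (qpi b) - b).
  by rewrite mulrBl mulrBr addrA subrK.
apply: (subspD Is); first exact: (di_mulr HI _ (qvalP _)).
exact: (di_mull HI _ (qvalP _)).
Qed.
Lemma qind (P : qT -> Prop) : (forall a, P (qpi a)) -> forall q, P q.
Proof. by move=> h q; rewrite -(qpi_val q). Qed.

Ltac qi := match goal with |- ?G => let G' := eval hnf in G in change G' end;
  refine (qind _) => ?.

Fact q_laws : alg_laws (qpi 0) (qpi 1) qopp qadd qmul qscale.
Proof.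
split.
- by do 3!qi; rewrite !qaddE addrA.
- by do 2!qi; rewrite !qaddE addrC.
- by qi; rewrite qaddE add0r.
- by qi; rewrite qoppE qaddE addNr.
- by do 3!qi; rewrite !qmulE mulrA.
- by qi; rewrite qmulE mul1r.
- by qi; rewrite qmulE mulr1.
- by do 3!qi; rewrite !(qaddE, qmulE) mulrDl.
- by do 3!qi; rewrite !(qaddE, qmulE) mulrDr.
- by move=> a b; qi; rewrite !qscaleE scalerA.
- by qi; rewrite qscaleE scale1r.
- by move=> a; do 2!qi; rewrite !(qaddE, qscaleE) scalerDr.
- by qi; move=> a b; rewrite !(qaddE, qscaleE) scalerDl.
- by move=> /qpiE; rewrite subr0; exact: di_proper HI.
- by move=> a; do 2!qi; rewrite !(qscaleE, qmulE) scalerAl.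
- by move=> a; do 2!qi; rewrite !(qscaleE, qmulE) scalerAr.
Qed.
Definition qalg : algType rat := mk_alg q_laws.
Definition qp (a : A) : qalg := qpi a.
Lemma qpD a b : qp (a + b) = qp a + qp b. Proof. exact/esym/qaddE. Qed.
Lemma qpZ s a : qp (s *: a) = s *: qp a. Proof. exact/esym/qscaleE. Qed.
Lemma qpM a b : qp (a * b) = qp a * qp b. Proof. exact/esym/qmulE. Qed.
Lemma qp1 : qp 1 = 1. Proof. by []. Qed.
Lemma qp_sum J (r : seq J) (P : pred J) (F : J -> A) :
  qp (\sum_(i <- r | P i) F i) = \sum_(i <- r | P i) qp (F i).
Proof. by elim/big_rec2: _ => // i a b _ <-; rewrite qpD. Qed.
Lemma qp_eq0 a : qp a = 0 <-> I a.
Proof. by rewrite -[X in I X]subr0; exact: qpiE. Qed.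
Lemma qp_surj (q : qalg) : exists a, qp a = q.
Proof. by exists (val (q : qT)); exact: qpi_val. Qed.

Definition qgr (k : nat) : set qalg := [set q | exists2 a, gr k a & qp a = q].
Fact qgr0 k : qgr k 0. Proof. by exists 0 => //; exact: gr0. Qed.
Fact qgrL k s p q : qgr k p -> qgr k q -> qgr k (s *: p + q).
Proof. by move=> [a ga <-] [b gb <-]; exists (s *: a + b); [exact: grL | rewrite qpD qpZ]. Qed.
Fact qgr_sum q : exists (N : nat) (f : nat -> qalg),
  (forall i, qgr i (f i)) /\ q = \sum_(i < N) f i.
Proof.
have [a <-] := qp_surj q; exists (bnd a), (fun k => qp (hcomp k a)); split.
  by move=> k; exists (hcomp k a) => //; exact: gr_hcomp.
by rewrite -qp_sum -hcomp_sumE.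
Qed.
Fact qgr_direct (N : nat) (f : nat -> qalg) : (forall i, qgr i (f i)) ->
  \sum_(i < N) f i = 0 -> forall i, (i < N)%N -> f i = 0.
Proof.
move=> h; have {h} [a ha] : exists a : nat -> A, forall i, gr i (a i) /\ qp (a i) = f i.
  have : forall i, exists a, gr i a /\ qp a = f i by move=> i; have [a ga <-] := h i; exists a.
  by move=> /choice [a ha]; exists a.
move=> e i iN; have [ga <-] := ha i; apply/qp_eq0.
rewrite -(hcomp_uniq (f := a) (fun k => (ha k).1) iN); apply: (di_hcomp HI).
apply/qp_eq0; rewrite qp_sum -[RHS]e; apply: eq_bigr => l _.
by case: (ha l).
Qed.
Fact qgr1 : qgr 0 (1 : qalg). Proof. by exists 1 => //; exact: gr1. Qed.
Fact qgrM i l (p q : qalg) : qgr i p -> qgr l q -> qgr (i + l) (p * q).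
Proof. by move=> [a ga <-] [b gb <-]; exists (a * b); [exact: grM | rewrite qpM]. Qed.
Fact qgrC i l (p q : qalg) : qgr i p -> qgr l q -> p * q = (-1) ^+ (i * l) * (q * p).
Proof. by move=> [a ga <-] [b gb <-]; rewrite gr_signE -!qpM -qpZ (grC ga gb) gr_signE. Qed.
Definition qgca : gca := Gca qgr0 qgrL qgr_sum qgr_direct qgr1 qgrM qgrC.

Definition qdiff (q : qgca) : qgca := qp (diff (val (q : qT))).
Lemma qdiffE a : qdiff (qp a) = qp (diff a).
Proof. by apply: qpiP; rewrite -diffB; apply: (di_diff HI); exact: qvalP. Qed.
Fact qdiffL (s : rat) (p q : qgca) : qdiff (s *: p + q) = s *: qdiff p + qdiff q.
Proof.
have [a <-] := qp_surj p; have [b <-] := qp_surj q.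
have -> : s *: (qp a : qgca) + qp b = qp (s *: a + b) by rewrite qpD qpZ.
by rewrite !qdiffE diffL qpD qpZ.
Qed.
Fact qdiff_gr k (q : qgca) : gr k q -> gr k.+1 (qdiff q).
Proof. by move=> [a ga <-]; rewrite qdiffE; exists (diff a) => //; exact: diff_gr. Qed.
Fact qdiffM k (p q : qgca) : gr k p ->
  qdiff (p * q) = qdiff p * q + (-1) ^+ k * (p * qdiff q).
Proof.
move=> [a ga <-]; have [b <-] := qp_surj q.
have -> : (qp a : qgca) * qp b = qp (a * b) by rewrite qpM.
by rewrite gr_signE !qdiffE (diffM _ ga) gr_signE qpD qpZ !qpM.
Qed.
Fact qdiffK (q : qgca) : qdiff (qdiff q) = 0.
Proof. by have [a <-] := qp_surj q; rewrite !qdiffE diffK. Qed.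
Definition qcdga : cdga := @Cdga qgca qdiff qdiffL qdiff_gr qdiffM qdiffK.

Definition qproj_mor : gmor A qcdga.
Proof.
refine (@mk_mor A qcdga qp _ _ _ _).
- by move=> s a b; rewrite qpD qpZ.
- exact: qp1.
- exact: qpM.
- by move=> k a ga; exists a.
Defined.
Definition qproj : dmor A qcdga.
Proof. by refine (@mk_dmor A qcdga qproj_mor _) => a; exact/esym/qdiffE. Defined.
End Quotient.

Lemma quotient_exists (A : cdga) (I : set A) : dg_ideal I ->
  exists (B : cdga) (rho : dmor A B), (forall b, exists a, rho a = b) /\
    forall a, rho a = 0 <-> I a.
Proof.
move=> HI; exists (qcdga HI), (qproj HI); split; first exact: qp_surj.
by move=> a; exact: qp_eq0.
Qed.

(** * Colimits of retractable chains *)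

Definition chain_j (E : nat -> cdga) := forall i, dmor (E i) (E i.+1).
Definition chain_p (E : nat -> cdga) := forall i, gmor (E i.+1) (E i).

(** The sequence of the images of an element e of E N in all stages: pushed
    forward by j beyond N, pulled back by p before N. Shifting the chain in
    the recursion avoids transporting e along an equality of indices. *)
Fixpoint emb (N : nat) : forall (E : nat -> cdga), chain_j E -> chain_p E ->
    E N -> forall i, E i :=
  match N return forall (E : nat -> cdga), chain_j E -> chain_p E ->
    E N -> forall i, E i with
  | 0 => fun E j p e => fix go i := if i is i'.+1 then j i' (go i') else e
  | N'.+1 => fun E j p e i =>
      let rec := @emb N' (fun i => E i.+1) (fun i => j i.+1) (fun i => p i.+1) e in
      if i is i'.+1 then rec i' else p 0%N (rec 0%N)
  end.

Lemma emb_at N E (j : chain_j E) (p : chain_p E) e : emb j p e N = e.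
Proof.
elim: N E j p e => [//|N ih] E j p e /=.
exact: (ih _ (fun i => j i.+1) (fun i => p i.+1)).
Qed.
Lemma emb_j N E (j : chain_j E) (p : chain_p E) (e : E N) i :
  (N <= i)%N -> emb j p e i.+1 = j i (emb j p e i).
Proof.
elim: N E j p e i => [|N ih] E j p e [|i] //= Ni.
exact: (ih _ (fun i => j i.+1) (fun i => p i.+1)).
Qed.
Lemma emb_p N E (j : chain_j E) (p : chain_p E) (e : E N) :
  (forall i a, p i (j i a) = a) -> forall i, p i (emb j p e i.+1) = emb j p e i.
Proof.
elim: N E j p e => [|N ih] E j p e pj i; first exact: pj.
by case: i => [//|i]; apply: (ih _ (fun i => j i.+1) (fun i => p i.+1)) => l a; exact: pj.
Qed.
Lemma emb_morph N E (j : chain_j E) (p : chain_p E) i :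
  exists h : gmor (E N) (E i), forall e, emb j p e i = h e.
Proof.
elim: N E j p i => [|N ih] E j p i /=.
  elim: i => [|i [h hE]]; first by exists (gid _).
  by exists (gcomp (j i) h) => e; rewrite gcompE hE.
case: i => [|i]; last exact: (ih _ (fun i => j i.+1) (fun i => p i.+1)).
have [h hE] := ih _ (fun i => j i.+1) (fun i => p i.+1) 0%N.
by exists (gcomp (p 0%N) h) => e; rewrite gcompE hE.
Qed.

Section Colimit.
Variables (E : nat -> cdga) (j : chain_j E) (p : chain_p E).
Hypothesis pj : forall i a, p i (j i a) = a.

Definition stable (f : forall i, E i) (N : nat) := forall i, (N <= i)%N -> f i.+1 = j i (f i).
(** Thanks to the retractions p, a colimit element is determined by the
    sequence of its images in all the stages, compatible under p and
    eventually given by j. Operations are then componentwise, with no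
    quotient; equality may be tested at late stages ([cP]). *)
Definition cok (f : forall i, E i) :=
  (forall i, p i (f i.+1) = f i) /\ exists N, stable f N.
Definition cT := {f : forall i, E i | cok f}.
Definition cv (F : cT) : forall i, E i := sval F.

Lemma cP (F G : cT) : (exists N, forall i, (N <= i)%N -> cv F i = cv G i) -> F = G.
Proof.
case: F G => [f [fp fs]] [g [gp gs]] [N /= e].
suff fg : f = g by subst g; congr exist; exact: Prop_irrelevance.
apply: functional_extensionality_dep => i.
have down k : f (i + k)%N = g (i + k)%N -> f i = g i.
  elim: k => [|k ih]; first by rewrite addn0.
  by rewrite addnS => ek; apply: ih; rewrite -fp -gp ek.
by apply: (down N); apply: e; exact: leq_addl.
Qed.
Lemma stable_le f N N' : (N <= N')%N -> stable f N -> stable f N'.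
Proof. by move=> NN h i Ni; apply: h; exact: leq_trans Ni. Qed.

Definition cpoint (op : forall i, E i) (h : cok op) : cT := exist _ op h.

Fact c0_ok : cok (fun i => 0).
Proof. by split=> [i|]; [rewrite gm0 | exists 0%N => i _; rewrite gm0]. Qed.
Fact c1_ok : cok (fun i => 1).
Proof. by split=> [i|]; [rewrite gm1 | exists 0%N => i _; rewrite gm1]. Qed.
Fact cN_ok F : cok (fun i => - cv F i).
Proof.
case: F => f [fp [N fs]] /=; split=> [i|]; first by rewrite gmN fp.
by exists N => i Ni; rewrite gmN fs.
Qed.
Fact cD_ok F G : cok (fun i => cv F i + cv G i).
Proof.
case: F G => f [fp [N fs]] [g [gp [N' gs]]] /=; split=> [i|]; first by rewrite gmD fp gp.
exists (maxn N N') => i; rewrite geq_max => /andP[h h'].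
by rewrite gmD fs ?gs.
Qed.
Fact cM_ok F G : cok (fun i => cv F i * cv G i).
Proof.
case: F G => f [fp [N fs]] [g [gp [N' gs]]] /=; split=> [i|]; first by rewrite gmM fp gp.
exists (maxn N N') => i; rewrite geq_max => /andP[h h'].
by rewrite gmM fs ?gs.
Qed.
Fact cZ_ok s F : cok (fun i => s *: cv F i).
Proof.
case: F => f [fp [N fs]] /=; split=> [i|]; first by rewrite gmZ fp.
by exists N => i Ni; rewrite gmZ fs.
Qed.
Fact c_laws : alg_laws (cpoint c0_ok) (cpoint c1_ok) (fun F => cpoint (cN_ok F))
  (fun F G => cpoint (cD_ok F G)) (fun F G => cpoint (cM_ok F G))
  (fun s F => cpoint (cZ_ok s F)).
Proof.
split.
- by move=> F G K; apply: cP; exists 0%N => i _ /=; rewrite addrA.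
- by move=> F G; apply: cP; exists 0%N => i _ /=; rewrite addrC.
- by move=> F; apply: cP; exists 0%N => i _ /=; rewrite add0r.
- by move=> F; apply: cP; exists 0%N => i _ /=; rewrite addNr.
- by move=> F G K; apply: cP; exists 0%N => i _ /=; rewrite mulrA.
- by move=> F; apply: cP; exists 0%N => i _ /=; rewrite mul1r.
- by move=> F; apply: cP; exists 0%N => i _ /=; rewrite mulr1.
- by move=> F G K; apply: cP; exists 0%N => i _ /=; rewrite mulrDl.
- by move=> F G K; apply: cP; exists 0%N => i _ /=; rewrite mulrDr.
- by move=> a b F; apply: cP; exists 0%N => i _ /=; rewrite scalerA.
- by move=> F; apply: cP; exists 0%N => i _ /=; rewrite scale1r.
- by move=> a F G; apply: cP; exists 0%N => i _ /=; rewrite scalerDr.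
- by move=> F a b; apply: cP; exists 0%N => i _ /=; rewrite scalerDl.
- by move=> /(congr1 (fun F => cv F 0%N)) /= /eqP; rewrite oner_eq0.
- by move=> a F G; apply: cP; exists 0%N => i _ /=; rewrite scalerAl.
- by move=> a F G; apply: cP; exists 0%N => i _ /=; rewrite scalerAr.
Qed.
Definition calg : algType rat := mk_alg c_laws.
Definition ca (F : calg) i : E i := cv F i.
Lemma caD F G i : ca (F + G) i = ca F i + ca G i. Proof. by []. Qed.
Lemma caZ s F i : ca (s *: F) i = s *: ca F i. Proof. by []. Qed.
Lemma caM F G i : ca (F * G) i = ca F i * ca G i. Proof. by []. Qed.
Lemma ca0 i : ca 0 i = 0. Proof. by []. Qed.
Lemma ca1 i : ca 1 i = 1. Proof. by []. Qed.
Lemma ca_sum I (r : seq I) (P : pred I) (F : I -> calg) i :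
  ca (\sum_(k <- r | P k) F k) i = \sum_(k <- r | P k) ca (F k) i.
Proof. by elim/big_rec2: _ => // k a b _ <-. Qed.
Lemma caP (F G : calg) : (exists N, forall i, (N <= i)%N -> ca F i = ca G i) -> F = G.
Proof. exact: cP. Qed.
Lemma ca_stable (F : calg) : exists N, stable (ca F) N.
Proof. by case: F => f []. Qed.

Fact cemb_ok N (e : E N) : cok (emb j p e).
Proof. by split; [exact: emb_p | exists N => i; exact: emb_j]. Qed.
Definition cemb N (e : E N) : calg := cpoint (cemb_ok e).
Lemma ca_emb N (e : E N) : ca (cemb e) N = e. Proof. exact: emb_at. Qed.
Lemma emb_stable N (e : E N) : stable (ca (cemb e)) N.
Proof. by move=> i; exact: emb_j. Qed.
Lemma cstable_eq (F G : calg) N : stable (ca F) N -> stable (ca G) N ->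
  ca F N = ca G N -> F = G.
Proof.
move=> hF hG e; apply: caP; exists N => i Ni; rewrite -(subnK Ni).
elim: (i - N)%N => [//|k ih]; rewrite addSn hF ?hG ?ih //; exact: leq_addl.
Qed.
Lemma cemb_ca (F : calg) N : stable (ca F) N -> cemb (ca F N) = F.
Proof. by move=> hF; apply: cstable_eq (emb_stable _) hF _; exact: ca_emb. Qed.
Lemma cemb_L N s (a b : E N) : cemb (s *: a + b) = s *: cemb a + cemb b.
Proof.
apply: caP; exists 0%N => i _; rewrite caD caZ /ca /=.
by have [h hE] := emb_morph N j p i; rewrite !hE gmD gmZ.
Qed.
Lemma cemb_M N (a b : E N) : cemb (a * b) = cemb a * cemb b.
Proof.
apply: caP; exists 0%N => i _; rewrite caM /ca /=.
by have [h hE] := emb_morph N j p i; rewrite !hE gmM.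
Qed.
Lemma cemb_1 N : cemb (1 : E N) = 1.
Proof.
apply: caP; exists 0%N => i _; rewrite ca1 /ca /=.
by have [h hE] := emb_morph N j p i; rewrite hE gm1.
Qed.
Lemma cemb_sum N I (r : seq I) (P : pred I) (F : I -> E N) :
  cemb (\sum_(k <- r | P k) F k) = \sum_(k <- r | P k) cemb (F k).
Proof.
elim/big_rec2: _ => [|k a b _ <-]; last by have := cemb_L 1 (F k) b; rewrite !scale1r.
by have := cemb_L (-1) (0 : E N) 0; rewrite scaler0 addr0 scaleN1r addNr.
Qed.

Definition cgr (k : nat) : set calg := [set F | forall i, gr k (ca F i)].
Lemma cgr_emb k N (e : E N) : gr k e -> cgr k (cemb e).
Proof.
move=> ge i; rewrite /ca /=; have [h hE] := emb_morph N j p i.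
by rewrite hE; exact: gmor_gr.
Qed.
Fact cgr0 k : cgr k 0. Proof. by move=> i; exact: gr0. Qed.
Fact cgrL k s F G : cgr k F -> cgr k G -> cgr k (s *: F + G).
Proof. by move=> hF hG i; rewrite caD caZ; exact: grL. Qed.
Fact cgr_sum F : exists (N : nat) (f : nat -> calg),
  (forall i, cgr i (f i)) /\ F = \sum_(i < N) f i.
Proof.
have [N hN] := ca_stable F.
exists (bnd (ca F N)), (fun k => cemb (hcomp k (ca F N))); split.
  by move=> k; apply: cgr_emb; exact: gr_hcomp.
by rewrite -cemb_sum -hcomp_sumE // cemb_ca.
Qed.
Fact cgr_direct (N : nat) (f : nat -> calg) : (forall i, cgr i (f i)) ->
  \sum_(i < N) f i = 0 -> forall i, (i < N)%N -> f i = 0.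
Proof.
move=> fg e i iN; apply: caP; exists 0%N => l _; rewrite ca0.
apply: (gr_direct (f := fun i => ca (f i) l) _ _ iN) => [k|]; first exact: fg.
by rewrite -ca_sum e.
Qed.
Fact cgr1 : cgr 0 (1 : calg). Proof. by move=> i; exact: gr1. Qed.
Fact cgrM i l F G : cgr i F -> cgr l G -> cgr (i + l) (F * G).
Proof. by move=> hF hG k; rewrite caM; exact: grM. Qed.
Fact cgrC i l F G : cgr i F -> cgr l G -> F * G = (-1) ^+ (i * l) * (G * F).
Proof.
move=> hF hG; rewrite gr_signE; apply: caP; exists 0%N => k _.
by rewrite caZ !caM (grC (hF k) (hG k)) gr_signE.
Qed.
Definition cgca : gca := Gca cgr0 cgrL cgr_sum cgr_direct cgr1 cgrM cgrC.

Lemma cdiff_ex (F : cgca) : exists G : cgca, exists N, forall i, (N <= i)%N ->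
  ca G i = diff (ca F i).
Proof.
have [N hN] := ca_stable F; exists (cemb (diff (ca F N))), N => i Ni.
rewrite -(subnK Ni); elim: (i - N)%N => [|k ih]; first exact: ca_emb.
rewrite addSn (emb_stable (diff (ca F N))) ?leq_addl // ih.
by rewrite dmor_diff -hN // leq_addl.
Qed.
(** The retractions p need not commute with the differentials, so the
    differential is componentwise only at late stages and is extended from
    there. *)
Definition cdiff (F : cgca) : cgca := sval (cid (cdiff_ex F)).
Lemma cdiffE F : exists N, forall i, (N <= i)%N -> ca (cdiff F) i = diff (ca F i).
Proof. by rewrite /cdiff; case: (cid _). Qed.
Fact cdiffL s (F G : cgca) : cdiff (s *: F + G) = s *: cdiff F + cdiff G.
Proof.
have [N1 h1] := cdiffE (s *: F + G); have [N2 h2] := cdiffE F; have [N3 h3] := cdiffE G.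
apply: caP; exists (maxn N1 (maxn N2 N3)) => i; rewrite !geq_max => /and3P[l1 l2 l3].
by rewrite caD caZ h1 // h2 // h3 // caD caZ diffL.
Qed.
Lemma cgr_late k (F : cgca) N : (forall i, (N <= i)%N -> gr k (ca F i)) -> gr k F.
Proof.
move=> h i.
have down l : gr k (ca F (i + l)%N) -> gr k (ca F i).
  elim: l => [|l ih]; first by rewrite addn0.
  rewrite addnS => g; apply: ih.
  by have <- : p _ (ca F (i + l).+1) = ca F (i + l)%N; [case: (F) => f [] | exact: gmor_gr].
by apply: (down N); apply: h; exact: leq_addl.
Qed.
Fact cdiff_gr k (F : cgca) : gr k F -> gr k.+1 (cdiff F).
Proof.
move=> gF; have [N h] := cdiffE F; apply: (@cgr_late _ _ N) => i Ni.
by rewrite h //; apply: diff_gr; exact: gF.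
Qed.
Fact cdiffM k (F G : cgca) : gr k F ->
  cdiff (F * G) = cdiff F * G + (-1) ^+ k * (F * cdiff G).
Proof.
move=> gF; rewrite gr_signE.
have [N1 h1] := cdiffE (F * G); have [N2 h2] := cdiffE F; have [N3 h3] := cdiffE G.
apply: caP; exists (maxn N1 (maxn N2 N3)) => i; rewrite !geq_max => /and3P[l1 l2 l3].
by rewrite caD caZ !caM h1 // h2 // h3 // caM (diffM _ (gF i)) gr_signE.
Qed.
Fact cdiffK (F : cgca) : cdiff (cdiff F) = 0.
Proof.
have [N1 h1] := cdiffE F; have [N2 h2] := cdiffE (cdiff F).
apply: caP; exists (maxn N1 N2) => i; rewrite !geq_max => /andP[l1 l2].
by rewrite h2 // h1 // diffK.
Qed.
Definition ccdga : cdga := @Cdga cgca cdiff cdiffL cdiff_gr cdiffM cdiffK.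

Definition cinc_mor N : gmor (E N) ccdga.
Proof.
refine (@mk_mor (E N) ccdga (@cemb N) _ _ _ _).
- exact: cemb_L.
- exact: cemb_1.
- exact: cemb_M.
- by move=> k a; exact: cgr_emb.
Defined.
Lemma cinc_diff N (a : E N) : cemb (diff a) = cdiff (cemb a).
Proof.
have [N1 h1] := cdiffE (cemb a); apply: caP; exists (maxn N N1) => i.
rewrite geq_max => /andP[Ni l1]; rewrite h1 // -(subnK Ni) {l1}.
elim: (i - N)%N => [|k ih]; first by rewrite !ca_emb.
rewrite addSn (emb_stable (diff a)) ?leq_addl // ih.
by rewrite dmor_diff -(emb_stable a) // leq_addl.
Qed.
Definition cinc N : dmor (E N) ccdga.
Proof. by refine (@mk_dmor (E N) ccdga (cinc_mor N) _) => a; exact: cinc_diff. Defined.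
Lemma cincE N a : cinc N a = cemb a. Proof. by []. Qed.
Lemma cinc_j N (a : E N) : cinc N.+1 (j N a) = cinc N a.
Proof.
apply: (@cstable_eq _ _ N.+1); first exact: emb_stable.
  exact: stable_le (leqnSn _) (emb_stable a).
by rewrite !cincE ca_emb emb_stable // ca_emb.
Qed.

Lemma cmap_exists (D : gca) (h : forall i, gmor (E i) D) :
  (forall i a, h i.+1 (j i a) = h i a) ->
  exists H : gmor ccdga D, forall i a, H (cinc i a) = h i a.
Proof.
move=> hj.
pose st (F : ccdga) := sval (cid (ca_stable F)).
have stP (F : ccdga) : stable (ca F) (st F) by rewrite /st; case: (cid _).
pose H (F : ccdga) := h (st F) (ca F (st F)).
have late (F : ccdga) N i : stable (ca F) N -> (N <= i)%N -> h i (ca F i) = h N (ca F N).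
  move=> hN Ni; rewrite -(subnK Ni); elim: (i - N)%N => [//|k ih].
  by rewrite addSn hN ?leq_addl // hj.
have HE (F : ccdga) i : stable (ca F) i -> H F = h i (ca F i).
  move=> hi; rewrite /H -(@late F (st F) (maxn (st F) i) (stP F)) ?leq_maxl //.
  by rewrite (@late F i (maxn (st F) i) hi) ?leq_maxr.
have HL s F G : H (s *: F + G) = s *: H F + H G.
  pose K : ccdga := s *: F + G; pose i := maxn (st K) (maxn (st F) (st G)).
  have l1 : (st K <= i)%N by rewrite /i; lia.
  have l2 : (st F <= i)%N by rewrite /i; lia.
  have l3 : (st G <= i)%N by rewrite /i; lia.
  rewrite (HE K i (stable_le l1 (stP K))) (HE F i (stable_le l2 (stP F))).
  by rewrite (HE G i (stable_le l3 (stP G))) caD caZ gmD gmZ.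
have HM F G : H (F * G) = H F * H G.
  pose K : ccdga := F * G; pose i := maxn (st K) (maxn (st F) (st G)).
  have l1 : (st K <= i)%N by rewrite /i; lia.
  have l2 : (st F <= i)%N by rewrite /i; lia.
  have l3 : (st G <= i)%N by rewrite /i; lia.
  rewrite (HE K i (stable_le l1 (stP K))) (HE F i (stable_le l2 (stP F))).
  by rewrite (HE G i (stable_le l3 (stP G))) caM gmM.
have H1 : H 1 = 1 by rewrite /H ca1 gm1.
have Hg k F : gr k F -> gr k (H F) by move=> gF; apply: gmor_gr; exact: gF.
exists (mk_mor HL H1 HM Hg) => i a; rewrite mk_morE cincE.
by rewrite (HE _ i (emb_stable a)) ca_emb.
Qed.
End Colimit.

(** What is used of the colimit of a chain of split inclusions: every element
    comes from a stage, the stages embed with their degrees, and compatible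
    morphisms glue. *)
Lemma colim_exists (E : nat -> cdga) (j : chain_j E) (p : chain_p E) :
  (forall i a, p i (j i a) = a) ->
  exists (C : cdga) (e : forall i, dmor (E i) C),
  [/\ forall i a, e i.+1 (j i a) = e i a,
      forall c, exists N a, c = e N a,
      forall i a, e i a = 0 -> a = 0,
      forall i k a, gr k (e i a) -> gr k a &
      forall (D : gca) (h : forall i, gmor (E i) D),
       (forall i a, h i.+1 (j i a) = h i a) ->
       exists H : gmor C D, forall i a, H (e i a) = h i a].
Proof.
move=> pj; exists (ccdga pj), (cinc pj); split.
- exact: cinc_j.
- move=> F; have [N hN] := ca_stable F; exists N, (ca F N).
  by rewrite cincE cemb_ca.
- by move=> i a /(congr1 (fun F => ca F i)); rewrite cincE ca_emb.
- by move=> i k a g; have := g i; rewrite cincE ca_emb.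
- by move=> D h; exact: cmap_exists.
Qed.

(** * Relative Sullivan models by killing the kernel *)

Lemma one_ext_exists (R : cdga) k (z : R) : gr k.+1 z -> diff z = 0 ->
  exists (R' : cdga) (j : dmor R R') (u : R'), one_ext j k z u.
Proof.
move=> zg zd; have [ok|ek] := boolP (odd k).
  have [R' [j [u H]]] := odd_ext_exists ok zg zd.
  by exists R', j, u; exact: odd_one H.
have [R' [j [u H]]] := even_ext_exists ek zg zd.
by exists R', j, u; exact: even_one H.
Qed.

Lemma hcomp_mulr (A : gca) i d (a b : A) : gr d b ->
  hcomp i (a * b) = if (d <= i)%N then hcomp (i - d) a * b else 0.
Proof.
move=> gb; move: a; apply: (@gr_ind A).
- by rewrite mul0r !hcomp0 mul0r; case: ifP.
- move=> a a' ha ha'; rewrite mulrDl [LHS]hcompD ha ha'; case: ifP => _; last exact: addr0.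
  by rewrite hcompD mulrDl.
- move=> k a ga; rewrite (hcomp_gr i (grM ga gb)); case: leqP => di.
    rewrite (hcomp_gr _ ga); case: eqP => [->|ne]; first by rewrite addnK eqxx.
    by case: eqP => [e|]; [case: ne; lia | rewrite mul0r].
  by case: eqP => // e; lia.
Qed.

(** A homogeneous element has homogeneous coefficients; in low degrees few
    powers of u can occur. The following three lemmas read this off below, at
    and just above the degree k of u. *)
Lemma one_gr (R R' : cdga) (j : dmor R R') k z u i (e : R') : one_ext j k z u -> gr i e ->
  exists N (f : nat -> R), [/\ e = \sum_(l < N) j (f l) * u ^+ l,
    forall l, (l * k <= i)%N -> gr (i - l * k) (f l) &
    forall l, (i < l * k)%N -> f l = 0].
Proof.
move=> H ge; have [N [f ef]] := on_gen H e.
exists N, (fun l => if (l * k <= i)%N then hcomp (i - l * k) (f l) else 0); split.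
- rewrite -(hcomp_id ge) ef hcomp_sum; apply: eq_bigr => l _.
  have gu : gr (l * k) (u ^+ l).
    elim: (nat_of_ord l) => [|a ih]; first exact: gr1.
    by rewrite exprS mulSn; apply: grM => //; exact: on_gr H.
  rewrite (hcomp_mulr _ _ gu); case: ifP => _; last by rewrite gm0 mul0r.
  by rewrite gmor_hcomp.
- by move=> l ->; exact: gr_hcomp.
- by move=> l; rewrite ltnNge => /negbTE ->.
Qed.

Lemma one_gr_low (R R' : cdga) (j : dmor R R') k z u i (e : R') : one_ext j k z u ->
  gr i e -> (i < k)%N -> exists2 a, gr i a & e = j a.
Proof.
move=> H ge ik; have [N [f [-> f1 f2]]] := one_gr H ge.
case: N => [|N]; first by exists 0; rewrite ?big_ord0 ?gm0 //; exact: gr0.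
exists (f 0%N); first by have := f1 0%N; rewrite mul0n subn0; exact.
rewrite big_ord_recl expr0 mulr1 big1 ?addr0 // => l _.
by rewrite f2 ?gm0 ?mul0r // mulSn; lia.
Qed.
Lemma one_gr_mid (R R' : cdga) (j : dmor R R') k z u (e : R') : one_ext j k z u ->
  (0 < k)%N -> gr k e -> exists a b, [/\ gr k a, gr 0 b & e = j a + j b * u].
Proof.
move=> H k0 ge; have [N [f [-> f1 f2]]] := one_gr H ge.
pose g l := if (l < N)%N then f l else 0.
have -> : \sum_(l < N) j (f l) * u ^+ l = \sum_(l < N.+2) j (g l) * u ^+ l.
  rewrite (big_ord_widen N.+2 (fun i => j (f i) * u ^+ i)) ?leqW //.
  rewrite big_mkcond; apply: eq_bigr => i _; rewrite /g.
  by case: ifP => // _; rewrite gm0 mul0r.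
exists (g 0%N), (g 1%N); split.
- rewrite /g; case: ifP => _; last exact: gr0.
  by have := f1 0%N; rewrite mul0n subn0; exact.
- rewrite /g; case: ifP => _; last exact: gr0.
  by have := f1 1%N; rewrite mul1n subnn; exact.
- rewrite !big_ord_recl expr0 mulr1 expr1 big1 ?addr0 // => l _.
  rewrite /g !lift0 /=; case: ifP => _; rewrite ?gm0 ?mul0r //.
  by rewrite f2 ?gm0 ?mul0r // !mulSn; lia.
Qed.
Lemma one_gr_high (R R' : cdga) (j : dmor R R') k z u (e : R') : one_ext j k z u ->
  (forall a : R, gr 1 a -> a = 0) ->
  (1 < k)%N -> gr k.+1 e -> exists2 a, gr k.+1 a & e = j a.
Proof.
move=> H R1 k0 ge; have [N [f [-> f1 f2]]] := one_gr H ge.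
case: N => [|N]; first by exists 0; rewrite ?big_ord0 ?gm0 //; exact: gr0.
exists (f 0%N); first by have := f1 0%N; rewrite mul0n subn0; exact.
rewrite big_ord_recl expr0 mulr1 big1 ?addr0 // => -[[|l] lN] _ /=.
  rewrite (R1 (f _)) ?gm0 ?mul0r //.
  by have := f1 1%N; rewrite mul1n subSnn; apply.
by rewrite f2 ?gm0 ?mul0r // /bump /= !mulSn; lia.
Qed.

Section Maps.
Variables (E E' : gca) (h : gmor E E') (S : set E) (S' : set E').
Hypothesis hS : forall s, S s -> S' (h s).
Lemma lspan_map x : lspan S x -> lspan S' (h x).
Proof.
move: x; apply: lspan_ind; last by move=> x Sx; apply: lspan_gen; exact: hS.
split; first by rewrite gm0; case: (lspan_subsp S').
by move=> c x y hx hy; rewrite gmD gmZ; exact: (lspan_subsp S').2.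
Qed.
Lemma wpow_map p x : wpow S p x -> wpow S' p (h x).
Proof.
move=> [n [c [v [hv ->]]]]; exists n, c, (fun i => h (v i)); split.
  move=> i; have [w [hw ->]] := hv i; exists (fun l => h (w l)); split.
    by move=> l; exact: hS.
  by rewrite gm_prod.
by rewrite gm_sum; apply: eq_bigr => i _; rewrite gmZ.
Qed.
Lemma wpow_if_map P x : wpow_if P S x -> wpow_if P S' (h x).
Proof.
move=> [n [c [v [hv ->]]]]; exists n, c, (fun i => h (v i)); split.
  by move=> i; have [p pp wp] := hv i; exists p => //; exact: wpow_map.
by rewrite gm_sum; apply: eq_bigr => i _; rewrite gmZ.
Qed.
End Maps.

Lemma ext_span_map (A E E' : gca) (io : gmor A E) (io' : gmor A E') (h : gmor E E') (S : set E) (S' : set E') :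
  (forall s, S s -> S' (h s)) -> (forall a, h (io a) = io' a) ->
  forall x, ext_span io S x -> ext_span io' S' (h x).
Proof.
move=> hS hio x [n [c [v [hv ->]]]]; exists n, c, (fun i => h (v i)); split.
  move=> i; have [a [b [hb ->]]] := hv i; exists a, (h b); split; last by rewrite gmM hio.
  exact: wpow_if_map hb.
by rewrite gm_sum; apply: eq_bigr => i _; rewrite gmZ.
Qed.

Lemma graded_map (E E' : gca) (h : gmor E E') P S : graded P S -> graded P (h @` S).
Proof.
move=> gS; have Ss := graded_subsp gS.
have hSs : subsp (h @` S).
  split; first by exists 0; [case: Ss | exact: gm0].
  move=> c _ _ [x Sx <-] [y Sy <-]; exists (c *: x + y); last by rewrite gmD gmZ.
  exact: Ss.2.
rewrite /graded; apply/seteqP; split; last exact: (hpart_sub hSs).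
move=> _ [x Sx <-]; move: Sx; rewrite {1}gS; apply: lspan_map => s [Ss' [k pk gk]].
by split; [exists s | exists k => //; exact: gmor_gr].
Qed.

Lemma wpow_if_mul (E : cdga) (S : set E) v w :
  wpow_if xpredT S v -> wpow_if xpredT S w -> wpow_if xpredT S (v * w).
Proof.
apply: lspan_mulr => [|{}v {}w [p _ hv] [q _ hw]]; first exact: lspan_subsp.
by apply: lspan_gen; exists (p + q)%N => //; exact: wpow_mul.
Qed.
Lemma wpow_if_1 (E : gca) (S : set E) (P : pred nat) : P 0%N -> wpow_if P S 1.
Proof.
move=> P0; apply: lspan_gen; exists 0%N => //; apply: lspan_gen.
by exists (fun=> 0); rewrite big_ord0; split=> // -[].
Qed.
Lemma wpow_if_gen (E : gca) (S : set E) x : S x -> wpow_if xpredT S x.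
Proof.
move=> Sx; apply: lspan_gen; exists 1%N => //; apply: lspan_gen.
by exists (fun=> x); rewrite big_ord1.
Qed.

Definition addgen (E E' : cdga) (j : dmor E E') (W : set E) (u : E') : set E' :=
  [set w | exists w0 (s : rat), W w0 /\ w = j w0 + s *: u].

Lemma addgen_u (E E' : cdga) (j : dmor E E') (W : set E) u : subsp W -> addgen j W u u.
Proof. by move=> [W0 _]; exists 0, 1; rewrite gm0 scale1r add0r. Qed.
Lemma addgen_j (E E' : cdga) (j : dmor E E') (W : set E) u w : W w -> addgen j W u (j w).
Proof. by move=> Ww; exists w, 0; rewrite scale0r addr0. Qed.

Lemma addgen_graded (E E' : cdga) (j : dmor E E') k z u (P : pred nat) W :
  one_ext j k z u -> P k -> graded P W -> graded P (addgen j W u).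
Proof.
move=> H Pk gW; have Ws := graded_subsp gW.
have As : subsp (addgen j W u).
  split; first by exists 0, 0; rewrite gm0 scale0r addr0; split=> //; case: Ws.
  move=> c _ _ [w [s [Ww ->]]] [w' [s' [Ww' ->]]]; exists (c *: w + w'), (c * s + s').
  split; first exact: Ws.2.
  by rewrite gmD gmZ scalerDr scalerDl scalerA addrACA.
have Au := addgen_u j u Ws; have Aj := addgen_j j (W := W) u.
rewrite /graded; apply/seteqP; split; last exact: (hpart_sub As).
move=> _ [w [s [Ww ->]]].
apply: (subspD (hpart_subsp P _)); last first.
  by apply: (subspZ s (hpart_subsp P _)); apply: hpart_gen Pk Au _; exact: on_gr H.
move: Ww; rewrite {1}gW; apply: lspan_map => v [Wv [i pi gi]].
by split; [exact: Aj | exists i => //; exact: gmor_gr].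
Qed.

Lemma addgen_free (A E E' : cdga) (io : dmor A E) (j : dmor E E') k z u W :
  one_ext j k z u -> free_ext io W -> free_ext (dcomp j io) (addgen j W u).
Proof.
move=> H [gW univ]; have Ws := graded_subsp gW.
split; first exact: (addgen_graded (P := xpredT) H).
have Au := addgen_u j u Ws; have Aj := addgen_j j (W := W) u.
move=> C f g gL gg.
have [||h0 [h01 h02 h0u]] := univ C f (fun w => g (j w)).
- by move=> c v w Wv Ww; rewrite gmD gmZ; apply: gL; exact: Aj.
- by move=> i v Wv gv; apply: gg; [exact: Aj | exact: gmor_gr].
have [h [h1 h2]] := on_univ H h0 (gg _ _ Au (on_gr H)).
exists h; split.
- by move=> a; rewrite dcompE h1 h01.
- move=> _ [w [s [Ww ->]]]; rewrite addrC gL ?gmD ?gmZ //; last exact: Aj.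
  by rewrite h1 h2 h02.
- move=> h' h'1 h'2; apply: (one_eq H) => [a|]; last by rewrite h2 h'2.
  rewrite h1; apply: (h0u (gcomp h' j)) => [b|w Ww]; rewrite gcompE.
    by rewrite -dcompE h'1.
  by rewrite h'2 //; exact: Aj.
Qed.

Lemma addgen_ext (A E E' : cdga) (io : dmor A E) (j : dmor E E') k z u W :
  one_ext j k z u -> subsp W -> (forall e, ext_span io W e) ->
  forall e, ext_span (dcomp j io) (addgen j W u) e.
Proof.
move=> H Ws hE e; have [N [f ->]] := on_gen H e.
have Es : subsp (ext_span (dcomp j io) (addgen j W u)) by exact: lspan_subsp.
apply: subsp_sum => // l _.
have Au := addgen_u j u Ws; have Aj := addgen_j j (W := W) u.
have := ext_span_map (io' := dcomp j io) Aj (fun a => erefl) (hE (f l)).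
have hu : wpow_if xpredT (addgen j W u) (u ^+ l).
  elim: (nat_of_ord l) => [|a ih]; first exact: wpow_if_1.
  by rewrite exprS; apply: wpow_if_mul => //; exact: wpow_if_gen.
move: (j (f l)); apply: lspan_ind.
  split; first by rewrite mul0r; case: Es.
  by move=> a v w hv hw; rewrite mulrDl -scalerAl; exact: Es.2.
move=> _ [a [b [hb ->]]]; apply: lspan_gen; exists a, (b * u ^+ l).
by split; [exact: wpow_if_mul | rewrite mulrA].
Qed.

Lemma one_ft (R R' : cdga) (j : dmor R R') k z u : one_ext j k z u -> (0 < k)%N ->
  (forall i, fin_dim (@gr R i)) -> forall i, fin_dim (@gr R' i).
Proof.
move=> H k0 ft i.
have /choice [s hs] : forall l, exists s : seq R, @gr R l `<=` lspan [set` s].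
  by move=> l; have [s hs] := ft l; exists s.
have [L hL] : exists L : seq nat, L = iota 0 i.+1 by eexists.
exists (flatten [seq [seq j a * u ^+ l | a <- s (i - l * k)%N] | l <- L]) => e ge.
have [N [f [-> f1 f2]]] := one_gr H ge.
apply: subsp_sum => [|l _]; first exact: lspan_subsp.
have [li|li] := leqP (l * k) i; last first.
  by rewrite f2 // gm0 mul0r; case: (lspan_subsp [set` flatten [seq [seq j a * u ^+ l | a <- s (i - l * k)%N] | l <- L]]).
have := hs _ _ (f1 _ li); move: (f l); apply: lspan_ind.
  split.
    by rewrite gm0 mul0r; case: (lspan_subsp [set` flatten [seq [seq j a * u ^+ l | a <- s (i - l * k)%N] | l <- L]]).
  by move=> a v w hv hw; rewrite gmD gmZ mulrDl -scalerAl; exact: (lspan_subsp _).2.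
move=> a /= sa; apply: lspan_gen; rewrite /=; apply/flatten_mapP; exists (nat_of_ord l).
  by rewrite hL mem_iota add0n ltnS /=; nia.
by apply/mapP; exists a.
Qed.

Lemma zmod_id3 (M : zmodType) (e p q r : M) : e - (p + q) + (p + r) = e - (q - r).
Proof. by rewrite opprD [- p - q]addrC !addrA subrK opprB addrA addrAC. Qed.

(** J is an acyclic ideal containing ker rho. The hypotheses on low degrees
    say that A is simply connected and that ker rho starts in degree 4, so
    that all generators adjoined have degree at least 3. *)
Section Killing.
Variables (A B : cdga) (rho : dmor A B) (J : set A).
Hypotheses (rho_surj : forall b, exists a, rho a = b)
  (A0 : forall a : A, gr 0 a -> exists s, a = s *: 1)
  (A1 : forall a : A, gr 1 a -> a = 0)
  (Aft : forall k, fin_dim (@gr A k))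
  (rho_low : forall k a, (k < 4)%N -> gr k a -> rho a = 0 -> a = 0)
  (Js : subsp J) (Jl : forall a i, J i -> J (a * i))
  (rhoJ : forall a, rho a = 0 -> J a)
  (Jacyc : forall k z, J z -> gr k.+1 z -> diff z = 0 ->
     exists eta, [/\ J eta, gr k eta & diff eta = z]).

Record state := State {
  sE : cdga; sI : dmor A sE; sW : set sE; sR : dmor sE B; sT : dmor sE A }.

Arguments sW : clear implicits.

Definition bd (S : state) (z : sE S) := exists2 w, sR S w = 0 & diff w = z.
Definition kcoc (S : state) k (z : sE S) := [/\ gr k z, sR S z = 0 & diff z = 0].
Definition acyc (S : state) k := forall z : sE S, kcoc k z -> bd z.
(** The measure that decreases: an upper bound d for the dimension of the
    cohomology of the kernel in degree k. *)
Definition span_by (S : state) k d := exists h : 'I_d -> sE S,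
  (forall i, kcoc k (h i)) /\
  forall z, kcoc k z -> exists c : 'I_d -> rat, bd (z - \sum_i c i *: h i).

(** The invariant. [g_J] is what allows the retraction to A to be extended;
    [g_0] and [g_1] keep the effect of a new generator of degree k on the
    degrees k and k + 1 under control. *)
Record good (S : state) : Prop := Good {
  g_free : free_ext (sI S) (sW S);
  g_W : graded (leq 1) (sW S);
  g_R : forall a, sR S (sI S a) = rho a;
  g_T : forall a, sT S (sI S a) = a;
  g_J : forall e, sR S e = 0 -> J (sT S e);
  g_ext : forall e, ext_span (sI S) (sW S) e;
  g_0 : forall e : sE S, gr 0 e -> exists s, e = s *: 1;
  g_1 : forall e : sE S, gr 1 e -> e = 0;
  g_ft : forall k, fin_dim (@gr (sE S) k);
  g_low : forall k, (k < 4)%N -> acyc S k }.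

(** One step either finds the kernel acyclic or lowers the dimension of its
    cohomology in the first degree where it is not zero, without disturbing
    lower degrees ([s_prog]). The retraction p of algebras is what makes the
    colimit a set of sequences. *)
Record stepr (S S' : state) (j : dmor (sE S) (sE S')) (p : gmor (sE S') (sE S)) : Prop :=
  Stepr {
  s_p : forall e, p (j e) = e;
  s_I : forall a, j (sI S a) = sI S' a;
  s_R : forall e, sR S' (j e) = sR S e;
  s_T : forall e, sT S' (j e) = sT S e;
  s_W : forall w, sW S w -> sW S' (j w);
  s_dW : forall w, sW S' w -> exists e, diff w = j e;
  s_prog : (forall k, acyc S k) /\ (forall k, acyc S' k) \/
    exists k0, [/\ ~ acyc S k0, forall k, (k < k0)%N -> acyc S k,
      forall k, (k < k0)%N -> acyc S' k &
      forall d, span_by S k0 d -> exists2 d', (d' < d)%N & span_by S' k0 d'] }.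

Lemma bd_subsp S : subsp (@bd S).
Proof.
split; first by exists 0; rewrite ?gm0 ?diff0.
move=> c _ _ [w rw <-] [w' rw' <-]; exists (c *: w + w'); last exact: diffL.
by rewrite gmD gmZ rw rw' scaler0 addr0.
Qed.


Lemma span_by_exists S k : good S -> exists d, span_by S k d.
Proof.
move=> G.
have fd : fin_dim (@kcoc S k) by apply: fin_dim_sub (g_ft G k) => z [].
have [d [h [h1 _ h2]]] := rel_basis fd (bd_subsp S).
by exists d, h; split=> // z /lspan_gen /h2.
Qed.

(** Adjoin u with du = z for a cocycle z of the kernel of the lowest possible
    degree k0 that is not a boundary; send u to 0 in B and, since the image of
    z in A is a cocycle of J, to a primitive in J in A. *)
Lemma step_exists S : good S -> exists S' j p, good S' /\ @stepr S S' j p.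
Proof.
move=> G.
have [acy|nacy] := pselect (forall k, acyc S k).
  exists S, (did _), (gid _); split=> //; split=> // [w Ww|]; last by left.
  by exists (diff w).
have nex : exists k, ~~ `[< acyc S k >].
  by apply: contrapT => h; apply: nacy => k; apply: contrapT => hk; apply: h;
     exists k; apply/negP => /asboolP.
case: (ex_minnP nex) => k0 /asboolP nk0 kmin.
have below k : (k < k0)%N -> acyc S k.
  move=> kk; apply: contrapT => hk; have : ~~ `[< acyc S k >] by apply/asboolP.
  by move=> /kmin; rewrite leqNgt kk.
have k04 : (4 <= k0)%N by rewrite leqNgt; apply/negP => /(g_low G).
have [z [[gz rz dz] nbz]] : exists z : sE S, kcoc k0 z /\ ~ bd z.
  apply: contrapT => h; apply: nk0 => z hz; apply: contrapT => hb; apply: h.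
  by exists z.
have ek0 : k0.-1.+1 = k0 by case: k0 k04 {nk0 kmin below gz}.
pose k := k0.-1; have k3 : (3 <= k)%N by rewrite /k; lia.
have gz1 : gr k.+1 z by rewrite /k ek0.
have [E' [j [u H]]] := one_ext_exists gz1 dz.
have [p [pj _]] := on_univ H (gid (sE S)) (gr0 _ k).
have {}pj e : p (j e) = e by rewrite pj.
have jinj e : j e = 0 -> e = 0 by move=> /(congr1 p); rewrite pj gm0.
have [|R' [R'1 R'2]] := one_map H (f := sR S) (gr0 B k); first by rewrite diff0 rz.
have dtz : diff (sT S z) = 0 by rewrite -dmor_diff dz gm0.
have [eta [Je ge de]] := Jacyc (g_J G rz) (gmor_gr (sT S) gz1) dtz.
have [T' [T'1 T'2]] := one_map H (f := sT S) ge de.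
have Ws := graded_subsp (g_W G).
pose S' := @State E' (dcomp j (sI S)) (addgen j (sW S) u) R' T'.
have kc_low i (e : E') : (i < k)%N -> kcoc (S := S') i e -> exists2 a, kcoc (S := S) i a & e = j a.
  move=> ik [gi ri di]; have [a ga ea] := one_gr_low H gi ik.
  exists a => //; split=> //; first by rewrite -R'1 -ea.
  by apply: jinj; rewrite dmor_diff -ea.
have bdj (a : sE S) : bd (S := S) a -> bd (S := S') (j a).
  by move=> [w rw <-]; exists (j w); rewrite ?dmor_diff //= R'1.
have acy' i : (i < k0)%N -> acyc S' i.
  move=> ik0 e ke; have [ik|ki] := ltnP i k.
    by have [a ka ->] := kc_low i e ik ke; apply: bdj; exact: (below i ik0 a ka).
  have ik : i = k by move: ik0 ki; rewrite -ek0 ltnS -/k; lia.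
  case: ke; rewrite ik => gi ri di.
  have [|a [b [ga gb eab]]] := one_gr_mid H _ gi; first by lia.
  have [s es] := g_0 G gb; move: eab; rewrite es gmZ gm1 -scalerAl mul1r => eab.
  have dab : diff a = - (s *: z).
    apply/eqP; rewrite -addr_eq0; apply/eqP; apply: jinj.
    by rewrite gmD gmZ dmor_diff -(on_d H) -diffZ -diffD -eab.
  have ra : sR S a = 0.
    by have : R' e = 0 := ri; rewrite eab gmD gmZ R'1 R'2 scaler0 addr0.
  have s0 : s = 0.
    apply/eqP; apply: contrapT => /negP s0; apply: nbz.
    exists (- s^-1 *: a); first by rewrite gmZ ra scaler0.
    by rewrite diffZ dab scalerN scaleNr opprK scalerA mulVf // scale1r.
  rewrite eab s0 scale0r addr0; apply: bdj; apply: (below k); first by rewrite -ek0.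
  by split=> //; rewrite dab s0 scale0r oppr0.
exists S', j, p; split.
  split.
  - exact: addgen_free H (g_free G).
  - apply: (addgen_graded H) (g_W G); exact: leq_trans k3.
  - by move=> a; change (R' (j (sI S a)) = rho a); rewrite R'1; exact: g_R.
  - by move=> a; change (T' (j (sI S a)) = a); rewrite T'1; exact: g_T.
  - move=> /= e; have [N [f ->]] := on_gen H e.
    have hX (C : cdga) (h : dmor E' C) : h (\sum_(l < N) j (f l) * u ^+ l) =
        \sum_(l < N) h (j (f l)) * h u ^+ l.
      by rewrite gm_sum; apply: eq_bigr => l _; rewrite gmM gmX.
    rewrite !hX R'2 T'2; case: N {hX} => [|N]; first by rewrite !big_ord0 => _; case: Js.
    rewrite !big_ord_recl !expr0 !mulr1 big1 => [|l _]; last first.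
      by rewrite exprS mul0r mulr0.
    rewrite addr0 R'1 T'1 => /(g_J G) Jf; apply: subspD => //.
    apply: subsp_sum => // l _; rewrite lift0 exprSr mulrA; exact: Jl.
  - exact: addgen_ext H Ws (g_ext G).
  - move=> e ge0; have [|a ga ->] := one_gr_low H ge0; first by lia.
    by have [s ->] := g_0 G ga; exists s; rewrite gmZ gm1.
  - move=> e ge1; have [|a ga ->] := one_gr_low H ge1; first by lia.
    by rewrite (g_1 G ga) gm0.
  - apply: (one_ft H) (g_ft G); exact: leq_trans k3.
  - by move=> i i4; apply: acy'; exact: leq_trans k04.
split=> //.
- by move=> w; exact: addgen_j.
- move=> _ [w [s [Ww ->]]]; exists (diff w + s *: z).
  by rewrite diffD diffZ (on_d H) gmD gmZ dmor_diff.
right; exists k0; split=> // d [h [hk hz]].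
have [c bc] := hz z (And3 gz rz dz).
have [i ci] : exists i, c i != 0.
  apply: contrapT => hn; apply: nbz; rewrite -[z]subr0.
  rewrite (_ : 0 = \sum_i c i *: h i) // big1 // => i _.
  suff -> : c i = 0 by rewrite scale0r.
  by apply/eqP; apply: contrapT => /negP h0; apply: hn; exists i.
case: d h hk hz c bc i ci => [|d] h hk hz c bc i ci; first by case: i ci.
exists d => //; exists (fun l => j (h (lift i l))); split.
  move=> l; have [g1 g2 g3] := hk (lift i l); split; first exact: gmor_gr.
    by rewrite /= R'1.
  by rewrite -dmor_diff g3 gm0.
(* The class of z involves h i with a nonzero coefficient; now that z bounds,
   h i is redundant. *)
have bds' := bd_subsp S'.
have bji : bd (S := S') (j (h i) + \sum_l (c i)^-1 * c (lift i l) *: j (h (lift i l))).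
  have bz : bd (S := S') (j z) by exists u; [exact: R'2 | exact: on_d H].
  have := subspZ (c i)^-1 bds' (subspB bds' bz (bdj _ bc)).
  rewrite gmB opprB addrC subrK gm_sum (bigD1_ord i) //= gmZ scalerDr scalerA mulVf //.
  rewrite scale1r scaler_sumr; congr (bd (_ + _)); apply: eq_bigr => l _.
  by rewrite gmZ scalerA.
move=> e [gE re dE].
have [||a ga ea] := one_gr_high H (g_1 G) _ (e := e); [lia|by rewrite /k ek0|].
have [|b hb] := hz a.
  split; first by rewrite -ek0.
    by have : R' e = 0 := re; rewrite ea R'1.
  by apply: jinj; rewrite dmor_diff -ea.
exists (fun l => b (lift i l) - b i * ((c i)^-1 * c (lift i l))).
have := subspD bds' (bdj _ hb) (subspZ (b i) bds' bji).
rewrite gmB gm_sum (bigD1_ord i) //= gmZ -ea scalerDr zmod_id3 scaler_sumr -sumrB.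
congr (bd (_ - _)); apply: eq_bigr => l _.
by rewrite gmZ scalerA -scalerBl.
Qed.

Lemma graded0 (E : gca) (P : pred nat) : graded P [set (0 : E)].
Proof.
rewrite /graded; apply/seteqP; split; last exact: (hpart_sub (subsp0 E)).
by move=> _ ->; case: (hpart_subsp P [set (0 : E)]).
Qed.

Definition state0 := @State A (did A) [set 0] rho (did A).
Lemma good0 : good state0.
Proof.
split=> //.
- split; first exact: graded0.
  move=> C f g gL gg; exists f; split=> // _ ->.
  have := gL (-1) 0 0 erefl erefl; rewrite scaler0 addr0 scaleN1r addNr => ->.
  exact: gm0.
- exact: graded0.
- move=> e; apply: lspan_gen; exists e, 1; rewrite mulr1; split=> //.
  exact: wpow_if_1.
- move=> k k4 z [gz rz _]; rewrite (rho_low k4 gz rz).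
  by exists 0; rewrite ?gm0 ?diff0.
Qed.

(** Iterating the step makes every degree of the kernel acyclic after finitely
    many steps, the cohomology of the kernel being finite dimensional in each
    degree. In the colimit the kernel of the surjection phi is acyclic, so phi
    is a quasi-isomorphism. *)
Lemma killing_model : homotopy_retraction rho.
Proof.
have nx : forall s : {S | good S}, {s' : {S | good S} &
    {j : dmor (sE (sval s)) (sE (sval s')) &
    {p : gmor (sE (sval s')) (sE (sval s)) | stepr j p}}}.
  move=> [S G]; have /cid [S' /cid [j /cid [p [G' st]]]] := step_exists G.
  by exists (exist _ S' G'), j, p.
pose fs := fix fs i := if i is i'.+1 then projT1 (nx (fs i')) else exist _ state0 good0.
pose S i := sval (fs i); have G i : good (S i) by exact: svalP (fs i).
pose E i := sE (S i).
pose j : chain_j E := fun i => projT1 (projT2 (nx (fs i))).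
pose p : chain_p E := fun i => sval (projT2 (projT2 (nx (fs i)))).
have st i : @stepr (S i) (S i.+1) (j i) (p i) := svalP (projT2 (projT2 (nx (fs i)))).
have pj i a : p i (j i a) = a := s_p (st i) a.
have [C [e [ej esurj einj egr euniv]]] := colim_exists pj.
have epush N i (a : E N) : (N <= i)%N -> exists a' : E i, e i a' = e N a.
  move=> Ni; rewrite -(subnK Ni); elim: (i - N)%N => [|l [a' ih]]; first by exists a.
  by exists (j _ a'); rewrite ej.
pose io : dmor A C := dcomp (e 0%N) (sI (S 0%N)).
have ioE i a : e i (sI (S i) a) = io a.
  by elim: i => [//|i ih]; rewrite -(s_I (st i)) ej.
pose F i : set C := e i @` sW (S i).
have FS i w : F i w -> F i.+1 w.
  by move=> [v Wv <-]; exists (j i v); [exact: (s_W (st i)) | exact: ej].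
have Fle i l w : (i <= l)%N -> F i w -> F l w.
  by move=> il; rewrite -(subnK il); elim: (l - i)%N => // k ih /ih /FS.
pose W := \bigcup_k F k.
have Fs i : subsp (F i) := graded_subsp (graded_map (e i) (g_W (G i))).
have Ws : subsp W.
  split; first by exists 0%N => //; case: (Fs 0%N).
  move=> c x y [i _ Fx] [l _ Fy]; exists (maxn i l) => //; apply: (Fs _).2.
    exact: Fle (leq_maxl _ _) Fx.
  exact: Fle (leq_maxr _ _) Fy.
have gW : graded (leq 1) W.
  rewrite /graded; apply/seteqP; split; last exact: (hpart_sub Ws).
  move=> w [i _ Fw].
  have hm : hpart (leq 1) (F i) w.
    by have := graded_map (e i) (g_W (G i)); rewrite /graded -/(F i) => <-.
  by apply: lspan_mono hm => v [Fv hv]; split=> //; exists i.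
have gWT : graded xpredT W.
  rewrite /graded; apply/seteqP; split; last exact: (hpart_sub Ws).
  rewrite {1}gW; apply: lspan_mono => w [Ww [k _ gk]].
  by split=> //; exists k.
have [phi0 phi0E] := euniv B (fun i => sR (S i)) (fun i a => s_R (st i) a).
have [tau0 tau0E] := euniv A (fun i => sT (S i)) (fun i a => s_T (st i) a).
have phid c : phi0 (diff c) = diff (phi0 c).
  by have [N [a ->]] := esurj c; rewrite -dmor_diff !phi0E dmor_diff.
have taud c : tau0 (diff c) = diff (tau0 c).
  by have [N [a ->]] := esurj c; rewrite -dmor_diff !tau0E dmor_diff.
pose phi := mk_dmor phid; pose tau := mk_dmor taud.
have phiE i a : phi (e i a) = sR (S i) a := phi0E i a.
(* Once the degrees up to k are acyclic, each step that is not trivial in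
   degree k + 1 lowers the number of classes there. *)
have persist k i : (forall l, (l <= k)%N -> acyc (S i) l) ->
    forall l, (l <= k)%N -> acyc (S i.+1) l.
  move=> acy l lk; case: (s_prog (st i)) => [[_ h]|[k0 [nk0 _ h _]]]; first exact: h.
  by apply: h; rewrite ltnNge; apply/negP => kl; apply/nk0/acy/(leq_trans kl).
have persist' k i l : (i <= l)%N -> (forall q, (q <= k)%N -> acyc (S i) q) ->
    forall q, (q <= k)%N -> acyc (S l) q.
  by move=> il; rewrite -(subnK il); elim: (l - i)%N => // d ih /ih /persist.
have reach k : exists i, forall l, (l <= k)%N -> acyc (S i) l.
  elim: k => [|k [i0 hi0]].
    by exists 0%N => l; rewrite leqn0 => /eqP ->; exact: (g_low (G 0%N)).
  have main d : forall i, (i0 <= i)%N -> span_by (S i) k.+1 d ->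
      exists i', (i0 <= i')%N /\ acyc (S i') k.+1.
    elim/ltn_ind: d => d ih i ii0 hd.
    have [acy|nacy] := pselect (acyc (S i) k.+1); first by exists i.
    case: (s_prog (st i)) => [[h _]|[k0 [nk0 below _ hprog]]]; first by case: nacy.
    have ek0 : k0 = k.+1.
      apply/eqP; rewrite eqn_leq; apply/andP; split; rewrite leqNgt; apply/negP => h.
        exact/nacy/below.
      by apply: nk0; apply: (persist' _ _ _ ii0 hi0); rewrite -ltnS.
    have [|d' d'd hd'] := hprog d; first by rewrite ek0.
    by apply: (ih d' d'd i.+1 (leqW ii0)); rewrite -ek0.
  have [d hd] := span_by_exists k.+1 (G i0).
  have [i' [ii' acy]] := main d i0 (leqnn _) hd.
  exists i' => l; rewrite leq_eqVlt => /orP[/eqP ->|]; first exact: acy.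
  by rewrite ltnS; apply: (persist' _ _ _ ii' hi0).
have kacy k c : gr k c -> phi c = 0 -> diff c = 0 -> exists2 w, phi w = 0 & diff w = c.
  move=> gc pc dc; have [i0 hi0] := reach k.
  have [N [a0 ea0]] := esurj c.
  have [a ea] := epush N (maxn N i0) a0 (leq_maxl _ _).
  have {ea0}ea : c = e _ a by rewrite ea.
  have [|w rw dw] := persist' _ _ _ (leq_maxr N i0) hi0 k (leqnn _) a.
    split; first by apply: egr; rewrite -ea.
      by rewrite -phiE -ea.
    by apply: einj; rewrite dmor_diff -ea.
  by exists (e _ w); [rewrite phiE | rewrite -dmor_diff dw -ea].
have kacy' c : phi c = 0 -> diff c = 0 -> exists2 w, phi w = 0 & diff w = c.
  move=> pc dc.
  have /choice [w hw] : forall k, exists w, phi w = 0 /\ diff w = hcomp k c.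
    move=> k; have [||w h1 h2] := kacy k (hcomp k c) (gr_hcomp _ _); last by exists w.
      by rewrite gmor_hcomp pc hcomp0.
    case: k => [|k]; last by rewrite diff_hcomp dc hcomp0.
    by rewrite diff_hcomp dc hcomp0.
  exists (\sum_(k < bnd c) w k).
    by rewrite gm_sum big1 // => k _; case: (hw k).
  rewrite diff_sum [RHS](hcomp_sumE (leqnn (bnd c))); apply: eq_bigr => k _.
  by case: (hw k).
have phi_surj b : exists c, phi c = b.
  by have [a <-] := rho_surj b; exists (io a); rewrite /io dcompE phiE (g_R (G 0%N)).
exists C, io, W, phi, tau; split.
- split=> //; last first.
    exists F; split.
    + move=> k; rewrite /graded; apply/seteqP; split; last exact: (hpart_sub (Fs k)).
      move=> w Fw; have := graded_map (e k) (g_free (G k)).1.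
      by rewrite /graded -/(F k) => <-.
    + by move=> k w; exact: FS.
    + by [].
    + by move=> _ [w -> <-]; exists 0; rewrite ?gm0 ?diff0.
    + move=> k _ [w Ww <-]; have [a da] := s_dW (st k) Ww.
      rewrite -dmor_diff da ej.
      apply: (ext_span_map (io := sI (S k)) _ _ (g_ext (G k) a)); first by move=> v Wv; exists v.
      exact: ioE.
  split=> // D f g gL gg.
  have hx : forall i, {h : gmor (E i) D |
      [/\ forall a, h (sI (S i) a) = f a, forall w, sW (S i) w -> h w = g (e i w) &
       forall h' : gmor (E i) D, (forall a, h' (sI (S i) a) = f a) ->
            (forall w, sW (S i) w -> h' w = g (e i w)) -> forall a, h' a = h a]}.
    move=> i; apply/cid/(g_free (G i)).2 => [c x y Wx Wy|k x Wx gx].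
      by rewrite gmD gmZ; apply: gL; [exists i => //; exists x | exists i => //; exists y].
    by apply: gg; [exists i => //; exists x | exact: gmor_gr].
  pose h i := sval (hx i); have hh i := svalP (hx i).
  have [|H HE] := euniv D h.
    move=> i; have [h1 h2 h3] := hh i; have [h1' h2' _] := hh i.+1.
    apply: (h3 (gcomp (h i.+1) (j i))) => [a|w Ww]; rewrite gcompE.
      by rewrite (s_I (st i)) h1'.
    by rewrite h2' ?ej //; exact: (s_W (st i)).
  exists H; split.
  + by move=> a; rewrite -(ioE 0%N) HE; case: (hh 0%N).
  + by move=> _ [i _ [w Ww <-]]; rewrite HE; case: (hh i) => _ h2 _; exact: h2.
  + move=> H' H'1 H'2 c; have [N [a ->]] := esurj c; rewrite HE.
    have [_ _ h3] := hh N.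
    apply: (h3 (gcomp H' (e N))) => [b|w Ww]; rewrite gcompE.
      by rewrite ioE H'1.
    by apply: H'2; exists N => //; exists w.
- split=> [c dc [b _ db]|b db].
    have [c0 ec0] := phi_surj b.
    have [||w pw dw] := kacy' (c - diff c0).
    + by rewrite gmB dmor_diff ec0 db subrr.
    + by rewrite diffB diffK dc subr0.
    + by exists (w + c0) => //; rewrite diffD dw subrK.
  have [c0 ec0] := phi_surj b.
  have [||w pw dw] := kacy' (diff c0).
  + by rewrite dmor_diff ec0.
  + exact: diffK.
  + exists (c0 - w); split; first by rewrite /cocycle /= diffB dw subrr.
    by exists 0 => //; rewrite diff0 gmB ec0 pw subr0 subrr.
- by move=> a; rewrite /io dcompE phiE (g_R (G 0%N)).
- by move=> a; rewrite /io dcompE mk_dmorE tau0E (g_T (G 0%N)).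
Qed.
End Killing.

(** * The upper bound for the category *)

Section CatUpper.
Variables (A : cdga) (V : set A) (n m : nat) (kx : 'I_n -> nat)
    (ky : 'I_m -> nat) (x : 'I_n -> A) (y : 'I_m -> A)
    (c : 'I_m -> 'I_n -> 'I_n -> rat).
Hypothesis H : model V kx ky x y c.
Hypothesis Hfd : fin_dim_cohomology A.
Variable th : gmor A A.
Hypotheses (thx : forall i, th (x i) = 2 *: x i) (thy : forall i, th (y i) = 2 *: y i).
Let W := wp H.

Lemma V_low v k : V v -> (k < 2)%N -> hcomp k v = 0.
Proof.
move=> /(md_V H) [a [b ->]] k2; rewrite hcompD !hcomp_sum !big1 ?addr0 // => i _.
  rewrite hcompZ (hcomp_gr k (md_ygr H i)); case: eqP => [e|_]; last exact: scaler0.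
  by have [_] := md_ky H i; lia.
rewrite hcompZ (hcomp_gr k (md_xgr H i)); case: eqP => [e|_]; last exact: scaler0.
by have [_] := md_kx H i; lia.
Qed.

Lemma wpow_low l v k : wpow V l v -> (k < 2 * l)%N -> hcomp k v = 0.
Proof.
move=> + kl; move: v; apply: lspan_ind.
  split; first exact: hcomp0.
  by move=> a v w /=; rewrite hcompD hcompZ => -> ->; rewrite scaler0 addr0.
move=> _ [w [hw ->]]; elim: l k kl w hw => [|l ih] k kl w hw; first by lia.
rewrite /= big_ord_recl; set b := \prod_(_ < _) _.
have hb q : (q < 2 * l)%N -> hcomp q b = 0.
  by move=> ql; apply: ih => // i; exact: hw.
rewrite (hcomp_sumE (leqnn (bnd (w ord0)))) (hcomp_sumE (leqnn (bnd b))).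
rewrite mulr_suml hcomp_sum big1 // => i _; rewrite mulr_sumr hcomp_sum big1 // => q _.
have [i2|i2] := ltnP i 2; first by rewrite (V_low (hw ord0)) // mul0r hcomp0.
have [ql|ql] := ltnP q (2 * l); first by rewrite hb // mulr0 hcomp0.
rewrite (hcomp_gr k (grM (gr_hcomp i (w ord0)) (gr_hcomp q b))).
by case: eqP => // e; lia.
Qed.

Lemma gr_wp k l (a : A) : gr k a -> gr k (W l a).
Proof. by move=> ga; rewrite -(hcomp_id ga) /W (wp_hcomp H thx thy); exact: gr_hcomp. Qed.

Lemma wp_low k l (a : A) : gr k a -> (k < 2 * l)%N -> W l a = 0.
Proof.
move=> ga kl; rewrite -(hcomp_id (gr_wp l ga)).
exact: wpow_low (wp_in H l a) kl.
Qed.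

Lemma A_0 (a : A) : gr 0 a -> exists s, a = s *: 1.
Proof.
move=> ga; have [s es] := wpow0E (wp_in H 0 a); exists s; rewrite -es.
apply: (wp_inj (H := H)) => l; rewrite (wp_wpow H thx thy (wp_in H 0 a)).
by case: eqP => [->|] //; case: l => // l _; exact: (wp_low ga).
Qed.
Lemma A_1 (a : A) : gr 1 a -> a = 0.
Proof.
move=> ga; apply: (wp_inj (H := H)) => -[|l].
  have [s es] := wpow0E (wp_in H 0 a); rewrite (wp0 H thx thy) //.
  apply: (@gr_disj A 1 0) => //; first exact: gr_wp.
  by rewrite es; apply: grZ; exact: gr1.
by rewrite (wp0 H thx thy) //; apply: (wp_low ga); lia.
Qed.

Lemma wpow_fd p : exists s : seq A, wpow V p `<=` lspan [set` s].
Proof.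
pose bs := [seq x i | i <- enum 'I_n] ++ [seq y i | i <- enum 'I_m].
have hV v : V v -> lspan [set` bs] v.
  have Ls := lspan_subsp [set` bs].
  move=> /(md_V H) [a [b ->]]; apply: subspD => //; apply: subsp_sum => // i _.
    by apply: subspZ => //; apply: lspan_gen; rewrite /= mem_cat map_f ?mem_enum.
  by apply: subspZ => //; apply: lspan_gen; rewrite /= mem_cat orbC map_f ?mem_enum.
elim: p => [|p [s hs]].
  exists [:: 1] => v /wpow0E [t ->]; apply: subspZ; first exact: lspan_subsp.
  by apply: lspan_gen; rewrite /= mem_seq1.
exists [seq u * v | u <- bs, v <- s]; apply: lspan_ind; first exact: lspan_subsp.
move=> _ [w [hw ->]]; rewrite big_ord_recl; move: (hV _ (hw ord0)) (hs (\prod_(i < p) w (lift ord0 i))) => hv /(_ _) hs'.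
apply: (lspan_mulr (lspan_subsp _) _ hv (hs' _)) => [a b ha hb|].
  by apply: lspan_gen; exact: allpairs_f.
by apply: lspan_gen; exists (fun i => w (lift ord0 i)).
Qed.

Lemma A_ft k : fin_dim (@gr A k).
Proof.
have /choice [s hs] : forall p, exists s : seq A, wpow V p `<=` lspan [set` s] by exact: wpow_fd.
have [L hL] : exists L : seq nat, L = index_iota 0 k.+1 by eexists.
exists (flatten [seq s l | l <- L]) => a ga.
have -> : a = \sum_(l < k.+1) W l a.
  apply: (wp_inj (H := H)) => l; rewrite (wp_sum H thx thy).
  under eq_bigr => i _ do rewrite (wp_wpow H thx thy (wp_in H i a)).
  have [lk|kl] := ltnP l k.+1.
    rewrite (bigD1 (Ordinal lk)) //= eqxx big1 ?addr0 // => i.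
    by rewrite -val_eqE /= eq_sym => /negbTE ->.
  rewrite big1 => [|i _]; last by case: eqP => // e; have := ltn_ord i; lia.
  by apply: (wp_low ga); lia.
apply: subsp_sum => [|l _]; first exact: lspan_subsp.
apply: lspan_mono (hs l _ (wp_in H l a)) => v /= sv.
by apply/flatten_mapP; exists (nat_of_ord l); rewrite // hL mem_index_iota /= ltn_ord.
Qed.

Definition Fge p : set A := wpow_if (leq p) V.
Lemma Fge_subsp p : subsp (Fge p). Proof. exact: lspan_subsp. Qed.
Lemma Fge_in p l v : (p <= l)%N -> wpow V l v -> Fge p v.
Proof. by move=> pl hv; apply: lspan_gen; exists l. Qed.
Lemma FgeP p a : Fge p a <-> forall l, (l < p)%N -> W l a = 0.
Proof.
split.
  move=> + l lp; move: a; apply: lspan_ind.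
    split; first exact: (wp0 H thx thy).
    by move=> s v w /= hv hw; rewrite /W (wpL H thx thy) -/W hv hw scaler0 addr0.
  move=> v [q pq hv]; rewrite /= /W (wp_wpow H thx thy hv).
  by case: eqP => // e; lia.
move=> h; rewrite (wp_sumE (H := H) (leqnn (wbnd H a))).
apply: subsp_sum => [|l _]; first exact: Fge_subsp.
have [lp|pl] := ltnP l p; last exact: Fge_in pl (wp_in H l a).
by rewrite -/(W l a) h //; case: (Fge_subsp p).
Qed.
Lemma Fge_mul p q a b : Fge p a -> Fge q b -> Fge (p + q) (a * b).
Proof.
apply: lspan_mulr => [|{}a {}b [i pi ha] [l ql hb]]; first exact: Fge_subsp.
by apply: (Fge_in (l := i + l)); [exact: leq_add | exact: wpow_mul].
Qed.
Lemma Fge0 a : Fge 0 a. Proof. by apply/FgeP. Qed.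

Lemma Fge_ideal : dg_ideal (Fge m.+1).
Proof.
split.
- exact: Fge_subsp.
- by move=> a i hi; rewrite -[m.+1]add0n; exact: Fge_mul (Fge0 a) hi.
- by move=> a i hi; rewrite -[m.+1]addn0; exact: Fge_mul hi (Fge0 a).
- move=> i /FgeP hi; apply/FgeP => -[|l] lm; first exact: (wp0_diff H thx thy).
  by rewrite /W (wp_diff H thx thy) -/W hi ?diff0 //; exact: ltnW.
- move=> k i /FgeP hi; apply/FgeP => l lm.
  by rewrite /W (wp_hcomp H thx thy) -/W hi // hcomp0.
- move=> /FgeP /(_ 0%N isT) /eqP; rewrite /W.
  have w1 : wpow V 0 1 by rewrite -[1]scale1r; exact: wpow0.
  by rewrite (wp_wpow H thx thy w1) eqxx oner_eq0.
Qed.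

(** Generators have degree at least 2, so length m + 1 means degree at least
    4, except when m = 0. In that case the x_i are cocycles of length 1, which
    are boundaries of constants, so V = 0. *)
Lemma Fge_low k (a : A) : (k < 4)%N -> gr k a -> Fge m.+1 a -> a = 0.
Proof.
move=> k4 ga /FgeP Fa; apply: (wp_inj (H := H)) => l; rewrite (wp0 H thx thy) //.
have [lm|ml] := ltnP l m.+1; first exact: Fa.
have [m0|m0] := posnP m; last by apply: (wp_low ga); lia.
have x0 i : x i = 0.
  have [|||eta [deta weta]] := (md_vanish H thx thy Hfd : vanish th m) 1%N (x i).
  - by rewrite m0.
  - exact: thx.
  - exact: md_dx H i.
  have [s es] := wpow0E (th_wpow H thx thy (k := 0) weta).
  by rewrite -deta es diffZ diff1 scaler0.
have V0 v : V v -> v = 0.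
  move=> /(md_V H) [al [be ->]]; rewrite !big1 ?addr0 // => i _.
    by case: (i) => q qm; exfalso; move: qm; rewrite m0.
  by rewrite x0 scaler0.
case: l ml => [|l] _; first by rewrite m0 in Fa; exact: Fa.
have := wp_in H l.+1 a; move: (wp H l.+1 a); apply: lspan_ind; first exact: subsp0.
by move=> _ [w [hw ->]] /=; rewrite big_ord_recl (V0 _ (hw ord0)) mul0r.
Qed.

(** The ideal J consists of Lambda^(>m) V and the span of a basis h of a
    complement of the cocycles in Lambda^m V. *)
Lemma LScat_upper : LScat_le V m.
Proof.
have [B [rho [rsurj rker]]] := quotient_exists Fge_ideal.
exists B, rho; split=> //.
pose Z := [set a : A | diff a = 0].
have Zs : subsp Z.
  by split; [exact: diff0 | move=> s a b; rewrite /Z /= diffL => -> ->; rewrite scaler0 addr0].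
pose H0 := [set v : A | wpow V m v /\ exists k, gr k v].
have H0fd : fin_dim H0 by apply: fin_dim_sub (wpow_fd m) => v [].
have [d [h [hH hind hspan]]] := rel_basis H0fd Zs.
have /choice [hd hdeg] : forall i, exists k, gr k (h i) by move=> i; case: (hH i).
have hm i : wpow V m (h i) by case: (hH i).
have hsm (b : 'I_d -> rat) : wpow V m (\sum_i b i *: h i).
  by apply: subsp_sum => [|i _]; [exact: wpow_subsp | apply: subspZ; [exact: wpow_subsp|]].
pose J a := exists b : 'I_d -> rat, Fge m.+1 (a - \sum_i b i *: h i).
have [F0 FL] := Fge_subsp m.+1.
have Js : subsp J.
  split; first by exists (fun=> 0); rewrite big1 ?subr0 // => i _; exact: scale0r.
  move=> s a a' [b hb] [b' hb']; exists (fun i => s * b i + b' i).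
  have -> : \sum_i (s * b i + b' i) *: h i = s *: (\sum_i b i *: h i) + \sum_i b' i *: h i.
    by rewrite scaler_sumr -big_split; apply: eq_bigr => i _; rewrite scalerDl scalerA.
  by rewrite opprD addrACA -scalerBr; exact: FL.
have JF a : Fge m.+1 a -> J a.
  by move=> Fa; exists (fun=> 0); rewrite big1 ?subr0 // => i _; exact: scale0r.
have Jh b : J (\sum_i b i *: h i) by exists b; rewrite subrr.
have JFm a : J a -> Fge m a.
  move=> [b hb]; rewrite -[a](subrK (\sum_i b i *: h i)).
  apply: subspD; [exact: Fge_subsp| |exact: Fge_in (leqnn m) (hsm b)].
  by apply/FgeP => l lm; move/FgeP: hb; apply; exact: leqW.
have Jl a i : J i -> J (a * i).
  move=> Ji; have [s es] := wpow0E (wp_in H 0 a).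
  have -> : a * i = s *: i + (a - W 0 a) * i.
    by rewrite mulrBl /W es -scalerAl mul1r addrC subrK.
  apply: subspD => //; first exact: subspZ.
  apply: JF; rewrite -add1n; apply: Fge_mul (JFm _ Ji).
  apply/FgeP => -[|//] _; rewrite /W (wpB H thx thy).
  by rewrite (wp_wpow H thx thy (wp_in H 0 a)) eqxx subrr.
have Jhc k a : J a -> J (hcomp k a).
  move=> [b hb]; exists (fun i => if k == hd i then b i else 0).
  have -> : \sum_i (if k == hd i then b i else 0) *: h i = hcomp k (\sum_i b i *: h i).
    rewrite hcomp_sum; apply: eq_bigr => i _; rewrite hcompZ (hcomp_gr k (hdeg i)).
    by case: eqP; rewrite ?scale0r ?scaler0.
  rewrite -[X in _ - X]scale1r -scaleNr addrC -hcompZ -hcompD scaleN1r addrC.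
  exact: (di_hcomp Fge_ideal).
apply: (killing_model (J := J)) => //.
- exact: A_0.
- exact: A_1.
- exact: A_ft.
- by move=> k a k4 ga /rker Fa; exact: (Fge_low k4 ga Fa).
- by move=> a /rker /JF.
move=> k z Jz gz dz.
(* The component of length m of a cocycle is a cocycle; for an element of J it
   is also a combination of the h_i, hence zero. *)
have Fz : Fge m.+1 z.
  have [b hb] := Jz; pose c' := \sum_i b i *: h i.
  have e : W m z = c'.
    have /FgeP /(_ m (leqnn _)) := hb; rewrite /W (wpB H thx thy) -/c'.
    by rewrite (wp_wpow H thx thy (hsm b)) eqxx => /eqP; rewrite subr_eq0 => /eqP.
  have dc' : Z c' by rewrite /Z /= -e /W -(wp_diff H thx thy) dz (wp0 H thx thy).
  have b0 := hind b dc'.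
  suff e0 : \sum_i b i *: h i = 0 by move: hb; rewrite e0 subr0.
  by rewrite big1 // => i _; rewrite b0 scale0r.
(* The component of length m + 1 bounds an element of length m, which may be
   changed by a cocycle to lie in the span of the h_i; longer components bound
   elements of Lambda^(>m) V. *)
have /choice [e he] : forall l, exists e, [/\ J e, diff e = W l.+1 z & (m < l)%N -> Fge m.+1 e].
  move=> l; have [lm|ml] := ltnP l m.
    exists 0; split; [by case: Js | rewrite diff0; apply/esym; move/FgeP: Fz; exact | by []].
  have [|||e [de we]] := (md_vanish H thx thy Hfd : vanish th m) l.+1 (W l.+1 z).
  - by rewrite ltnS.
  - exact: (wpow_th H thx thy (wp_in H _ _)).
  - by rewrite /W -(wp_diff H thx thy) dz (wp0 H thx thy).
  have ew : wpow V l e := th_wpow H thx thy we.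
  have [lm|ml'] := eqVneq l m; last first.
    have Fe : Fge m.+1 e by apply: Fge_in ew; rewrite ltn_neqAle eq_sym ml'.
    by exists e; split=> //; exact: JF.
  have [|b hb] := hspan e.
    rewrite (hcomp_sumE (leqnn (bnd e))); apply: subsp_sum => [|i _]; first exact: lspan_subsp.
    apply: lspan_gen; split; last by exists i; exact: gr_hcomp.
    by apply: (th_wpow H thx thy); rewrite gmor_hcomp we /= hcompZ lm.
  exists (\sum_i b i *: h i); split=> //; last by rewrite lm ltnn.
  by rewrite -de; apply/esym/eqP; rewrite -subr_eq0 -diffB; apply/eqP.
pose eta := \sum_(l < wbnd H z) e l.
have deta : diff eta = z.
  rewrite diff_sum [RHS](wp_sumE (H := H) (leqW (leqnn (wbnd H z)))) big_ord_recl.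
  have -> : wp H 0 z = 0 by move/FgeP: Fz; exact.
  by rewrite add0r; apply: eq_bigr => l _; case: (he l).
exists (hcomp k eta); split; last by rewrite diff_hcomp deta hcomp_id.
- by apply: Jhc; apply: subsp_sum => // l _; case: (he l).
- exact: gr_hcomp.
Qed.
End CatUpper.

(** * The inequality *)

(** The unit is not a boundary because a differential has no component of
    degree 0. *)
Lemma has_odd_product0 (A : cdga) (V : set A) (n m : nat) (kx : 'I_n -> nat)
    (ky : 'I_m -> nat) (x : 'I_n -> A) (y : 'I_m -> A) c :
  model V kx ky x y c -> lin_indep x -> has_odd_product V x 0.
Proof.
move=> H xi.
have [E [j [u T]]] := md_squares H.
have [fr ui] := ot_free T.
exists E, j, u, (fun=> 0); split; [|by case|].
  split=> // [i k gk|i]; last by rewrite (ot_d T) gmX.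
  have [e|ne] := eqVneq (kx i) k; first by rewrite -e; exact: ot_gr T i.
  have /eqP := gr_disj (md_xgr H i) gk ne.
  by rewrite (negbTE (lin_indep_neq0 i xi)).
rewrite big_ord0 => -[w _ dw]; have := hcomp0_diff w; rewrite dw (hcomp_id (gr1 E)).
by move=> /eqP; rewrite oner_eq0.
Qed.

(** [the_nat] picks its value by choice, so uniqueness is needed to compute
    it. *)
Lemma the_natP (Q : set nat) k : Q k -> (forall l, Q l -> l = k) ->
  the_nat Q = (Posz k)%:E.
Proof.
move=> Qk Qu; rewrite /the_nat; case: pselect => [h|]; last by case; exists k.
by rewrite (Qu _ (svalP (cid h))).
Qed.

Lemma nat_minP (P : set nat) n : P n -> exists k, [/\ nat_min P = (Posz k)%:E, P k &
  forall l, P l -> (k <= l)%N].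
Proof.
move=> Pn; have ex : exists l, `[< P l >] by exists n; exact/asboolP.
case: (ex_minnP ex) => k /asboolP Pk kmin; exists k.
have kl l : P l -> (k <= l)%N by move=> Pl; apply: kmin; exact/asboolP.
split=> //; apply: the_natP => // l [Pl lmin].
by apply/eqP; rewrite eqn_leq lmin ?kl.
Qed.

Lemma nat_maxP (P : set nat) n N : P n -> (forall l, P l -> (l <= N)%N) ->
  exists k, nat_max P = (Posz k)%:E /\ P k.
Proof.
move=> Pn PN; have ex : exists l, `[< P l >] by exists n; exact/asboolP.
have bound l : `[< P l >] -> (l <= N)%N by move=> /asboolP /PN.
case: (ex_maxnP ex bound) => k /asboolP Pk kmax; exists k.
have kl l : P l -> (l <= k)%N by move=> Pl; apply: kmax; exact/asboolP.
split=> //; apply: the_natP => // l [Pl lmax].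
by apply/eqP; rewrite eqn_leq lmax ?kl.
Qed.

Theorem theorem3 (r : nat) (A : cdga) (V : set A) (n : nat) (x : 'I_n -> A)
    (hr : (2 <= r)%N)
    (hmodel : sullivan_model V) (hmin : minimal V)
    (hcoformal : coformal V) (hpure : pure V) (hell : elliptic V)
    (hx : hom_basis (even_part V) x) :
  ((Posz r.-1)%:E * LScat V + Lprod V x <= TC r A)%E.
Proof.
have [m [kx [ky [y [c H]]]]] := model_exists hmodel hcoformal hpure hell hx.
have [[N TCN]|noTC] := pselect (exists N, TC_le r A N); last first.
  rewrite [TC _ _](_ : _ = +oo%E) ?leey // /TC /nat_min /the_nat.
  case: pselect => // h; case: noTC; have [N [TCN _]] := h; by exists N.
have [N0 [eN TCN0 _]] := nat_minP TCN; rewrite [TC _ _]eN {eN}.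
have [th [thx thy]] := md_univ H (fun i => grZ 2 (md_xgr H i)) (fun i => grZ 2 (md_ygr H i)).
have [k [ek _ km]] := nat_minP (LScat_upper H hell.2 thx thy); rewrite [LScat V]ek {ek}.
case: r hr TCN TCN0 => [//|[//|r]] _ _ TCN0.
have bound i : has_odd_product V x i -> (r.+1 * m + i <= N0)%N.
  by move=> hi; exact: (TC_lower H hi TCN0).
have [||l [el hl]] := nat_maxP (has_odd_product0 H _) (N := N0).
- by case: hx.
- by move=> i /bound; lia.
rewrite [Lprod V x]el {el}.
have := bound l hl; have := km _ (LScat_upper H hell.2 thx thy) => km' lN.
rewrite -EFinM -EFinD lee_fin -PoszM -PoszD lez_nat.
by apply: leq_trans lN; rewrite leq_add2r leq_mul2l km' orbT.
Qed.
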